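(* Let $H\in(0,1)$, $1<\alpha\le2$, and let $Z^H=\{Z^H(t),t\ge0\}$, $Z^H(t)=W^H(L_t)$, be the $\alpha$-stable local time $H$-fractional Brownian motion with values in $\mathbb{R}$. Then for any $0\le a<b<\infty$, $$\lim_{x\to\infty}\frac{\log\mathbb{P}\{|Z^H(b)-Z^H(a)|>x\}}{x^{\frac{2\alpha}{\alpha+2H}}}=-B_2,$$ where $B_2$ is the positive constant $$B_2=\frac{\alpha+2H}{2\alpha}\left(\frac{H\,A_1^\alpha}{(1-\frac1\alpha)^{\alpha-1}}\right)^{-\frac{2H}{\alpha+2H}}(b-a)^{-\frac{2H(\alpha-1)}{\alpha+2H}}$$ and $$A_1=\frac{\Gamma(1-\frac1\alpha)\,\Gamma(\frac1\alpha)\,\chi^{1/\alpha}\cos\big(\frac1\alpha\arctan(\nu\tan(\frac{\pi\alpha}{2}))\big)}{\pi\alpha\,[1+(\nu\tan(\frac{\pi\alpha}{2}))^2]^{1/(2\alpha)}}.$$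
   Context: $W^H=\{W^H(t),t\in\mathbb{R}\}$ is a real-valued fractional Brownian motion of Hurst index $H$: a centered Gaussian process with continuous sample paths, $W^H(0)=0$ and $\mathbb{E}(W^H(s)W^H(t))=\frac12(|s|^{2H}+|t|^{2H}-|s-t|^{2H})$. $X=\{X_t,t\ge0\}$ is a real-valued strictly stable Lévy process of index $\alpha\in(1,2]$ (with $X_0=0$), independent of $W^H$, with characteristic function $\mathbb{E}[e^{i\xi X_t}]=\exp\big(-t|\xi|^\alpha\frac{1+i\nu\,\mathrm{sgn}(\xi)\tan(\pi\alpha/2)}{\chi}\big)$, where $-1\le\nu\le1$ and $\chi>0$ are constants. The local time $L(x,t)$ of $X$ is the density with respect to Lebesgue measure of the occupation measure $A\mapsto\lambda_1\{s\in[0,t]:X_s\in A\}$, in a version jointly continuous in $(x,t)$; $L_t:=L(0,t)$ is the local time at zero. $Z^H(t)=W^H(L_t)$ for $t\ge0$. *)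

(* Defs.v *)
From HB Require Import structures.
From mathcomp Require Import all_boot all_order all_algebra.
From mathcomp Require Import complex.
From mathcomp Require Import all_classical all_reals all_analysis.
Import Order.TTheory GRing.Theory Num.Theory.
Import numFieldNormedType.Exports.

Set Implicit Arguments.
Unset Strict Implicit.
Unset Printing Implicit Defensive.

Local Open Scope classical_set_scope.
Local Open Scope complex_scope.
Local Open Scope ring_scope.

(* Meaningful for 0 < a, where the integral converges. *)
Definition Gamma {R : realType} (a : R) : R :=
  Rintegral lebesgue_measure `]0, +oo[ (fun x => x `^ (a - 1) * expR (- x)).

Definition cexp {R : realType} (z : R[i]) : R[i] :=
  (expR (complex.Re z))%:C * (cos (complex.Im z) +i* sin (complex.Im z)).

Section processes.
Context {d : measure_display} {T : measurableType d} {R : realType}.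
Variable P : probability T R.

(* E[exp (i xi Y)] = E[cos (xi Y)] + i E[sin (xi Y)] *)
Definition charfun (Y : T -> R) (xi : R) : R[i] :=
  fine ('E_P[fun w => cos (xi * Y w)]) +i* fine ('E_P[fun w => sin (xi * Y w)]).

Definition same_law (Y Y' : T -> R) : Prop :=
  forall A : set R, measurable A -> P (Y @^-1` A) = P (Y' @^-1` A).

(* [normal_prob m 0] is a dummy law (uniform on [0, 1]), so that the degenerate
   Gaussian laws are listed separately. *)
Definition gaussian (Y : T -> R) : Prop :=
  exists m s : R, 0 <= s /\
    forall A : set R, measurable A ->
      P (Y @^-1` A) = if s == 0 then dirac m A else normal_prob m s A.

Definition gaussian_process (Y : R -> T -> R) : Prop :=
  forall (n : nat) (t c : 'I_n -> R),
    gaussian (fun w => \sum_(i < n) c i * Y (t i) w).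

(* Taking B i = setT for some of the i gives the product rule for subfamilies. *)
Definition mutually_independent (n : nat) (Y : 'I_n -> T -> R) : Prop :=
  forall B : 'I_n -> set R, (forall i, measurable (B i)) ->
    P (\bigcap_(i in [set: 'I_n]) (Y i @^-1` B i)) =
    (\prod_(i < n) P (Y i @^-1` B i))%E.

Definition process_sigma (D : set R) (Y : R -> T -> R) : set_system T :=
  <<s \bigcup_(t in D) g_sigma_algebra_preimage (Y t) >>.

Definition independent_processes (D D' : set R) (Y Y' : R -> T -> R) : Prop :=
  forall E F : set T, process_sigma D Y E -> process_sigma D' Y' F ->
    P (E `&` F) = (P E * P F)%E.

(* The paths are continuous for every w: this makes w |-> W (Y w) w measurable
   for every random variable Y. *)
Record is_fbm (H : R) (W : R -> {RV P >-> R}) : Prop := IsFbm {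
  fbm_gaussian : gaussian_process (fun t => W t : T -> R) ;
  fbm_centered : forall t, ('E_P[W t] = 0)%E ;
  fbm_covariance : forall s t,
    ('E_P[fun w => (W s w * W t w)%R])%E =
    (2^-1 * (`|s| `^ (2 * H) + `|t| `^ (2 * H) - `|s - t| `^ (2 * H)))%:E ;
  fbm_start : {ae P, forall w, W 0 w = 0} ;
  fbm_continuous : forall w, continuous (fun t => W t w) }.

(* Only the restriction of X to the times 0 <= t is meaningful. *)
Record is_levy (X : R -> {RV P >-> R}) : Prop := IsLevy {
  levy_start : {ae P, forall w, X 0 w = 0} ;
  levy_independent_increments : forall (n : nat) (t : nat -> R),
    0 <= t 0%N -> (forall i, t i <= t i.+1) ->
    mutually_independent (fun (i : 'I_n) w => X (t i.+1) w - X (t i) w) ;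
  levy_stationary_increments : forall s t, 0 <= s -> s <= t ->
    same_law (fun w => X t w - X s w) (X (t - s)) ;
  levy_cadlag : {ae P, forall w,
    (forall t, 0 <= t -> X s w @[s --> t^'+] --> X t w) /\
    (forall t, 0 < t -> cvg (X s w @[s --> t^'-]))} }.

Definition is_stable_levy (alpha nu chi : R) (X : R -> {RV P >-> R}) : Prop :=
  is_levy X /\
  forall t xi, 0 <= t ->
    charfun (X t) xi =
    cexp (- ((t * `|xi| `^ alpha)%:C *
             ((1 +i* (nu * Num.sg xi * tan (pi * alpha / 2))) / chi%:C))).

Record is_local_time (X : R -> {RV P >-> R}) (L : R -> R -> {RV P >-> R}) :
    Prop := IsLocalTime {
  local_time_density : {ae P, forall w, forall t, 0 <= t ->
    forall A : set R, measurable A ->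
      lebesgue_measure (`[0, t] `&` [set s | A (X s w)]) =
      (\int[lebesgue_measure]_(x in A) (L x t w)%:E)%E} ;
  local_time_continuous : {ae P, forall w,
    {within [set xt : R * R | 0 <= xt.2],
      continuous (fun xt : R * R => L xt.1 xt.2 w)}} }.

Definition local_time_fbm (W : R -> {RV P >-> R}) (L : R -> R -> {RV P >-> R})
  (t : R) (w : T) : R := W (L 0 t w) w.

End processes.

Definition A1 {R : realType} (alpha nu chi : R) : R :=
  Gamma (1 - alpha^-1) * Gamma alpha^-1 * chi `^ alpha^-1
    * cos (alpha^-1 * atan (nu * tan (pi * alpha / 2)))
  / (pi * alpha * (1 + (nu * tan (pi * alpha / 2)) ^+ 2) `^ (2 * alpha)^-1).

Definition B2 {R : realType} (H alpha nu chi a b : R) : R :=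
  (alpha + 2 * H) / (2 * alpha)
  * (H * A1 alpha nu chi `^ alpha / (1 - alpha^-1) `^ (alpha - 1))
      `^ (- (2 * H / (alpha + 2 * H)))
  * (b - a) `^ (- (2 * H * (alpha - 1) / (alpha + 2 * H))).

(* Main.v *)
Require Import Defs.
From HB Require Import structures.
From mathcomp Require Import all_boot all_order all_algebra.
From mathcomp Require Import complex.
From mathcomp Require Import all_classical all_reals all_analysis.
From mathcomp Require Import measurable_realfun ring lra zify.
Import Order.TTheory GRing.Theory Num.Theory.
Import numFieldNormedType.Exports.

Local Open Scope classical_set_scope.
Local Open Scope ring_scope.

(** Given the path of [X], the increment of [Z] is a centred Gaussian variable with
    variance [U `^ (2 * H)], where [U] is the increment of the local time at zero over
    the interval from [a] to [b] ([time_changed_tail], [fbm_increment_law]).  The tail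
    is therefore of the order of the expectation of [expR (- x ^+ 2 / (2 * U `^ (2 * H)))],
    and everything rests on the exponential moments of [U]: with [theta = 1 - alpha^-1]
    and [rho = theta^-1], the logarithm of the expectation of [expR (g * U)] is
    equivalent, for large [g], to [A1 `^ rho * (b - a) * g `^ rho]
    ([local_time_moment_upper], [local_time_moment_lower]).

    These moments come from a renewal argument.  The local time is the limit, as the
    width [e] tends to 0, of the integrals of [tent e (X s)] over [s], and these are limits
    of Riemann sums.  The exponential of a Riemann sum is a product; expanding it and
    using the Markov property ([hit_weight_markov_bounds]) bounds its expectation by the
    solution of a discrete renewal equation whose kernel is [g] times the mesh times the
    expectation of [tent e (x + X s)], with [x] close to 0.  Fourier inversion
    ([tent_fourier], [expectation_tent_stable_near]) shows that this expectation is close to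
    [c * s `^ (theta - 1)], where [c] is the density of [X 1] at 0, an explicit Gamma
    integral.  The growth rate [la] solves [g * c * Gamma theta * la `^ (- theta) = 1], that
    is, [la = (g * A1) `^ rho], because [A1 = c * Gamma theta] ([kernel_peakE]).  The
    inequalities [renewal_upper] and [renewal_lower] turn this into two-sided bounds
    that are uniform in the mesh and in the width, so that they pass to the limit.

    The theorem is then a saddle point computation.  For the upper bound,
    [x ^+ 2 / (2 * u `^ (2 * H)) + g * u] is bounded below for all [u] by its value at the
    saddle ([saddle_minimum]), so the Gaussian factor is at most a constant times
    [expR (g * U)].  For the lower bound it is enough that [U] reach the saddle time; under
    the law tilted by [expR (g * U)] this is likely, because the moments at tilts slightly
    smaller and larger than [g] exclude other values ([tail_lower]).  The two bounds have
    the same exponent, which is [B2] times [x `^ rate_exponent alpha H]. *)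

(** * Integration over the half-line *)

Section halfline.
Context {R : realType}.
Notation mu := (@lebesgue_measure R).
Implicit Types (f g F G : R -> R).

Lemma pos_itvP (x : R) : `]0, +oo[%classic x <-> 0 < x.
Proof. by rewrite /= in_itv/= andbT. Qed.

Lemma measurable_halfline f :
  (forall x : R, 0 < x -> {for x, continuous f}) -> measurable_fun (`]0, +oo[ : set R) f.
Proof.
move=> cf; apply: open_continuous_measurable_fun => //.
by move=> x /set_mem/pos_itvP; exact: cf.
Qed.

Lemma integrable_halfline_le f g :
  (forall x : R, 0 < x -> {for x, continuous f}) ->
  mu.-integrable `]0, +oo[ (EFin \o g) ->
  (forall x : R, 0 < x -> `|f x| <= g x) ->
  mu.-integrable `]0, +oo[ (EFin \o f).
Proof.
move=> cf ig fg; apply: (le_integrable _ _ _ ig) => //.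
  by apply/measurable_EFinP; exact: measurable_halfline.
move=> x /pos_itvP x0 /=; rewrite lee_fin.
exact: le_trans (fg _ x0) (ler_norm _).
Qed.

Let cut (n : nat) : set R := `[n.+1%:R^-1, n.+2%:R].

Lemma cut_sub n : cut n `<=` `]0, +oo[.
Proof.
move=> x; rewrite /cut /= !in_itv/= andbT => /andP[+ _].
by apply: lt_le_trans; rewrite invr_gt0.
Qed.

Lemma near_cut (x : R) : 0 < x -> \forall n \near \oo, cut n x.
Proof.
move=> x0; near=> n; rewrite /cut /= in_itv/=; apply/andP; split.
  rewrite invf_ple ?posrE//; apply: (@le_trans _ _ n%:R); last by rewrite ler_nat.
  by near: n; exact: nbhs_infty_ger.
apply: (@le_trans _ _ n%:R); last by rewrite ler_nat leqW.
by near: n; exact: nbhs_infty_ger.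
Unshelve. all: by end_near. Qed.

Lemma ndecr_cut : {homo cut : n m / (n <= m)%N >-> (n <= m)%O}.
Proof.
move=> n m nm; apply/subsetPset => x; rewrite /cut/= !in_itv/= => /andP[xn nx].
apply/andP; split; last by rewrite (le_trans nx)// ler_nat.
by rewrite (le_trans _ xn)// lef_pV2 ?posrE// ler_nat.
Qed.

Lemma bigcup_cut : \bigcup_n cut n = `]0, +oo[%classic.
Proof.
apply/seteqP; split => [x [n _]|x /pos_itvP x0]; first exact: cut_sub.
by have [n _ /(_ n (leqnn n)) xn] := near_cut x x0; exists n.
Qed.

Let cutlt n : n.+1%:R^-1 < n.+2%:R :> R.
Proof.
rewrite (@le_lt_trans _ _ 1)//; last by rewrite ltr1n.
by rewrite invf_le1// ler1n.
Qed.

Let integral_cut F f n :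
  (forall x : R, 0 < x -> is_derive x 1 F (f x)) ->
  (forall x : R, 0 < x -> {for x, continuous f}) ->
  (\int[mu]_(x in cut n) (f x)%:E = (F n.+2%:R - F n.+1%:R^-1)%:E)%E.
Proof.
move=> dF cf.
have cutoo x : x \in `]n.+1%:R^-1, n.+2%:R[ -> 0 < x.
  by rewrite in_itv/= => /andP[+ _]; apply: lt_trans; rewrite invr_gt0.
rewrite (continuous_FTC2 (cutlt n) _ _ _ (F := F))//.
- apply: continuous_in_subspaceT => x /set_mem/cut_sub/pos_itvP; exact: cf.
- have Fc (x : R) : 0 < x -> {for x, continuous F}.
    move=> x0; apply: differentiable_continuous; apply/derivable1_diffP.
    by have [] := dF _ x0.
  split.
  + by move=> x /cutoo/dF[].
  + by apply: cvg_at_right_filter; apply: Fc; rewrite invr_gt0.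
  + by apply: cvg_at_left_filter; apply: Fc.
- by move=> x /cutoo/dF[]; rewrite derive1E.
Qed.

Let cvg_cut F (l0 l1 : R) :
  F x @[x --> 0^'+] --> l0 -> F x @[x --> +oo] --> l1 ->
  (F n.+2%:R - F n.+1%:R^-1)%:E @[n --> \oo] --> (l1 - l0)%:E.
Proof.
move=> F0 Fy; apply: cvg_EFin; first by near=> n.
apply: cvgB.
  move/cvg_pinftyP : Fy; apply.
  by have := @cvgr_idn R; rewrite -(cvg_shiftn 2); under eq_fun do rewrite addn2.
move/cvg_at_rightP : F0; apply; split; first by move=> n; rewrite invr_gt0.
exact: cvg_harmonic.
Unshelve. all: by end_near. Qed.

(** The half-line is exhausted by the segments [cut n], and monotone convergence
    applies; since no integrability is assumed, the formula also serves to prove it. *)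
Lemma FTC2_halfline_ge0 F f (l0 l1 : R) :
  (forall x : R, 0 < x -> is_derive x 1 F (f x)) ->
  (forall x : R, 0 < x -> {for x, continuous f}) ->
  (forall x : R, 0 < x -> 0 <= f x) ->
  F x @[x --> 0^'+] --> l0 -> F x @[x --> +oo] --> l1 ->
  (\int[mu]_(x in `]0%R, +oo[) (f x)%:E = (l1 - l0)%:E)%E.
Proof.
move=> dF cf f0 F0 Fy; apply: (cvg_unique _ _ (cvg_cut _ _ _ F0 Fy)) => //.
rewrite (_ : (fun n => (F n.+2%:R - F n.+1%:R^-1)%:E) =
    (fun n => \int[mu]_(x in cut n) (f x)%:E)%E); last first.
  by apply/funext => n; rewrite (integral_cut F).
rewrite -bigcup_cut /=.
have := @ge0_nondecreasing_set_cvg_integral _ (measurableTypeR R) R cut (EFin \o f) mu.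
apply.
- exact: ndecr_cut.
- by move=> n; exact: measurable_itv.
- move=> n; apply/measurable_EFinP; apply: measurable_funS (measurable_halfline _ cf) => //.
  exact: cut_sub.
- by move=> n x /cut_sub/pos_itvP x0; rewrite lee_fin f0.
Qed.

(** Signed counterpart, by dominated convergence along the same segments. *)
Lemma FTC2_halfline F f (l0 l1 : R) :
  (forall x : R, 0 < x -> is_derive x 1 F (f x)) ->
  (forall x : R, 0 < x -> {for x, continuous f}) ->
  mu.-integrable `]0, +oo[ (EFin \o f) ->
  F x @[x --> 0^'+] --> l0 -> F x @[x --> +oo] --> l1 ->
  \int[mu]_(x in `]0, +oo[) f x = l1 - l0.
Proof.
move=> dF cf intf F0 Fy.
have lim1 := cvg_cut _ _ _ F0 Fy.
have lim2 : (F n.+2%:R - F n.+1%:R^-1)%:E @[n --> \oo] --> (\int[mu]_(x in `]0%R, +oo[) (f x)%:E)%E.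
  rewrite [X in X @ _ --> _](_ : _ = fun n => \int[mu]_x ((EFin \o f) \_ (cut n)) x)%E; last first.
    by apply/funext => n; rewrite -(integral_cut F f)// integral_mkcond.
  rewrite integral_mkcond.
  have := @dominated_cvg _ _ _ mu setT measurableT (fun n => (EFin \o f) \_ (cut n))
    ((EFin \o f) \_ `]0, +oo[) ((EFin \o (Num.norm \o f)) \_ `]0, +oo[).
  apply => //.
  - move=> n; have mc : measurable (cut n) by exact: measurable_itv.
    apply: (iffLR (measurable_restrictT (EFin \o f) mc)).
    apply/measurable_EFinP; apply: measurable_funS (measurable_halfline _ cf) => //.
    exact: cut_sub.
  - move=> x _; have [x0|x0] := ltP 0 x.
      rewrite patchE mem_set; last exact/pos_itvP.
      apply: (cvg_trans (near_eq_cvg _)); last exact: cvg_cst.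
      by near=> n; rewrite patchE mem_set//; near: n; exact: near_cut.
    rewrite (_ : (fun n => _) = cst 0%E); last first.
      apply/funext => n; rewrite patchE memNset// => /cut_sub/pos_itvP.
      by rewrite ltNge x0.
    by rewrite patchE memNset; [exact: cvg_cst|move/pos_itvP; rewrite ltNge x0].
  - by move=> x _; rewrite patchE; case: ifP.
  - by apply/integrable_restrict => //; rewrite setTI; exact: integrable_norm.
  - move=> n x _; have [xc|xc] := pselect (cut n x).
      by rewrite !patchE !mem_set//; exact: cut_sub xc.
    have -> : ((EFin \o f) \_ (cut n)) x = 0%E by rewrite patchE memNset.
    rewrite abse0 patchE; case: ifP => _; first by rewrite lee_fin normr_ge0.
    exact: lexx.
by rewrite /Rintegral (cvg_unique _ lim2 lim1).
Unshelve. all: by end_near. Qed.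

End halfline.

(** * Gamma integrals *)

Section gamma_integrals.
Context {R : realType}.
Notation mu := (@lebesgue_measure R).
Implicit Types (f g F G : R -> R).

(** [1 + v <= expR v] at [v = u / (2 * s)], raised to the power [s]. *)
Lemma powR_le_expR (s u : R) : 0 < s -> 0 < u -> u `^ s <= (2 * s) `^ s * expR (u / 2).
Proof.
move=> s0 u0; have s20 : 0 < 2 * s by rewrite mulr_gt0.
have {1}-> : u = (2 * s) * (u / (2 * s)) by rewrite mulrCA divff ?mulr1// gt_eqF.
have v0 : 0 < u / (2 * s) by rewrite divr_gt0.
rewrite (powRM _ (ltW s20) (ltW v0)); set v := u / (2 * s).
have -> : u / 2 = v * s by rewrite /v; field; rewrite gt_eqF.
rewrite ler_pM2l ?powR_gt0// expRM.
apply: ge0_ler_powR; rewrite ?nnegrE ?expR_ge0 ?(ltW s0) ?(ltW v0)//.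
by apply: le_trans (expR_ge1Dx _); rewrite lerDr.
Qed.

Lemma cvgy_powR (s : R) : 0 < s -> u `^ s @[u --> +oo] --> +oo.
Proof.
move=> s0; apply/cvgryPge => A; near=> u.
have B0 : 0 < Num.max A 1 by rewrite lt_max ltr01 orbT.
apply: (@le_trans _ _ (Num.max A 1)); first by rewrite le_max lexx.
have -> : Num.max A 1 = (Num.max A 1 `^ s^-1) `^ s.
  by rewrite -powRrM mulVf ?gt_eqF// powRr1// ltW.
have uB : Num.max A 1 `^ s^-1 <= u by near: u; exact: nbhs_pinfty_ge.
apply: ge0_ler_powR; rewrite ?nnegrE ?powR_ge0 ?(ltW s0)//.
Unshelve. all: by end_near. Qed.

Lemma cvgy_powRN (s : R) : 0 < s -> u `^ (- s) @[u --> +oo] --> (0 : R).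
Proof.
move=> s0; under eq_cvg do rewrite powRN.
apply/gtr0_cvgV0; last exact: cvgy_powR.
by near=> u; rewrite powR_gt0.
Unshelve. all: by end_near. Qed.

Lemma continuous_powR (p x : R) : 0 < x -> {for x, continuous (fun u => u `^ p)}.
Proof.
move=> x0; apply: differentiable_continuous; apply/derivable1_diffP.
by have [] := is_derive1_powR p x0.
Qed.

Lemma is_derive1_cast f (df df' x : R) :
  is_derive x 1 f df -> df = df' -> is_derive x 1 f df'.
Proof. by move=> H <-. Qed.

Lemma is_derive_expRN (x : R) :
  is_derive x 1 (fun u => expR (- u)) (- expR (- x)).
Proof.
have := is_derive1_comp (is_derive_expR (- x)) (is_deriveNid x 1).
by move/is_derive1_cast; apply; rewrite mulrN1.
Qed.

Lemma is_derive_expRNM (c x : R) :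
  is_derive x 1 (fun u => expR (- c * u)) (- c * expR (- c * x)).
Proof.
have := is_derive1_comp (is_derive_expR (- c * x)) (is_deriveZ (- c) (is_derive_id x 1)).
by move/is_derive1_cast; apply; rewrite /GRing.scale/= mulr1 mulrC.
Qed.

Lemma continuous_expRNM (c : R) : continuous (fun u => expR (- c * u)).
Proof.
move=> x; apply: differentiable_continuous; apply/derivable1_diffP.
by have [] := is_derive_expRNM c x.
Qed.

Lemma cvgy_expRNM (c : R) : 0 < c -> expR (- c * u) @[u --> +oo] --> 0.
Proof.
move=> c0; under eq_cvg do rewrite mulNr.
apply: (cvg_comp (fun u => c * u) (fun u => expR (- u)) _ (@cvgr_expR R)).
exact: gt0_cvgMry.
Qed.

Lemma cvgy_powR_expR (s : R) : 0 < s -> u `^ s * expR (- u) @[u --> +oo] --> (0 : R).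
Proof.
move=> s0.
apply: (@squeeze_cvgr _ _ _ _ (cst 0) (fun u => (2 * s) `^ s * expR (- 2^-1 * u))).
- near=> u; rewrite mulr_ge0 ?powR_ge0 ?expR_ge0//=.
  have u0 : 0 < u by [].
  apply: (le_trans (ler_wpM2r (expR_ge0 _) (powR_le_expR _ _ s0 u0))).
  by rewrite -mulrA -expRD ler_pM2l ?powR_gt0 ?mulr_gt0// ler_expR; lra.
- exact: cvg_cst.
- rewrite -[X in _ --> X](mulr0 ((2 * s) `^ s)); apply: cvgMr.
  by apply: cvgy_expRNM; rewrite invr_gt0.
Unshelve. all: by end_near. Qed.

Lemma continuous_gamma_fun (s u : R) : 0 < u ->
  {for u, continuous (fun u => u `^ s * expR (- u))}.
Proof.
move=> u0; apply: continuousM; first exact: continuous_powR.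
by apply: continuous_comp; [exact: opp_continuous|exact: continuous_expR].
Qed.

Lemma is_derive_gamma_fun (s u : R) : 0 < u ->
  is_derive u 1 (fun u => u `^ s * expR (- u))
    (s * (u `^ (s - 1) * expR (- u)) - u `^ s * expR (- u)).
Proof.
move=> u0; have := is_deriveM (is_derive1_powR s u0) (is_derive_expRN u).
by move/is_derive1_cast; apply; rewrite /GRing.scale/=; ring.
Qed.

(** An integration by parts on upper bounds: by [powR_le_expR] the integrand has
    a majorant [g] with an explicit antiderivative [G] that converges at both ends. *)
Lemma integrable_gamma (s : R) : 0 < s ->
  mu.-integrable `]0, +oo[ (EFin \o (fun u : R => u `^ (s - 1) * expR (- u))).
Proof.
move=> s0.
pose C := 2 * (2 * s) `^ s / s.
pose g (u : R) := s^-1 * (s * (u `^ (s - 1) * expR (- u)) - u `^ s * expR (- u)) - C * (- 2^-1 * expR (- 2^-1 * u)).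
pose G (u : R) := s^-1 * (u `^ s * expR (- u)) - C * expR (- 2^-1 * u).
have gbig (u : R) : 0 < u -> u `^ (s - 1) * expR (- u) <= g u.
  move=> u0; rewrite /g -subr_ge0.
  have -> : s^-1 * (s * (u `^ (s - 1) * expR (- u)) - u `^ s * expR (- u)) -
     C * (- 2^-1 * expR (- 2^-1 * u)) - u `^ (s - 1) * expR (- u) =
     s^-1 * ((2 * s) `^ s * expR (- 2^-1 * u) - u `^ s * expR (- u)).
    by rewrite /C; field; rewrite gt_eqF.
  rewrite mulr_ge0 ?invr_ge0 ?(ltW s0)// subr_ge0.
  apply: (le_trans (ler_wpM2r (expR_ge0 _) (powR_le_expR _ _ s0 u0))).
  by rewrite -mulrA -expRD ler_pM2l ?powR_gt0 ?mulr_gt0// ler_expR; lra.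
have f_ge0 (u : R) : 0 <= u `^ (s - 1) * expR (- u).
  by rewrite mulr_ge0 ?powR_ge0 ?expR_ge0.
have gc (u : R) : 0 < u -> {for u, continuous g}.
  move=> u0; rewrite /g; apply: continuousB.
    apply: continuousM; first exact: cst_continuous.
    apply: continuousB; last exact: continuous_gamma_fun.
    apply: continuousM; first exact: cst_continuous.
    exact: continuous_gamma_fun.
  apply: continuousM; first exact: cst_continuous.
  apply: continuousM; first exact: cst_continuous.
  exact: continuous_expRNM.
apply: (integrable_halfline_le _ g).
- by move=> u u0; exact: continuous_gamma_fun.
- apply/integrableP; split; first by apply/measurable_EFinP; exact: measurable_halfline.
  have -> : (\int[mu]_(x in `]0%R, +oo[) `|(EFin \o g) x| =
      \int[mu]_(x in `]0%R, +oo[) (g x)%:E)%E.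
    apply: eq_integral => u /[!inE] /pos_itvP u0 /=.
    by rewrite ger0_norm// (le_trans _ (gbig _ u0)).
  rewrite [X in (X < _)%E](_ : _ = (0 - (- C))%:E) ?ltry//.
  apply: (@FTC2_halfline_ge0 _ G g (- C) 0) => //.
  + move=> u u0; exact: (is_deriveB (is_deriveZ s^-1 (is_derive_gamma_fun s u u0))
      (is_deriveZ C (is_derive_expRNM 2^-1 u))).
  + by move=> u u0; rewrite (le_trans _ (gbig _ u0)).
  + rewrite -[- C]add0r; apply: cvgB.
      rewrite -[X in _ --> X](mulr0 s^-1); apply: cvgMr.
      rewrite -[X in _ --> X](mul0r (expR (- 0))); apply: cvgM; first exact: powR_cvg0.
      apply: cvg_at_right_filter.
      by apply: continuous_comp; [exact: opp_continuous|exact: continuous_expR].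
    rewrite -[X in _ --> X](mulr1 C); apply: cvgMr.
    have := @continuous_expRNM 2^-1 0; rewrite /continuous_at mulr0 expR0.
    exact: cvg_at_right_filter.
  + rewrite -[X in _ --> X](subrr 0) -[X in _ --> X - _](mulr0 s^-1) -[X in _ --> _ - X](mulr0 C).
    apply: cvgB; apply: cvgMr; first exact: cvgy_powR_expR.
    by apply: cvgy_expRNM; rewrite invr_gt0.
- by move=> u u0; rewrite ger0_norm ?gbig.
Qed.

(** The substitution is singular at the origin when [p < 1], so it is made on the
    rays that start at [F (a n)], which exhaust the half-line. *)
Lemma halfline_subst_powR (c p : R) G : 0 < c -> 0 < p <= 1 ->
  (forall x : R, 0 < x -> {for x, continuous G}) ->
  (forall x : R, 0 < x -> 0 <= G x) ->
  (\int[mu]_(x in `]0%R, +oo[) (G x)%:E =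
   \int[mu]_(u in `]0%R, +oo[) (G (c * u `^ p) * (c * (p * u `^ (p - 1))))%:E)%E.
Proof.
move=> c0 /andP[p0 p1] cG G0.
pose F (u : R) := c * u `^ p.
pose F' (u : R) := c * (p * u `^ (p - 1)).
have dF (u : R) : 0 < u -> is_derive u 1 F (F' u).
  by move=> u0; have := is_deriveZ c (is_derive1_powR p u0).
have F'E (u : R) : 0 < u -> F^`()%classic u = F' u.
  by move=> u0; rewrite derive1E; have [_ ->] := dF _ u0.
have cF (u : R) : 0 < u -> {for u, continuous F}.
  move=> u0; apply: differentiable_continuous; apply/derivable1_diffP.
  by have [] := dF _ u0.
have cF' (u : R) : 0 < u -> {for u, continuous F'}.
  move=> u0; apply: continuousM; first exact: cst_continuous.
  apply: continuousM; first exact: cst_continuous.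
  exact: continuous_powR.
have cdF (u : R) : 0 < u -> {for u, continuous F^`()%classic}.
  move=> u0; change (F^`()%classic v @[v --> u] --> F^`()%classic u); rewrite F'E//.
  apply: cvg_trans (cF' _ u0); apply: near_eq_cvg.
  near=> v; rewrite F'E//; near: v; exact: lt_nbhsr.
have F0 (u : R) : 0 < u -> 0 < F u by move=> u0; rewrite mulr_gt0 ?powR_gt0.
pose a (n : nat) : R := n.+1%:R^-1.
have a0 n : 0 < a n by rewrite invr_gt0.
have sub1 n : (\int[mu]_(x in `[F (a n), +oo[) (G x)%:E =
   \int[mu]_(u in `[a n, +oo[) (G (F u) * F' u)%:E)%E.
  have an u : u \in `]a n, +oo[ -> 0 < u by rewrite in_itv/= andbT; exact: lt_trans.
  rewrite (@increasing_ge0_integration_by_substitutiony _ F G (a n)).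
  - apply: eq_integral => u; rewrite inE/= in_itv/= andbT => au.
    have /F'E E : 0 < u by rewrite (lt_le_trans (a0 n)).
    by congr EFin; rewrite [LHS]/= -E.
  - move=> x y; rewrite !in_itv/= !andbT => ax ay xy.
    rewrite ltr_pM2l//; apply: gt0_ltr_powR => //; rewrite nnegrE.
      by rewrite (le_trans _ ax)// ltW.
    by rewrite (le_trans _ ay)// ltW.
  - by move=> u /an; exact: cdF.
  - by apply/cvg_ex; exists (F^`()%classic (a n)); apply: cvg_at_right_filter; exact: cdF.
  - apply/cvg_ex.
    have [l Hl] : exists l : R, F' u @[u --> +oo] --> l.
      move: p1; rewrite le_eqVlt => /predU1P[p1|p1].
        exists (c * (p * 1)); rewrite /F' p1 subrr.
        under eq_cvg do rewrite powRr0.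
        exact: cvg_cst.
      exists (c * (p * 0)); apply: cvgMr; apply: cvgMr.
      by rewrite -(opprB 1 p); apply: cvgy_powRN; rewrite subr_gt0.
    exists l; apply: cvg_trans Hl; apply: near_eq_cvg.
    by near=> u; rewrite F'E.
  - split.
      by move=> u /an u0; have [] := dF _ u0.
    by apply: cvg_at_right_filter; exact: cF.
  - by apply: gt0_cvgMry => //; exact: cvgy_powR.
  - apply: continuous_in_subspaceT => x; rewrite inE/= in_itv/= andbT => Fx.
    by apply: cG; rewrite (lt_le_trans _ Fx)// F0.
  - move=> x; rewrite in_itv/= andbT => Fx.
    by apply: G0; rewrite (lt_trans _ Fx)// F0.
have acut : \bigcup_n `[a n, +oo[%classic = `]0, +oo[%classic.
  apply/seteqP; split => [x [n _]|x /pos_itvP x0].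
    by rewrite /= !in_itv/= !andbT; exact: lt_le_trans.
  have [n _ /(_ n (leqnn n))] := near_cut x x0.
  by rewrite /= in_itv/= => /andP[an _]; exists n => //=; rewrite in_itv/= andbT.
have Facut : \bigcup_n `[F (a n), +oo[%classic = `]0, +oo[%classic.
  apply/seteqP; split => [x [n _]|x /pos_itvP x0].
    by rewrite /= !in_itv/= !andbT; apply: lt_le_trans; exact: F0.
  have y0 : 0 < (x / c) `^ p^-1 by rewrite powR_gt0 ?divr_gt0.
  have [n _ /(_ n (leqnn n))] := near_cut _ y0.
  rewrite /= in_itv/= => /andP[an _]; exists n => //=; rewrite in_itv/= andbT.
  rewrite /F mulrC -ler_pdivlMr// -(@powRr1 _ (x / c)) ?divr_ge0 ?(ltW x0) ?(ltW c0)//.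
  rewrite -(@mulVf _ p) ?gt_eqF// powRrM; apply: ge0_ler_powR => //.
  - exact: ltW.
  - by rewrite nnegrE ltW.
  - by rewrite nnegrE powR_ge0.
have and_ : {homo (fun n => `[a n, +oo[%classic : set R) : n m / (n <= m)%N >-> (n <= m)%O}.
  move=> n m nm; apply/subsetPset => x; rewrite /= !in_itv/= !andbT; apply: le_trans.
  by rewrite lef_pV2 ?posrE// ler_nat.
have Fand : {homo (fun n => `[F (a n), +oo[%classic : set R) : n m / (n <= m)%N >-> (n <= m)%O}.
  move=> n m nm; apply/subsetPset => x; rewrite /= !in_itv/= !andbT; apply: le_trans.
  rewrite /F ler_pM2l//; apply: ge0_ler_powR; rewrite ?nnegrE ?(ltW p0) ?(ltW (a0 _))//.
  by rewrite lef_pV2 ?posrE// ler_nat.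
have lim1 := @ge0_nondecreasing_set_cvg_integral _ (measurableTypeR R) R
  (fun n => `[F (a n), +oo[%classic) (EFin \o G) mu Fand.
have lim2 := @ge0_nondecreasing_set_cvg_integral _ (measurableTypeR R) R
  (fun n => `[a n, +oo[%classic) (EFin \o (fun u => G (F u) * F' u)) mu and_.
have asub n : `[a n, +oo[ `<=` `]0, +oo[.
  by move=> x; rewrite /= !in_itv/= !andbT; exact: lt_le_trans.
have Fasub n : `[F (a n), +oo[ `<=` `]0, +oo[.
  by move=> x; rewrite /= !in_itv/= !andbT; apply: lt_le_trans; exact: F0.
have L1 : (\int[mu]_(x in `[F (a n), +oo[) (G x)%:E @[n --> \oo] -->
    \int[mu]_(x in `]0%R, +oo[) (G x)%:E)%E.
  rewrite -Facut; apply: lim1.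
  - by move=> n; exact: measurable_itv.
  - move=> n; apply/measurable_EFinP; apply: measurable_funS (measurable_halfline _ cG) => //.
  - by move=> n x /Fasub/pos_itvP x0; rewrite lee_fin G0.
have L2 : (\int[mu]_(u in `[a n, +oo[) (G (F u) * F' u)%:E @[n --> \oo] -->
    \int[mu]_(x in `]0%R, +oo[) (G (F x) * F' x)%:E)%E.
  rewrite -acut; apply: lim2.
  - by move=> n; exact: measurable_itv.
  - have mH : measurable_fun (`]0, +oo[ : set R) (fun u => G (F u) * F' u).
      apply: measurable_halfline => u u0.
      apply: (@continuousM _ _ (G \o F)); last exact: cF'.
      apply: continuous_comp; [exact: cF|exact/cG/F0].
    by move=> n; apply/measurable_EFinP; apply: measurable_funS mH.
  - move=> n x /asub/pos_itvP x0; rewrite lee_fin mulr_ge0 ?G0 ?F0//.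
    by rewrite !mulr_ge0 ?powR_ge0 ?(ltW p0) ?(ltW c0).
have E : (fun n => \int[mu]_(x in `[F (a n), +oo[) (G x)%:E)%E =
  (fun n => \int[mu]_(u in `[a n, +oo[) (G (F u) * F' u)%:E)%E by apply/funext.
by rewrite E in L1; exact: (cvg_unique _ L1 L2).
Unshelve. all: by end_near. Qed.

End gamma_integrals.

(** * Gamma integrals with an oscillating weight *)

Section cosine_gamma.
Context {R : realType}.
Notation mu := (@lebesgue_measure R).
Implicit Types (f g F G h : R -> R).

Lemma is_derive_cosMl (c x : R) : is_derive x 1 (fun t => cos (c * t)) (- (c * sin (c * x))).
Proof.
have := is_derive1_comp (is_derive_cos (c * x)) (is_deriveZ c (is_derive_id x 1)).
by move/is_derive1_cast; apply; rewrite /GRing.scale/= mulr1 mulrC mulrN.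
Qed.

Lemma is_derive_sinMl (c x : R) : is_derive x 1 (fun t => sin (c * t)) (c * cos (c * x)).
Proof.
have := is_derive1_comp (is_derive_sin (c * x)) (is_deriveZ c (is_derive_id x 1)).
by move/is_derive1_cast; apply; rewrite /GRing.scale/= mulr1 mulrC.
Qed.

Lemma is_derive1_continuous f (df x : R) : is_derive x 1 f df -> {for x, continuous f}.
Proof.
by move=> [df0 _]; apply: differentiable_continuous; apply/derivable1_diffP.
Qed.

(** Constant, cosine and sine weights share one differentiation formula and one
    integration by parts. *)
Definition gamma_int (s : R) (h : R -> R) : R :=
  \int[mu]_(u in `]0, +oo[) (u `^ (s - 1) * expR (- u) * h u).

Lemma continuous_gammaM (s u : R) h : 0 < u -> continuous h ->
  {for u, continuous (fun u => u `^ s * expR (- u) * h u)}.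
Proof.
move=> u0 ch; apply: (@continuousM _ _ (fun u => u `^ s * expR (- u))); last exact: ch.
exact: continuous_gamma_fun.
Qed.

Lemma integrable_gammaM (s : R) h : 0 < s -> continuous h ->
  (forall u, `|h u| <= 1) ->
  mu.-integrable `]0, +oo[ (EFin \o (fun u : R => u `^ (s - 1) * expR (- u) * h u)).
Proof.
move=> s0 ch h1; apply: (integrable_halfline_le _ _ _ (integrable_gamma s s0)).
  by move=> u u0; exact: continuous_gammaM.
move=> u u0; rewrite normrM ger0_norm ?mulr_ge0 ?powR_ge0 ?expR_ge0//.
by rewrite ler_piMr// mulr_ge0 ?powR_ge0 ?expR_ge0.
Qed.

Lemma normr_cos_le1 (x : R) : `|cos x| <= 1.
Proof. by rewrite ler_norml cos_geN1 cos_le1. Qed.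

Lemma normr_sin_le1 (x : R) : `|sin x| <= 1.
Proof. by rewrite ler_norml sin_geN1 sin_le1. Qed.

Lemma continuous_cosM (t : R) : continuous (fun u => cos (t * u)).
Proof. move=> x; exact: is_derive1_continuous (is_derive_cosMl t x). Qed.

Lemma continuous_sinM (t : R) : continuous (fun u => sin (t * u)).
Proof. move=> x; exact: is_derive1_continuous (is_derive_sinMl t x). Qed.

(** Each derivative in the frequency brings out a factor [u], which raises the
    exponent of the Gamma integrand by one. *)
Lemma is_derive_gamma_int (s t : R) (h h' : R -> R) : 0 < s ->
  (forall x : R, is_derive x 1 h (h' x)) -> continuous h' ->
  (forall x, `|h x| <= 1) -> (forall x, `|h' x| <= 1) ->
  is_derive t 1 (fun t => gamma_int s (fun u => h (t * u)))
                (gamma_int (s + 1) (fun u => h' (t * u))).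
Proof.
move=> s0 dh ch' h1 h'1.
have ch : continuous h by move=> x; exact: is_derive1_continuous (dh x).
have cM (k : R -> R) (x : R) : continuous k -> continuous (fun u : R => k (x * u)).
  move=> ck y; apply: continuous_comp; last exact: ck.
  exact: mulrl_continuous.
pose f (x u : R) := u `^ (s - 1) * expR (- u) * h (x * u).
have df (x u : R) : 0 < u -> is_derive x 1 (f ^~ u) (u `^ (s + 1 - 1) * expR (- u) * h' (x * u)).
  move=> u0.
  have H : is_derive x 1 (fun x : R => x * u) u.
    have := is_deriveZ u (is_derive_id x 1).
    rewrite (_ : u \*: id = (fun x => x * u)); last first.
      by apply/funext => z; rewrite /GRing.scale/= mulrC.
    by move/is_derive1_cast; apply; rewrite /GRing.scale/= mulr1.
  have := is_deriveZ (u `^ (s - 1) * expR (- u)) (@is_derive1_comp R h (fun x => x * u) x _ _ (dh (x * u)) H).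
  move/is_derive1_cast; apply; rewrite /GRing.scale/= addrK -(mulr_powRB1 (ltW u0) s0).
  by ring.
pose G (u : R) := u `^ (s + 1 - 1) * expR (- u).
have tI : `]t - 1, t + 1[%classic t by rewrite /= in_itv/=; apply/andP; split; lra.
have if_ (x : R) : `]t - 1, t + 1[%classic x -> mu.-integrable `]0, +oo[ (EFin \o f x).
  by move=> _; apply: integrable_gammaM => //; exact: cM.
have der (x u : R) : `]t - 1, t + 1[%classic x -> `]0, +oo[%classic u -> derivable (f ^~ u) x 1.
  by move=> _ /pos_itvP u0; have [] := df x _ u0.
have G0 u : 0 <= G u by rewrite mulr_ge0 ?powR_ge0 ?expR_ge0.
have iG : mu.-integrable `]0, +oo[ (EFin \o G) by apply: integrable_gamma; rewrite addr_gt0.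
have d1E (x u : R) : 0 < u -> partial1of2 f x u = u `^ (s + 1 - 1) * expR (- u) * h' (x * u).
  by move=> u0; rewrite partial1of2E; have [_ ->] := df x _ u0.
have Gub (x u : R) : `]t - 1, t + 1[%classic x -> `]0, +oo[%classic u -> `|partial1of2 f x u| <= G u.
  by move=> _ /pos_itvP u0; rewrite d1E// normrM ger0_norm ?G0// ler_piMr ?G0.
have mI : measurable (`]0, +oo[%classic : set (measurableTypeR R)) by exact: measurable_itv.
split.
  exact: (@derivable_under_integral R _ (measurableTypeR R) mu f _ mI t _ _ tI if_ der G G0 iG Gub).
rewrite -derive1E.
have -> := (@differentiation_under_integral R _ (measurableTypeR R) mu f _ mI t _ _ tI if_ der G G0 iG Gub).
by apply: eq_Rintegral => u /set_mem/pos_itvP u0; rewrite d1E.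
Qed.

(** The boundary terms of [u `^ s * expR (- u) * h u] vanish.  For cosine and sine
    weights the identity expresses the integrals of exponent [s + 1] through those of
    exponent [s], which closes the differential system of [gamma_int_cos_sin]. *)
Lemma gamma_int_by_parts (s : R) (h h' : R -> R) (c : R) : 0 < s ->
  (forall x : R, is_derive x 1 h (c * h' x)) -> continuous h' ->
  (forall x, `|h x| <= 1) -> (forall x, `|h' x| <= 1) ->
  s * gamma_int s h - gamma_int (s + 1) h + c * gamma_int (s + 1) h' = 0.
Proof.
move=> s0 dh ch' h1 h'1.
have ch : continuous h by move=> x; exact: is_derive1_continuous (dh x).
have s10 : 0 < s + 1 by rewrite addr_gt0.
have mI : measurable (`]0, +oo[%classic : set (measurableTypeR R)) by exact: measurable_itv.
have i1 := integrable_gammaM s h s0 ch h1.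
have i2 := integrable_gammaM (s + 1) h s10 ch h1.
have i3 := integrable_gammaM (s + 1) h' s10 ch' h'1.
pose f (u : R) := s * (u `^ (s - 1) * expR (- u) * h u) - u `^ (s + 1 - 1) * expR (- u) * h u
  + c * (u `^ (s + 1 - 1) * expR (- u) * h' u).
have cf (x : R) : 0 < x -> {for x, continuous f}.
  move=> x0; apply: continuousD; first apply: continuousB.
  - by apply: continuousM; [exact: cst_continuous|exact: continuous_gammaM].
  - exact: continuous_gammaM.
  - by apply: continuousM; [exact: cst_continuous|exact: continuous_gammaM].
have si1 := integrableZl mI s i1.
have ci3 := integrableZl mI c i3.
have if_ : mu.-integrable `]0, +oo[ (EFin \o f).
  have := integrableD mI (integrableB mI si1 i2) ci3.
  by apply: eq_integrable => // x _.
have -> : s * gamma_int s h - gamma_int (s + 1) h + c * gamma_int (s + 1) h' =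
    \int[mu]_(x in `]0, +oo[) f x.
  rewrite /f RintegralD//; last first.
    by have := integrableB mI si1 i2; apply: eq_integrable => // x _.
  by rewrite RintegralB// !RintegralZl.
rewrite -[RHS](subrr (0 : R)).
apply: (@FTC2_halfline R (fun u => u `^ s * expR (- u) * h u) f 0 0) => //.
- move=> x x0; have := is_deriveM (is_derive_gamma_fun s x x0) (dh x).
  by move/is_derive1_cast; apply; rewrite /f /GRing.scale/= addrK; ring.
- apply: (@squeeze_cvgr _ _ _ _ (fun u : R => - (u `^ s)) (fun u : R => u `^ s)).
  + near=> u; rewrite -ler_norml normrM ger0_norm ?mulr_ge0 ?powR_ge0 ?expR_ge0//.
    rewrite -mulrA ler_piMr ?powR_ge0// -[leRHS]mulr1 ler_pM ?expR_ge0//.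
    by rewrite -expR0 ler_expR oppr_le0.
  + by rewrite -[X in _ --> X]oppr0; apply: cvgN; exact: powR_cvg0.
  + exact: powR_cvg0.
- apply: (@squeeze_cvgr _ _ _ _ (fun u : R => - (u `^ s * expR (- u))) (fun u : R => u `^ s * expR (- u))).
  + near=> u; rewrite -ler_norml normrM ger0_norm ?mulr_ge0 ?powR_ge0 ?expR_ge0//.
    by rewrite ler_piMr// mulr_ge0 ?powR_ge0 ?expR_ge0.
  + by rewrite -[X in _ --> X]oppr0; apply: cvgN; exact: cvgy_powR_expR.
  + exact: cvgy_powR_expR.
Unshelve. all: by end_near. Qed.

(** The real part of [Gamma s * (1 - i t) ^ (- s)], obtained without complex powers:
    the cosine and sine integrals [C] and [S] satisfy a linear differential system in
    [t]; scaling by [(1 + t ^+ 2) `^ (s / 2)] and rotating by the angle [s * atan t]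
    makes both components constant, and their values are read off at [t = 0]. *)
Lemma gamma_int_cos_sin (s t : R) : 0 < s ->
  gamma_int s (fun u => cos (t * u)) = Gamma s * (1 + t ^+ 2) `^ (- (s / 2)) * cos (s * atan t).
Proof.
move=> s0.
pose C t := gamma_int s (fun u => cos (t * u)).
pose S t := gamma_int s (fun u => sin (t * u)).
pose C1 t := gamma_int (s + 1) (fun u => cos (t * u)).
pose S1 t := gamma_int (s + 1) (fun u => sin (t * u)).
have q0 (x : R) : 0 < 1 + x ^+ 2 by rewrite ltr_pwDl// sqr_ge0.
have q1 (x : R) : 1 + x ^+ 2 != 0 by rewrite gt_eqF.
have eq1 x : s * C x - C1 x - x * S1 x = 0.
  rewrite -[RHS](@gamma_int_by_parts s (fun u => cos (x * u)) (fun u => sin (x * u)) (- x) s0).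
  - by rewrite mulNr.
  - by move=> u; rewrite mulNr; exact: is_derive_cosMl.
  - exact: continuous_sinM.
  - by move=> u; exact: normr_cos_le1.
  - by move=> u; exact: normr_sin_le1.
have eq2 x : s * S x - S1 x + x * C1 x = 0.
  rewrite -[RHS](@gamma_int_by_parts s (fun u => sin (x * u)) (fun u => cos (x * u)) x s0)//.
  - by move=> u; exact: is_derive_sinMl.
  - exact: continuous_cosM.
  - by move=> u; exact: normr_sin_le1.
  - by move=> u; exact: normr_cos_le1.
have dS (x : R) : is_derive x 1 S (C1 x).
  apply: is_derive_gamma_int => //.
  - exact: continuous_cos.
  - by move=> u; exact: normr_sin_le1.
  - by move=> u; exact: normr_cos_le1.
have dC (x : R) : is_derive x 1 C (- S1 x).
  have := @is_derive_gamma_int s x cos (fun u => - sin u) s0 _ _ _ _.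
  have -> : gamma_int (s + 1) (fun u => - sin (x * u)) = - S1 x.
    have s10 : 0 < s + 1 by rewrite addr_gt0.
    have mI : measurable (`]0, +oo[%classic : set (measurableTypeR R)) by exact: measurable_itv.
    have i1 := integrable_gammaM (s + 1) _ s10 (continuous_sinM x) (fun u => normr_sin_le1 _).
    rewrite -mulN1r -RintegralZl//; apply: eq_Rintegral => u _; ring.
  apply => //.
  - by move=> u; apply: continuousN; exact: continuous_sin.
  - by move=> u; exact: normr_cos_le1.
  - by move=> u; rewrite normrN; exact: normr_sin_le1.
pose r x := (1 + x ^+ 2) `^ (s / 2).
have dr (x : R) : is_derive x 1 r (s * x * r x / (1 + x ^+ 2)).
  have H : is_derive x 1 (fun x : R => 1 + x ^+ 2) (2 * x).
    have := is_deriveD (is_derive_cst (1 : R) x (1 : R)) (is_deriveX 2 (is_derive_id x (1 : R))).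
    by move/is_derive1_cast; apply; rewrite /GRing.scale/= add0r mulr1 expr1.
  have := @is_derive1_comp R (fun y => y `^ (s / 2)) (fun x => 1 + x ^+ 2) x _ _ (is_derive1_powR (s / 2) (q0 x)) H.
  move/is_derive1_cast; apply; rewrite powRB ?q1 ?implybT// powRr1 ?ltW// /r.
  by field; rewrite q1.
pose p x := s * atan x.
have dp (x : R) : is_derive x 1 p (s / (1 + x ^+ 2)).
  by have := is_deriveZ s (is_derive1_atan x).
have dcp (x : R) : is_derive x 1 (cos \o p) (- sin (p x) * (s / (1 + x ^+ 2))).
  exact: (is_derive1_comp (is_derive_cos (p x)) (dp x)).
have dsp (x : R) : is_derive x 1 (sin \o p) (cos (p x) * (s / (1 + x ^+ 2))).
  exact: (is_derive1_comp (is_derive_sin (p x)) (dp x)).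
(* the components of the scaled and rotated vector [(C, S)] *)
pose E1 := r * (C * (cos \o p) + S * (sin \o p)).
pose E2 := r * (S * (cos \o p) - C * (sin \o p)).
have C1E x : C1 x = s * (C x - x * S x) / (1 + x ^+ 2).
  apply: (canRL (mulfK (q1 x))); apply/eqP; rewrite -subr_eq0; apply/eqP.
  transitivity (x * (s * S x - S1 x + x * C1 x) - (s * C x - C1 x - x * S1 x)); first by ring.
  by rewrite eq1 eq2 mulr0 subrr.
have S1E x : S1 x = s * (S x + x * C x) / (1 + x ^+ 2).
  apply: (canRL (mulfK (q1 x))); apply/eqP; rewrite -subr_eq0; apply/eqP.
  transitivity (- x * (s * C x - C1 x - x * S1 x) - (s * S x - S1 x + x * C1 x)); first by ring.
  by rewrite eq1 eq2 mulr0 subrr.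
have dE1 (x : R) : is_derive x 1 E1 0.
  have := is_deriveM (dr x) (is_deriveD (is_deriveM (dC x) (dcp x)) (is_deriveM (dS x) (dsp x))).
  move/is_derive1_cast; apply.
  rewrite /GRing.scale/= C1E S1E.
  have -> : (C * (cos \o p) + S * (sin \o p)) x = C x * cos (p x) + S x * sin (p x) by [].
  by field; rewrite q1.
have dE2 (x : R) : is_derive x 1 E2 0.
  have := is_deriveM (dr x) (is_deriveB (is_deriveM (dS x) (dcp x)) (is_deriveM (dC x) (dsp x))).
  move/is_derive1_cast; apply.
  rewrite /GRing.scale/= C1E S1E.
  have -> : (S * (cos \o p) - C * (sin \o p)) x = S x * cos (p x) - C x * sin (p x) by [].
  by field; rewrite q1.
have E1c : E1 t = E1 0 by exact: is_derive_0_is_cst.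
have E2c : E2 t = E2 0 by exact: is_derive_0_is_cst.
have C0 : C 0 = Gamma s.
  by apply: eq_Rintegral => u _; rewrite mul0r cos0 mulr1.
have S0 : S 0 = 0.
  rewrite /S /gamma_int /Rintegral integral0_eq ?fine0// => u _.
  by rewrite mul0r sin0 mulr0.
have E10 : E1 0 = Gamma s.
  have -> : E1 0 = r 0 * (C 0 * cos (p 0) + S 0 * sin (p 0)) by [].
  rewrite C0 S0 /r /p atan0 mulr0 cos0 sin0 expr0n/= addr0 powR1.
  ring.
have E20 : E2 0 = 0.
  have -> : E2 0 = r 0 * (S 0 * cos (p 0) - C 0 * sin (p 0)) by [].
  rewrite C0 S0 /r /p atan0 mulr0 cos0 sin0 expr0n/= addr0 powR1.
  ring.
have r0 : r t != 0 by rewrite gt_eqF// powR_gt0.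
have E1t : E1 t = r t * (C t * cos (p t) + S t * sin (p t)) by [].
have E2t : E2 t = r t * (S t * cos (p t) - C t * sin (p t)) by [].
rewrite powRN -/(r t) -/(p t) -/(C t) -E10 -E1c.
have := cos2Dsin2 (p t).
have : E2 t = 0 by rewrite E2c E20.
rewrite E2t E1t => /eqP; rewrite mulf_eq0 (negbTE r0)/= => /eqP H1 H2.
transitivity (C t * (cos (p t) ^+ 2 + sin (p t) ^+ 2) + sin (p t) * (S t * cos (p t) - C t * sin (p t))).
  by rewrite H1 H2 mulr0 addr0 mulr1.
by field.
Qed.

End cosine_gamma.

(** * The Fejer kernel and the tent function *)

Section fejer_kernel.
Context {R : realType}.
Notation mu := (@lebesgue_measure R).
Let halfline : set (measurableTypeR R) := `]0, +oo[%classic.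

Let mhalf : measurable halfline.
Proof. exact: measurable_itv. Qed.

Lemma gamma_int_cst (s : R) : gamma_int s (cst 1) = Gamma s.
Proof. by apply: eq_Rintegral => u _; rewrite mulr1. Qed.

Lemma Gamma1 : Gamma 1 = 1 :> R.
Proof.
rewrite /Gamma /Rintegral.
have -> : (\int[mu]_(x in `]0%R, +oo[) (x `^ (1 - 1) * expR (- x))%:E =
  \int[mu]_(x in `]0%R, +oo[) (expR (- x))%:E)%E.
  by apply: eq_integral => x _; rewrite subrr powRr0 mul1r.
rewrite (_ : (\int[mu]_(x in `]0%R, +oo[) (expR (- x))%:E = (0 - (- 1))%:E)%E).
  by rewrite sub0r opprK.
apply: (@FTC2_halfline_ge0 R (fun x => - expR (- x)) (fun x => expR (- x))).
- move=> x _; have := is_deriveN (is_derive_expRN x).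
  by move/is_derive1_cast; apply; rewrite opprK.
- move=> x _; apply: (is_derive1_continuous _ _ _ (is_derive_expRN x)).
- by move=> x _; exact: expR_ge0.
- apply: cvgN; rewrite -(@expR0 R) -[X in _ --> expR X]oppr0; apply: cvg_at_right_filter.
  exact: (is_derive1_continuous _ _ _ (is_derive_expRN 0)).
- by rewrite -[X in _ --> X]oppr0; apply: cvgN; exact: cvgr_expR.
Qed.

Lemma Gamma2 : Gamma 2 = 1 :> R.
Proof.
have := @gamma_int_by_parts R 1 (cst 1) (cst 0) 0 ltr01.
rewrite mul0r addr0 !gamma_int_cst Gamma1 mul1r => H.
apply/eqP; rewrite eq_sym -subr_eq0; apply/eqP; rewrite -[X in _ - X](_ : Gamma (1 + 1) = _)//.
apply: H => //.
- by move=> x; apply: is_derive1_cast (is_derive_cst _ _ _) _; rewrite mul0r.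
- by move=> x; exact: cst_continuous.
- by move=> x; rewrite normr1.
- by move=> x; rewrite normr0.
Qed.

(** Up to normalisation the Fejer kernel, whose cosine transform is a tent. *)
Definition fejer (x : R) : R := (1 - cos x) / x ^+ 2.

Lemma fejer_ge0 x : 0 <= fejer x.
Proof. by rewrite mulr_ge0 ?invr_ge0 ?sqr_ge0// subr_ge0 cos_le1. Qed.

Lemma continuous_fejer (a x : R) : 0 < x -> {for x, continuous (fun u => (1 - cos (a * u)) / u ^+ 2)}.
Proof.
move=> x0; apply: continuousM.
  by apply: continuousB; [exact: cst_continuous|exact: continuous_cosM].
apply: continuousV; first by rewrite expf_neq0// gt_eqF.
exact: exprn_continuous.
Qed.

Lemma integral_inv_1Dsqr :
  (\int[mu]_(x in `]0%R, +oo[) ((1 + x ^+ 2)^-1)%:E = (pi / 2)%:E)%E.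
Proof.
rewrite -[in RHS](subr0 (pi / 2)).
have q0 (x : R) : 1 + x ^+ 2 != 0 by rewrite gt_eqF// ltr_pwDl// sqr_ge0.
apply: (@FTC2_halfline_ge0 R (@atan R) (fun x => (1 + x ^+ 2)^-1)).
- move=> x _; apply: continuousV => //.
  by apply: continuousD; [exact: cst_continuous|exact: exprn_continuous].
- by move=> x _; rewrite invr_ge0 addr_ge0// sqr_ge0.
- by rewrite -[X in _ --> X](@atan0 R); apply: cvg_at_right_filter; exact: continuous_atan.
- exact: cvgy_atan.
Qed.

Lemma measurable_invr : measurable_fun [set: R] (fun x : R => x^-1).
Proof.
rewrite (_ : (fun x : R => x^-1) = (fun x => x * `|x| `^ (- 2%:R))).
  apply: measurable_funM; first exact: measurable_id.
  by apply: (measurableT_comp (measurable_powR _)); exact: normr_measurable.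
apply/funext => x; rewrite powR_invn// -normrX ger0_norm ?sqr_ge0//.
have [->|x0] := eqVneq x 0; first by rewrite invr0 mul0r.
by rewrite expr2; field.
Qed.

Lemma integral_indicM_halfline (g : R -> R) :
  (\int[mu]_y (\1_halfline y * g y)%:E = \int[mu]_(y in halfline) (g y)%:E)%E.
Proof.
rewrite [RHS]integral_mkcond; apply: eq_integral => y _.
by rewrite patchE indicE; case: ifP => _; rewrite ?mul1r ?mul0r.
Qed.

Lemma tonelli_halfline (g : R -> R -> R) :
  measurable_fun [set: measurableTypeR R * measurableTypeR R] (fun z => g z.1 z.2) ->
  (forall x y, 0 <= g x y) ->
  (\int[mu]_(x in halfline) \int[mu]_(y in halfline) (g x y)%:E =
   \int[mu]_(y in halfline) \int[mu]_(x in halfline) (g x y)%:E)%E.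
Proof.
move=> mg g0.
pose f (z : measurableTypeR R * measurableTypeR R) : \bar R :=
  (\1_halfline z.1 * (\1_halfline z.2 * g z.1 z.2))%:E.
have f0 z : (0 <= f z)%E by rewrite lee_fin !mulr_ge0.
have mf : measurable_fun setT f.
  have mi : measurable_fun [set: measurableTypeR R] (\1_halfline : measurableTypeR R -> R).
    exact: measurable_indic.
  apply/measurable_EFinP; apply: measurable_funM.
    exact: (measurableT_comp mi measurable_fst).
  apply: measurable_funM => //.
  exact: (measurableT_comp mi measurable_snd).
have := @fubini_tonelli _ _ (measurableTypeR R) (measurableTypeR R) R mu mu f mf f0.
have -> : (\int[mu]_x \int[mu]_y f (x, y) =
    \int[mu]_(x in halfline) \int[mu]_(y in halfline) (g x y)%:E)%E.
  rewrite [RHS]integral_mkcond; apply: eq_integral => x _.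
  rewrite patchE /f/= indicE; case: ifP => _.
    by under eq_integral do rewrite mul1r; rewrite integral_indicM_halfline.
  by rewrite integral0_eq// => y _; rewrite mul0r.
have -> // : (\int[mu]_y \int[mu]_x f (x, y) =
    \int[mu]_(y in halfline) \int[mu]_(x in halfline) (g x y)%:E)%E.
rewrite [RHS]integral_mkcond; apply: eq_integral => y _.
rewrite patchE /f/=; case: ifPn => yh.
  have y1 : \1_halfline y = 1 :> R by rewrite indicE yh.
  by under eq_integral do rewrite y1 mul1r; rewrite integral_indicM_halfline.
have y1 : \1_halfline y = 0 :> R by rewrite indicE (negbTE yh).
by rewrite integral0_eq// => x _; rewrite y1 mul0r mulr0.
Qed.

Lemma EFin_Rintegral_halfline (f : R -> R) : mu.-integrable halfline (EFin \o f) ->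
  (\int[mu]_(x in halfline) (f x)%:E = (\int[mu]_(x in halfline) f x)%:E)%E.
Proof. by move=> intf; rewrite /Rintegral fineK//; exact: integrable_fin_num. Qed.

Let K := (\int[mu]_(x in halfline) ((1 - cos x) / x ^+ 2)%:E)%E.

Lemma measurable_fejer : measurable_fun [set: R] fejer.
Proof.
apply: measurable_funM; last first.
  by apply: (measurableT_comp measurable_invr); exact: exprn_measurable.
apply: measurable_funB => //; apply: continuous_measurable_fun; exact: continuous_cos.
Qed.

Let scale_fejer (a : R) : 0 < a ->
  (\int[mu]_(x in halfline) ((1 - cos (a * x)) / x ^+ 2)%:E = a%:E * K)%E.
Proof.
move=> a0; rewrite /K /halfline.
rewrite (@halfline_subst_powR R a 1 (fun x => (1 - cos x) / x ^+ 2))//; last 3 first.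
- by rewrite ltr01 lexx.
- move=> x x0; have := continuous_fejer 1 x x0.
  by rewrite (_ : (fun u => (1 - cos (1 * u)) / u ^+ 2) = (fun x => (1 - cos x) / x ^+ 2))//;
    apply/funext => u; rewrite mul1r.
- by move=> x x0; exact: fejer_ge0.
transitivity (a%:E * (a^-1%:E * (\int[mu]_(x in `]0%R, +oo[) ((1 - cos (a * x)) / x ^+ 2)%:E)))%E.
  by rewrite muleA -EFinM divff ?gt_eqF// mul1e.
congr (_ * _)%E; rewrite -ge0_integralZl_EFin//=; last 3 first.
- by move=> x _; rewrite lee_fin mulr_ge0 ?invr_ge0 ?sqr_ge0// subr_ge0 cos_le1.
- by apply/measurable_EFinP; apply: measurable_halfline => u u0; exact: continuous_fejer.
- by rewrite invr_ge0 ltW.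
apply: eq_integral => x /set_mem/pos_itvP x0; congr EFin.
rewrite subrr powRr0 powRr1 ?(ltW x0)//; field.
by rewrite !gt_eqF.
Qed.

Let expR_gammaE (x : R) : expR (- x) = x `^ (1 - 1) * expR (- x).
Proof. by rewrite subrr powRr0 mul1r. Qed.

(** The value of [gamma_int_cos_sin] at exponent one, where [cos (atan y)] is
    algebraic; it is the inner integral of [integral_fejer] in one of the two orders. *)
Lemma integral_expR_1Bcos (y : R) : 0 < y ->
  (\int[mu]_(x in halfline) (expR (- x) * ((1 - cos (x * y)) / y ^+ 2))%:E =
   ((1 + y ^+ 2)^-1)%:E)%E.
Proof.
move=> y0.
have i1 := @integrable_gamma R 1 ltr01.
have i2 := @integrable_gammaM R 1 _ ltr01 (continuous_cosM y) (fun u => normr_cos_le1 _).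
pose g (x : R) := y^-2 * (x `^ (1 - 1) * expR (- x) - x `^ (1 - 1) * expR (- x) * cos (y * x)).
have gE x : expR (- x) * ((1 - cos (x * y)) / y ^+ 2) = g x.
  by rewrite /g -expR_gammaE (mulrC x y); field; rewrite gt_eqF.
under eq_integral do rewrite gE.
have i12 := integrableB mhalf i1 i2.
have ig : mu.-integrable halfline (EFin \o g).
  by have := integrableZl mhalf (y^-2) i12; apply: eq_integrable => // x _.
rewrite EFin_Rintegral_halfline// RintegralZl// RintegralB//.
have -> : \int[mu]_(x in halfline) (x `^ (1 - 1) * expR (- x)) = 1 by rewrite -[RHS]Gamma1.
have -> : \int[mu]_(x in halfline) (x `^ (1 - 1) * expR (- x) * cos (y * x)) = (1 + y ^+ 2)^-1.
  have := @gamma_int_cos_sin R 1 y ltr01; rewrite /gamma_int => ->.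
  rewrite Gamma1 !mul1r cos_atan powRN powR12_sqrt ?addr_ge0 ?sqr_ge0//.
  by rewrite -invfM -expr2 sqr_sqrtr// addr_ge0 ?sqr_ge0.
congr EFin; field.
by rewrite (gt_eqF y0) andbT gt_eqF// ltr_pwDl// sqr_ge0.
Qed.

(** The double integral of [expR (- x) * ((1 - cos (x * y)) / y ^+ 2)] is computed in
    both orders: scaling in [y] leaves the unknown constant times [Gamma 2], whereas
    integrating first in [x] leaves the derivative of the arctangent. *)
Lemma integral_fejer : K = (pi / 2)%:E.
Proof.
have K0 : (0 <= K)%E by apply: integral_ge0 => x _; rewrite lee_fin fejer_ge0.
have := @tonelli_halfline (fun x y => expR (- x) * ((1 - cos (x * y)) / y ^+ 2)) _ _.
have -> : (\int[mu]_(x in halfline) \int[mu]_(y in halfline)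
   (expR (- x) * ((1 - cos (x * y)) / y ^+ 2))%:E = K)%E.
  transitivity (\int[mu]_(x in halfline) ((x `^ (2 - 1) * expR (- x))%:E * K))%E.
    apply: eq_integral => x /set_mem/pos_itvP x0.
    under eq_integral do rewrite EFinM.
    rewrite ge0_integralZl_EFin ?expR_ge0//; last 2 first.
    - by move=> y _; rewrite lee_fin mulr_ge0 ?invr_ge0 ?sqr_ge0// subr_ge0 cos_le1.
    - by apply/measurable_EFinP; apply: measurable_halfline => u u0; exact: continuous_fejer.
    rewrite scale_fejer// muleA -EFinM (_ : (2 - 1) = 1 :> R); last by ring.
    by rewrite powRr1 ?(ltW x0)// mulrC.
  rewrite ge0_integralZr//; last 2 first.
  - apply/measurable_EFinP; apply: measurable_halfline => u u0; exact: continuous_gamma_fun.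
  - by move=> x _; rewrite lee_fin mulr_ge0 ?powR_ge0 ?expR_ge0.
  rewrite EFin_Rintegral_halfline; last exact: integrable_gamma.
  by rewrite (_ : \int[mu]_(x in halfline) _ = 1) ?mul1e// -[RHS]Gamma2.
have -> : (\int[mu]_(y in halfline) \int[mu]_(x in halfline)
   (expR (- x) * ((1 - cos (x * y)) / y ^+ 2))%:E = (pi / 2)%:E)%E.
  rewrite -integral_inv_1Dsqr; apply: eq_integral => y /set_mem/pos_itvP y0.
  exact: integral_expR_1Bcos.
apply.
- have mfst : measurable_fun setT (fst : measurableTypeR R * measurableTypeR R -> R).
    exact: measurable_fst.
  have msnd : measurable_fun setT (snd : measurableTypeR R * measurableTypeR R -> R).
    exact: measurable_snd.
  apply: measurable_funM.
    apply: (measurableT_comp (@measurable_expR R)).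
    exact: (measurableT_comp (@oppr_measurable R setT) mfst).
  apply: measurable_funM.
    apply: measurable_funB => //.
    apply: (measurableT_comp (continuous_measurable_fun (@continuous_cos R))).
    exact: measurable_funM.
  apply: (measurableT_comp measurable_invr).
  exact: (measurableT_comp (@exprn_measurable R setT 2) msnd).
- by move=> x y; rewrite !mulr_ge0 ?expR_ge0 ?invr_ge0 ?sqr_ge0// subr_ge0 cos_le1.
Qed.

Lemma integrable_1Bcos (a : R) :
  mu.-integrable halfline (EFin \o (fun x => (1 - cos (a * x)) / x ^+ 2)).
Proof.
wlog a0 : a / 0 <= a.
  move=> H; have [/H//|/ltW] := leP 0 a; rewrite -oppr_ge0 => /H.
  by apply: eq_integrable => // x _; rewrite /= mulNr cosN.
move: a0; rewrite le_eqVlt => /predU1P[<-|a0].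
  apply: (eq_integrable _ (cst 0%E)) => //; last exact: integrable0.
  by move=> x _; rewrite /= mul0r cos0 subrr mul0r.
apply/integrableP; split.
  by apply/measurable_EFinP; apply: measurable_halfline => u u0; exact: continuous_fejer.
under eq_integral => x _.
  rewrite /= ger0_norm; last by rewrite mulr_ge0 ?invr_ge0 ?sqr_ge0// subr_ge0 cos_le1.
  over.
by rewrite scale_fejer// integral_fejer -EFinM ltry.
Qed.

(** By scaling, one constant gives all frequencies; the absolute value that appears
    is the source of the corners of the tent in [tent_fourier]. *)
Lemma Rintegral_1Bcos (a : R) :
  \int[mu]_(x in halfline) ((1 - cos (a * x)) / x ^+ 2) = `|a| * (pi / 2).
Proof.
wlog a0 : a / 0 <= a.
  move=> H; have [/H//|/ltW] := leP 0 a; rewrite -oppr_ge0 => /H; rewrite normrN => <-.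
  by apply: eq_Rintegral => x _; rewrite mulNr cosN.
move: a0; rewrite le_eqVlt => /predU1P[<-|a0].
  rewrite /Rintegral integral0_eq ?fine0 ?normr0 ?mul0r// => x _.
  by rewrite mul0r cos0 subrr mul0r.
by rewrite /Rintegral scale_fejer// integral_fejer -EFinM/= gtr0_norm.
Qed.

(** An approximation of the Dirac mass at the origin with a nonnegative and explicit
    Fourier transform. *)
Definition tent (e z : R) : R := Num.max 0 (e - `|z|) / e ^+ 2.

Lemma integrable_fejerM (e : R) (h : R -> R) : 0 < e -> continuous h ->
  (forall x, `|h x| <= 1) ->
  mu.-integrable halfline (EFin \o (fun u => fejer (e * u) * h u)).
Proof.
move=> e0 ch h1.
have i1 := integrableZl mhalf (e ^- 2) (integrable_1Bcos e).
have E u : e ^- 2 * ((1 - cos (e * u)) / u ^+ 2) = fejer (e * u).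
  by rewrite /fejer exprMn [in RHS]invfM; ring.
apply: (le_integrable _ _ _ i1) => //.
  apply/measurable_EFinP; apply: measurable_funM.
    apply: measurable_funTS; apply: (measurableT_comp measurable_fejer).
    exact: mulrl_measurable.
  by apply: measurable_funTS; exact: continuous_measurable_fun.
move=> x _; rewrite /= lee_fin normrM E ler_piMr//.
Qed.

(** [fejer (e * u) * cos (z * u)] is a second difference in [z], with step [e], of
    [(1 - cos (z * u)) / u ^+ 2], and the second difference of the absolute value is
    a multiple of the tent. *)
Lemma tent_fourier (e z : R) : 0 < e ->
  \int[mu]_(u in halfline) (fejer (e * u) * cos (z * u)) = pi / 2 * tent e z.
Proof.
move=> e0.
have i1 := integrableZl mhalf (- e ^- 2) (integrable_1Bcos z).
have i2 := integrableZl mhalf (e ^- 2 / 2) (integrable_1Bcos (z + e)).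
have i3 := integrableZl mhalf (e ^- 2 / 2) (integrable_1Bcos (z - e)).
have -> : \int[mu]_(u in halfline) (fejer (e * u) * cos (z * u)) =
  \int[mu]_(u in halfline) (- e ^- 2 * ((1 - cos (z * u)) / u ^+ 2) +
   e ^- 2 / 2 * ((1 - cos ((z + e) * u)) / u ^+ 2) +
   e ^- 2 / 2 * ((1 - cos ((z - e) * u)) / u ^+ 2)).
  apply: eq_Rintegral => u /set_mem/pos_itvP u0.
  rewrite /fejer (mulrDl z e) (mulrBl u z e) cosD cosB.
  by field; rewrite !gt_eqF.
rewrite RintegralD//; last by have := integrableD mhalf i1 i2; apply: eq_integrable.
rewrite RintegralD// !RintegralZl//; try exact: integrable_1Bcos.
rewrite !Rintegral_1Bcos /tent.
have key : - `|z| + `|z + e| / 2 + `|z - e| / 2 = Num.max 0 (e - `|z|).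
  have [z0|z0] := leP 0 z; [rewrite (ger0_norm z0)|rewrite (ltr0_norm z0)];
  (have [a0|a0] := leP 0 (z + e); [rewrite (ger0_norm a0)|rewrite (ltr0_norm a0)]);
  (have [b0|b0] := leP 0 (z - e); [rewrite (ger0_norm b0)|rewrite (ltr0_norm b0)]);
  rewrite maxEle; case: ifPn; rewrite -?ltNge => *; lra.
by rewrite -key; field; rewrite gt_eqF.
Qed.

End fejer_kernel.

(** * Fourier inversion for tent functions *)

Section fourier_representation.
Context {d : measure_display} {T : measurableType d} {R : realType}.
Variable P : probability T R.
Notation mu := (@lebesgue_measure R).
Let halfline : set (measurableTypeR R) := `]0, +oo[%classic.
Let mhalf : measurable halfline. Proof. exact: measurable_itv. Qed.

Lemma integrable_bounded_prob (f : T -> R) (M : R) : measurable_fun setT f ->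
  (forall w, `|f w| <= M) -> P.-integrable setT (EFin \o f).
Proof.
move=> mf fM; apply: measurable_bounded_integrable => //.
  exact: (le_lt_trans (@probability_le1 _ _ _ P _ measurableT) (ltry _)).
exists M; split; first exact: num_real.
by move=> y My w _ /=; exact: le_trans (fM w) (ltW My).
Qed.

Lemma EFin_Rintegral_prob (f : T -> R) (M : R) : measurable_fun setT f ->
  (forall w, `|f w| <= M) -> (\int[P]_w (f w)%:E = (\int[P]_w f w)%:E)%E.
Proof.
move=> mf fM; rewrite /Rintegral fineK//.
by apply: integrable_fin_num => //; exact: integrable_bounded_prob fM.
Qed.

Lemma tent_ge0 (e z : R) : 0 <= tent e z.
Proof. by rewrite mulr_ge0 ?invr_ge0 ?sqr_ge0// le_max lexx. Qed.

Lemma tent_le (e z : R) : 0 < e -> tent e z <= e^-1.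
Proof.
move=> e0; rewrite /tent ler_pdivrMr ?exprn_gt0// expr2 mulrA mulVf ?gt_eqF// mul1r.
by rewrite ge_max (ltW e0)/= gerBl.
Qed.

Lemma measurable_tent (e : R) : measurable_fun setT (tent e).
Proof.
apply: measurable_funM => //; apply: measurable_maxr => //.
by apply: measurable_funB => //; exact: normr_measurable.
Qed.

(** Fubini: the Fejer kernel is integrable, so the expectation of a tent is an
    integral of the characteristic function for every law. *)
Lemma expectation_tent_fourier (Y : T -> R) (e x : R) : 0 < e ->
  measurable_fun setT Y ->
  \int[P]_w tent e (x + Y w) =
  2 / pi * \int[mu]_(u in halfline) (fejer (e * u) * \int[P]_w cos (u * (x + Y w))).
Proof.
move=> e0 mY.
pose f (z : T * measurableTypeR R) : \bar R :=
  (\1_halfline z.2 * (fejer (e * z.2) * cos ((x + Y z.1) * z.2)))%:E.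
have mi : measurable_fun [set: measurableTypeR R] (\1_halfline : measurableTypeR R -> R).
  exact: measurable_indic.
have msnd : measurable_fun setT (snd : T * measurableTypeR R -> R) by exact: measurable_snd.
have mxY : measurable_fun setT (fun z : T * measurableTypeR R => x + Y z.1).
  by apply: measurable_funD => //; exact: (measurableT_comp mY measurable_fst).
have mf : measurable_fun setT f.
  apply/measurable_EFinP; apply: measurable_funM.
    exact: (measurableT_comp mi measurable_snd).
  apply: measurable_funM.
    apply: (measurableT_comp (@measurable_fejer R)).
    exact: (measurableT_comp (@mulrl_measurable R setT e) msnd).
  apply: (measurableT_comp (continuous_measurable_fun (@continuous_cos R))).
  exact: measurable_funM.
have ife := @integrable_fejerM R e (cst 1) e0 (fun z => @cst_continuous _ _ (1 : R) z).
have {}ife : mu.-integrable halfline (EFin \o (fun u => fejer (e * u))).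
  by have := ife (fun x => ltac:(rewrite normr1; exact: lexx)); apply: eq_integrable => // u _; rewrite /= mulr1.
have intf : (P \x mu)%E.-integrable setT f.
  apply/integrable12ltyP => //.
  apply: (@le_lt_trans _ _ (\int[P]_w (\int[mu]_(u in halfline) (fejer (e * u)))%:E)%E).
    have maf : measurable_fun setT (abse \o f) by exact: measurableT_comp.
    apply: ge0_le_integral => //.
    - by move=> w _; exact: integral_ge0.
    - exact: (@measurable_fun_fubini_tonelli_F _ _ _ _ _ mu (abse \o f) maf (fun z => abse_ge0 _)).
    move=> w _; rewrite -(EFin_Rintegral_halfline _ ife) -integral_indicM_halfline.
    apply: ge0_le_integral => //.
    - exact: (measurableT_comp maf (measurable_pair1 w)).
    - apply/measurable_EFinP; apply: measurable_funM => //.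
      by apply: (measurableT_comp (@measurable_fejer R)); exact: mulrl_measurable.
    move=> u _; rewrite /f /= lee_fin normrM ger0_norm// ler_wpM2l//.
    by rewrite normrM ger0_norm ?fejer_ge0// ler_piMr ?fejer_ge0// normr_cos_le1.
  rewrite integral_cst// [X in (_ * X)%E](_ : _ = 1%E) ?mule1 ?ltry//.
  exact: probability_setT.
have pi0 : pi != 0 :> R by rewrite gt_eqF// pi_gt0.
have mtent : measurable_fun setT (fun w => tent e (x + Y w)).
  by apply: (measurableT_comp (measurable_tent e)); exact: measurable_funD.
have tent_b w : `|tent e (x + Y w)| <= e^-1 by rewrite ger0_norm ?tent_ge0 ?tent_le.
have L : (\int[P]_w \int[mu]_y f (w, y) = (pi / 2 * \int[P]_w tent e (x + Y w))%:E)%E.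
  rewrite -(@RintegralZl _ _ _ P)//; last exact: integrable_bounded_prob tent_b.
  have E1 := EFin_Rintegral_prob (fun w => pi / 2 * tent e (x + Y w)) (pi / 2 * e^-1).
  rewrite -E1; last 2 first.
  - exact: measurable_funM.
  - by move=> w; rewrite normrM ger0_norm ?divr_ge0 ?pi_ge0// ler_wpM2l ?divr_ge0 ?pi_ge0.
  apply: eq_integral => w _; rewrite /f /=.
  rewrite (integral_indicM_halfline (fun y => fejer (e * y) * cos ((x + Y w) * y))).
  rewrite EFin_Rintegral_halfline ?tent_fourier//.
  apply: integrable_fejerM => //; first exact: continuous_cosM.
  by move=> ?; exact: normr_cos_le1.
have Rr : (\int[mu]_y \int[P]_w f (w, y) =
   \int[mu]_(u in halfline) (fejer (e * u) * \int[P]_w cos (u * (x + Y w)))%:E)%E.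
  rewrite -integral_indicM_halfline; apply: eq_integral => u _; rewrite /f/=.
  have mc : measurable_fun setT (fun w => cos (u * (x + Y w))).
    apply: (measurableT_comp (continuous_measurable_fun (@continuous_cos R))).
    by apply: measurable_funM => //; exact: measurable_funD.
  have cb w : `|cos (u * (x + Y w))| <= 1 by exact: normr_cos_le1.
  rewrite mulrA -(@RintegralZl _ _ _ P)//; last exact: integrable_bounded_prob cb.
  have E1 := EFin_Rintegral_prob (fun w => \1_halfline u * fejer (e * u) * cos (u * (x + Y w)))
    (`|\1_halfline u * fejer (e * u)|).
  rewrite -E1; last 2 first.
  - exact: measurable_funM.
  - by move=> w; rewrite normrM ler_piMr.
  by apply: eq_integral => w _; rewrite -mulrA (mulrC u).
have F := Fubini intf; rewrite L Rr in F.
rewrite [in RHS]/Rintegral -F /= mulrA -[LHS]mul1r; congr (_ * _).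
by rewrite mulrA divfK// divff.
Qed.

End fourier_representation.

(** * Taylor bounds for sine and cosine *)

Section cosine_bounds.
Context {R : realType}.

(** The Taylor bounds below follow from one another by one more integration. *)
Lemma ge0_of_derive (F f : R -> R) : F 0 = 0 ->
  (forall x : R, is_derive x 1 F (f x)) -> (forall x, 0 < x -> 0 <= f x) ->
  forall x, 0 <= x -> 0 <= F x.
Proof.
move=> F0 dF f0 x; rewrite le_eqVlt => /predU1P[<-|x0]; first by rewrite F0.
have cF : {within `[0, x], continuous F}.
  apply: continuous_in_subspaceT => y _; exact: (is_derive1_continuous _ _ _ (dF y)).
have [c cx] := MVT x0 (fun y _ => dF y) cF.
rewrite F0 !subr0 => ->; rewrite mulr_ge0 ?(ltW x0)// f0//.
by move: cx; rewrite in_itv/= => /andP[].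
Qed.

Lemma sin_le (x : R) : 0 <= x -> sin x <= x.
Proof.
move=> x0; rewrite -subr_ge0; move: x x0.
apply: (ge0_of_derive (fun x => x - sin x) (fun x => 1 - cos x)); first by rewrite sin0 subrr.
- by move=> x _; rewrite subr_ge0 cos_le1.
Qed.

Lemma is_derive_cMX2 (c x : R) : is_derive x 1 (fun x => c * x ^+ 2) (2 * c * x).
Proof.
have := is_deriveZ c (is_deriveX 2 (is_derive_id x (1 : R))).
by move/is_derive1_cast; apply; rewrite /GRing.scale/= mulr1 expr1; ring.
Qed.

Lemma is_derive_cMX3 (c x : R) : is_derive x 1 (fun x => c * x ^+ 3) (3 * c * x ^+ 2).
Proof.
have := is_deriveZ c (is_deriveX 3 (is_derive_id x (1 : R))).
by move/is_derive1_cast; apply; rewrite /GRing.scale/= mulr1; ring.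
Qed.

Lemma is_derive_cMX4 (c x : R) : is_derive x 1 (fun x => c * x ^+ 4) (4 * c * x ^+ 3).
Proof.
have := is_deriveZ c (is_deriveX 4 (is_derive_id x (1 : R))).
by move/is_derive1_cast; apply; rewrite /GRing.scale/= mulr1; ring.
Qed.

Lemma cos_ge (x : R) : 1 - cos x <= 2^-1 * x ^+ 2.
Proof.
wlog x0 : x / 0 <= x.
  by move=> H; have [/H//|/ltW] := leP 0 x; rewrite -oppr_ge0 => /H; rewrite cosN sqrrN.
rewrite -subr_ge0; move: x x0.
apply: (ge0_of_derive (fun x => 2^-1 * x ^+ 2 - (1 - cos x)) (fun x => x - sin x)).
- by rewrite cos0 subrr expr0n/= mulr0 subr0.
- move=> x; have := is_deriveB (is_derive_cMX2 2^-1 x) (is_deriveB (is_derive_cst (1 : R) x 1) (is_derive_cos x)).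
  by move/is_derive1_cast; apply; field.
- by move=> x x0; rewrite subr_ge0 sin_le// ltW.
Qed.

Lemma sin_ge (x : R) : 0 <= x -> x - 6^-1 * x ^+ 3 <= sin x.
Proof.
move=> x0; rewrite -subr_ge0; move: x x0.
apply: (ge0_of_derive (fun x => sin x - (x - 6^-1 * x ^+ 3)) (fun x => 2^-1 * x ^+ 2 - (1 - cos x))).
- by rewrite sin0 expr0n/= mulr0 !subr0.
- move=> x; have := is_deriveB (is_derive_sin x) (is_deriveB (is_derive_id x (1 : R)) (is_derive_cMX3 6^-1 x)).
  by move/is_derive1_cast; apply; field.
- by move=> x x0; rewrite subr_ge0 cos_ge.
Qed.

Lemma cos_le (x : R) : 2^-1 * x ^+ 2 - 24^-1 * x ^+ 4 <= 1 - cos x.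
Proof.
wlog x0 : x / 0 <= x.
  move=> H; have [/H//|/ltW] := leP 0 x; rewrite -oppr_ge0 => /H.
  have E4 : (- x) ^+ 4 = x ^+ 4 by rewrite (exprM _ 2 2) sqrrN -exprM.
  by rewrite cosN sqrrN E4 => h; exact: h.
rewrite -subr_ge0; move: x x0.
apply: (ge0_of_derive (fun x => (1 - cos x) - (2^-1 * x ^+ 2 - 24^-1 * x ^+ 4)) (fun x => sin x - (x - 6^-1 * x ^+ 3))).
- by rewrite cos0 subrr !expr0n/= !mulr0 !subr0.
- move=> x; have := is_deriveB (is_deriveB (is_derive_cst (1 : R) x 1) (is_derive_cos x)) (is_deriveB (is_derive_cMX2 2^-1 x) (is_derive_cMX4 24^-1 x)).
  by move/is_derive1_cast; apply; field.
- by move=> x x0; rewrite subr_ge0 sin_ge// ltW.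
Qed.

Lemma normr_sin_le (x : R) : `|sin x| <= `|x|.
Proof.
wlog x0 : x / 0 <= x.
  by move=> H; have [/H//|/ltW] := leP 0 x; rewrite -oppr_ge0 => /H; rewrite sinN !normrN.
rewrite (ger0_norm x0) ler_norml sin_le// andbT.
have [xp|xp] := leP x pi.
  by apply: (@le_trans _ _ 0); [rewrite oppr_le0|apply: sin_ge0_pi; rewrite x0].
apply: le_trans (sin_geN1 x); rewrite lerN2; apply: le_trans (ltW xp).
by apply: le_trans (@pi_ge2 R); lra.
Qed.

Lemma fejer_le (x : R) : fejer x <= 2^-1.
Proof.
have [->|x0] := eqVneq x 0; first by rewrite /fejer cos0 subrr mul0r invr_ge0.
by rewrite /fejer ler_pdivrMr ?cos_ge// exprn_even_gt0.
Qed.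

Lemma fejer_ge (x : R) : x != 0 -> 2^-1 - 24^-1 * x ^+ 2 <= fejer x.
Proof.
move=> x0; rewrite /fejer ler_pdivlMr ?exprn_even_gt0//.
apply: le_trans (cos_le x); rewrite le_eqVlt; apply/orP; left; apply/eqP; ring.
Qed.

End cosine_bounds.

(** * Stable laws near the origin *)

Section stable_integrals.
Context {R : realType}.
Notation mu := (@lebesgue_measure R).
Let halfline : set (measurableTypeR R) := `]0, +oo[%classic.
Let mhalf : measurable halfline. Proof. exact: measurable_itv. Qed.

Let cst1_01 (x : R) : 0 <= (cst 1 x : R) <= 1.
Proof. by rewrite ler01 lexx. Qed.

(** The substitution [u = k * x `^ a] reduces stretched exponentials to Gamma integrals. *)
Lemma integral_expR_powR (k a q : R) (h : R -> R) : 0 < k -> 1 <= a -> 0 <= q ->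
  continuous h -> (forall x, 0 <= h x <= 1) ->
  (\int[mu]_(x in halfline) (x `^ q * expR (- (k * x `^ a)) * h (k * x `^ a))%:E =
   (k `^ (- ((q + 1) / a)) / a * gamma_int ((q + 1) / a) h)%:E)%E.
Proof.
move=> k0 a1 q0 ch h01.
have a0 : 0 < a by rewrite (lt_le_trans _ a1).
have p0 : 0 < a^-1 by rewrite invr_gt0.
have r0 : 0 < (q + 1) / a by rewrite divr_gt0// ltr_wpDl.
have h1 x : `|h x| <= 1 by have /andP[h0 ?] := h01 x; rewrite ger0_norm.
set c := k `^ (- a^-1).
have c0 : 0 < c by rewrite powR_gt0.
rewrite (@halfline_subst_powR R c a^-1 (fun x => x `^ q * expR (- (k * x `^ a)) * h (k * x `^ a)))//; last 3 first.
- by rewrite p0 invf_le1.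
- move=> x x0; have cm : {for x, continuous (fun x => k * x `^ a)}.
    by apply: continuousM; [exact: cst_continuous|exact: continuous_powR].
  apply: continuousM; last by apply: continuous_comp; [exact: cm|exact: ch].
  apply: continuousM; first exact: continuous_powR.
  apply: (@continuous_comp _ _ _ (fun x => - (k * x `^ a)) expR); last exact: continuous_expR.
  exact: continuousN.
- move=> x _; have /andP[h0 _] := h01 (k * x `^ a).
  by rewrite !mulr_ge0 ?powR_ge0 ?expR_ge0.
have ig := @integrable_gammaM R _ h r0 ch h1.
rewrite /gamma_int -(@RintegralZl _ _ _ mu)// -EFin_Rintegral_halfline; last first.
  by have := integrableZl mhalf (k `^ (- ((q + 1) / a)) / a) ig; apply: eq_integrable.
apply: eq_integral => u /set_mem/pos_itvP u0; congr EFin.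
have E1 : k * (c * u `^ a^-1) `^ a = u.
  rewrite powRM ?powR_ge0// /c -!powRrM mulNr mulVf ?gt_eqF//.
  by rewrite powRN !powRr1 ?(ltW k0) ?(ltW u0)// mulrA divff ?mul1r// gt_eqF.
rewrite E1 powRM ?powR_ge0// /c -!powRrM.
have -> : u `^ ((q + 1) / a - 1) = u `^ (a^-1 * q) * u `^ (a^-1 - 1).
  by rewrite -powRD ?(gt_eqF u0) ?implybT//; congr (_ `^ _); ring.
have -> : k `^ (- ((q + 1) / a)) = k `^ (- a^-1 * q) * k `^ (- a^-1).
  by rewrite -powRD ?(gt_eqF k0) ?implybT//; congr (_ `^ _); ring.
ring.
Qed.

Lemma integrable_powR_expR (k a q : R) : 0 < k -> 1 <= a -> 0 <= q ->
  mu.-integrable halfline (EFin \o (fun x => x `^ q * expR (- (k * x `^ a)))).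
Proof.
move=> k0 a1 q0; apply/integrableP; split.
  apply/measurable_EFinP; apply: measurable_halfline => x x0.
  apply: continuousM; first exact: continuous_powR.
  apply: (@continuous_comp _ _ _ (fun x => - (k * x `^ a)) expR); last exact: continuous_expR.
  apply: continuousN.
  by apply: continuousM; [exact: cst_continuous|exact: continuous_powR].
have := @integral_expR_powR k a q (cst 1) k0 a1 q0 (fun z => @cst_continuous _ _ (1 : R) z).
move=> /(_ cst1_01) E.
under eq_integral => x _.
  rewrite /= ger0_norm; last by rewrite mulr_ge0 ?powR_ge0 ?expR_ge0.
  rewrite -[X in X%:E]mulr1.
  over.
by rewrite E ltry.
Qed.

Lemma Rintegral_expR_powR (k a : R) : 0 < k -> 1 <= a ->
  \int[mu]_(x in halfline) expR (- (k * x `^ a)) = k `^ (- a^-1) / a * Gamma a^-1.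
Proof.
move=> k0 a1.
have := @integral_expR_powR k a 0 (cst 1) k0 a1 (lexx _) (fun z => @cst_continuous _ _ (1 : R) z).
move=> /(_ cst1_01); rewrite gamma_int_cst add0r div1r => E.
rewrite /Rintegral -[RHS]/(fine (_%:E)) -E; congr fine; apply: eq_integral => x _.
by rewrite powRr0 mul1r mulr1.
Qed.

Lemma integrable_expR_powRM (k a : R) (g : R -> R) : 0 < k -> 1 <= a ->
  measurable_fun setT g -> (forall x, `|g x| <= 1) ->
  mu.-integrable halfline (EFin \o (fun x => expR (- (k * x `^ a)) * g x)).
Proof.
move=> k0 a1 mg g1; apply: (le_integrable mhalf _ _ (integrable_powR_expR k a 0 k0 a1 (lexx _))).
  apply/measurable_EFinP; apply: measurable_funM; last exact: measurable_funTS.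
  apply: measurable_funTS; apply: (measurableT_comp (@measurable_expR R)).
  apply: (measurableT_comp (@oppr_measurable R setT)).
  by apply: measurable_funM => //; exact: measurable_powR.
move=> x _; rewrite /= lee_fin powRr0 mul1r normrM ler_piMr//.
Qed.

Lemma measurable_cos_powR (t k a x : R) :
  measurable_fun setT (fun u : R => cos (u * x - t * (k * u `^ a))).
Proof.
apply: (measurableT_comp (continuous_measurable_fun (@continuous_cos R))).
apply: measurable_funB; first exact: measurable_funM.
by do 2! apply: measurable_funM => //; exact: measurable_powR.
Qed.

(** [integral_expR_powR] needs a nonnegative weight, hence the detour through
    [(1 + cos) / 2], from which the cosine is recovered by linearity. *)
Lemma Rintegral_expR_cos_powR (k a t : R) : 0 < k -> 1 <= a ->
  \int[mu]_(x in halfline) (expR (- (k * x `^ a)) * cos (t * (k * x `^ a))) =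
  k `^ (- a^-1) / a * (Gamma a^-1 * (1 + t ^+ 2) `^ (- (a^-1 / 2)) * cos (a^-1 * atan t)).
Proof.
move=> k0 a1.
have a0 : 0 < a by rewrite (lt_le_trans _ a1).
have p0 : 0 < a^-1 by rewrite invr_gt0.
rewrite -gamma_int_cos_sin//.
pose h (u : R) := 2^-1 * (1 + cos (t * u)).
have ch : continuous h.
  move=> x; apply: (@continuousM _ _ (cst 2^-1) (fun u => 1 + cos (t * u))).
    exact: cst_continuous.
  by apply: continuousD; [exact: cst_continuous|exact: continuous_cosM].
have h01 x : 0 <= h x <= 1.
  by rewrite /h; have := cos_geN1 (t * x); have := cos_le1 (t * x) => *; apply/andP; split; lra.
have h1 x : `|h x| <= 1 by have /andP[h0 ?] := h01 x; rewrite ger0_norm.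
have := @integral_expR_powR k a 0 h k0 a1 (lexx _) ch h01.
rewrite add0r div1r => E.
have mc : measurable_fun setT (fun u : R => cos (t * (k * u `^ a))).
  have := measurable_cos_powR t k a 0; congr (measurable_fun _ _).
  by apply/funext => u; rewrite mulr0 sub0r cosN.
have n1 (x : R) : `|cst 1 x : R| <= 1 by rewrite normr1.
have i0 := integrable_expR_powRM k a (cst 1) k0 a1 (measurable_cst _) n1.
have i1 := integrable_expR_powRM k a (fun u => cos (t * (k * u `^ a))) k0 a1 mc (fun u => normr_cos_le1 _).
have g0 := @integrable_gammaM R _ _ p0 (fun z => @cst_continuous _ _ (1 : R) z) n1.
have g1 := @integrable_gammaM R _ _ p0 (continuous_cosM t) (fun u => normr_cos_le1 _).
have gh : gamma_int a^-1 h = 2^-1 * (Gamma a^-1 + gamma_int a^-1 (fun u => cos (t * u))).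
  rewrite -gamma_int_cst /gamma_int -(@RintegralD _ _ _ mu)// -(@RintegralZl _ _ _ mu)//; last first.
    by have := integrableD mhalf g0 g1; apply: eq_integrable.
  by apply: eq_Rintegral => u _; rewrite /h /=; ring.
have I0 : \int[mu]_(x in halfline) (expR (- (k * x `^ a)) * cst 1 x) = k `^ (- a^-1) / a * Gamma a^-1.
  by rewrite -Rintegral_expR_powR//; apply: eq_Rintegral => x _; rewrite mulr1.
have : \int[mu]_(x in halfline) (2^-1 * (expR (- (k * x `^ a)) * cst 1 x + expR (- (k * x `^ a)) * cos (t * (k * x `^ a)))) = k `^ (- a^-1) / a * gamma_int a^-1 h.
  rewrite /Rintegral -[RHS]/(fine (_%:E)) -E; congr fine; apply: eq_integral => x _.
  by congr EFin; rewrite powRr0 /h /=; ring.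
rewrite RintegralZl//; last by have := integrableD mhalf i0 i1; apply: eq_integrable.
rewrite RintegralD// I0 gh => H.
by apply: (mulfI (_ : 2^-1 != 0 :> R)); [rewrite invr_eq0|lra].
Qed.

End stable_integrals.

Section stable_kernel.
Context {d : measure_display} {T : measurableType d} {R : realType}.
Variable P : probability T R.
Notation mu := (@lebesgue_measure R).
Let halfline : set (measurableTypeR R) := `]0, +oo[%classic.
Let mhalf : measurable halfline. Proof. exact: measurable_itv. Qed.

(** Real and imaginary parts of the characteristic function
    [exp (- k |u|^a (1 + i t sgn u))]. *)
Definition stable_cf (a t k : R) (Y : T -> R) : Prop :=
  forall u : R, 0 < u ->
  \int[P]_w cos (u * Y w) = expR (- (k * u `^ a)) * cos (t * (k * u `^ a)) /\
  \int[P]_w sin (u * Y w) = - (expR (- (k * u `^ a)) * sin (t * (k * u `^ a))).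

(** The density at the origin of the law [stable_cf a t 1]; for the parameter [k] it
    is multiplied by [k `^ (- a^-1)]. *)
Definition stable_peak (a t : R) : R :=
  Gamma a^-1 * (1 + t ^+ 2) `^ (- (a^-1 / 2)) * cos (a^-1 * atan t) / (pi * a).

(** Bounds the dependence of the smoothed density on the width of the tent and on the
    starting point, see [expectation_tent_stable_near]. *)
Definition stable_moment (a k : R) : R :=
  (\int[mu]_(u in halfline) (expR (- (k * u `^ a)) * u) +
  \int[mu]_(u in halfline) (expR (- (k * u `^ a)) * u ^+ 2)) / pi.

Variables (a t k : R) (Y : T -> R).
Hypotheses (a1 : 1 <= a) (k0 : 0 < k) (mY : measurable_fun setT Y) (cfY : stable_cf a t k Y).

Lemma expectation_cos_shift (x u : R) : 0 < u ->
  \int[P]_w cos (u * (x + Y w)) = expR (- (k * u `^ a)) * cos (u * x - t * (k * u `^ a)).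
Proof.
move=> u0; have [c s] := cfY u u0.
have mc : measurable_fun setT (fun w => cos (u * Y w)).
  apply: (measurableT_comp (continuous_measurable_fun (@continuous_cos R))).
  exact: measurable_funM.
have ms : measurable_fun setT (fun w => sin (u * Y w)).
  apply: (measurableT_comp (continuous_measurable_fun (@continuous_sin R))).
  exact: measurable_funM.
have ic := integrable_bounded_prob P _ 1 mc (fun w => normr_cos_le1 _).
have is_ := integrable_bounded_prob P _ 1 ms (fun w => normr_sin_le1 _).
transitivity (cos (u * x) * \int[P]_w cos (u * Y w) - sin (u * x) * \int[P]_w sin (u * Y w)).
  rewrite -!(@RintegralZl _ _ _ P)// -(@RintegralB _ _ _ P)//; last 2 first.
  - by have := integrableZl measurableT (cos (u * x)) ic; apply: eq_integrable.
  - by have := integrableZl measurableT (sin (u * x)) is_; apply: eq_integrable.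
  by apply: eq_Rintegral => w _; rewrite mulrDr cosD.
by rewrite c s cosB; ring.
Qed.

Lemma expectation_tent_stable (e x : R) : 0 < e ->
  \int[P]_w tent e (x + Y w) = 2 / pi * \int[mu]_(u in halfline)
    (expR (- (k * u `^ a)) * (fejer (e * u) * cos (u * x - t * (k * u `^ a)))).
Proof.
move=> e0; rewrite expectation_tent_fourier//; congr (_ * _).
apply: eq_Rintegral => u /set_mem/pos_itvP u0.
by rewrite expectation_cos_shift// mulrCA.
Qed.

Let pi0 : 0 < pi :> R := pi_gt0 R.

Let fej1 (e x u : R) : `|fejer (e * u) * cos (u * x - t * (k * u `^ a))| <= 2^-1.
Proof.
rewrite normrM ger0_norm ?fejer_ge0// -[leRHS]mulr1.
by apply: ler_pM; rewrite ?fejer_ge0 ?fejer_le ?normr_cos_le1.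
Qed.

Let mfej (e x : R) : measurable_fun setT (fun u => fejer (e * u) * cos (u * x - t * (k * u `^ a))).
Proof.
apply: measurable_funM; last exact: measurable_cos_powR.
by apply: (measurableT_comp (@measurable_fejer R)); exact: mulrl_measurable.
Qed.

Let ifej (e x : R) : mu.-integrable halfline (EFin \o (fun u =>
  expR (- (k * u `^ a)) * (fejer (e * u) * cos (u * x - t * (k * u `^ a))))).
Proof.
apply: integrable_expR_powRM => // u; apply: le_trans (fej1 e x u) _.
by rewrite invf_le1// ler1n.
Qed.

(** In the Fourier integral the cosine is at most one and the Fejer kernel at most one
    half, whatever the starting point and the width. *)
Lemma expectation_tent_stable_le (e x : R) : 0 < e ->
  \int[P]_w tent e (x + Y w) <= k `^ (- a^-1) * (Gamma a^-1 / (pi * a)).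
Proof.
move=> e0; rewrite expectation_tent_stable//.
have n1 (y : R) : `|cst 1 y : R| <= 1 by rewrite normr1.
have i0 := integrable_expR_powRM k a (cst 1) k0 a1 (measurable_cst _) n1.
have -> : k `^ (- a^-1) * (Gamma a^-1 / (pi * a)) =
  2 / pi * \int[mu]_(u in halfline) (2^-1 * (expR (- (k * u `^ a)) * cst 1 u)).
  rewrite RintegralZl// (_ : \int[mu]_(u in halfline) _ = k `^ (- a^-1) / a * Gamma a^-1); last first.
    by rewrite -Rintegral_expR_powR//; apply: eq_Rintegral => u _; rewrite mulr1.
  have an : a != 0 by rewrite gt_eqF// (lt_le_trans _ a1).
  have : pi != 0 :> R by rewrite gt_eqF.
  by move: (pi : R) => p pn; field; rewrite pn an.
rewrite ler_pM2l ?divr_gt0//; apply: le_Rintegral => //.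
  by have := integrableZl mhalf 2^-1 i0; apply: eq_integrable.
move=> u _; rewrite /= mulr1 mulrC ler_pM2r ?expR_gt0//.
exact: le_trans (ler_norm _) (fej1 e x u).
Qed.

(** The Fejer kernel departs quadratically from its value one half at the origin, and
    the shift by [x] moves the cosine by at most [e * u].  The moments that bound the
    error are taken at the smallest parameter [k1], so the error is uniform in [k]. *)
Lemma expectation_tent_stable_near (e x k1 : R) : 0 < e -> e <= 1 -> `|x| <= e ->
  0 < k1 -> k1 <= k ->
  `|\int[P]_w tent e (x + Y w) - k `^ (- a^-1) * stable_peak a t| <= e * stable_moment a k1.
Proof.
move=> e0 e1 xe k10 k1k; rewrite expectation_tent_stable//.
have a0 : 0 < a by rewrite (lt_le_trans _ a1).
have mc : measurable_fun setT (fun u : R => cos (t * (k * u `^ a))).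
  have := measurable_cos_powR t k a 0; congr (measurable_fun _ _).
  by apply/funext => u; rewrite mulr0 sub0r cosN.
have ic := integrable_expR_powRM k a _ k0 a1 mc (fun u => normr_cos_le1 _).
have -> : k `^ (- a^-1) * stable_peak a t =
  2 / pi * \int[mu]_(u in halfline) (2^-1 * (expR (- (k * u `^ a)) * cos (t * (k * u `^ a)))).
  rewrite RintegralZl// Rintegral_expR_cos_powR// /stable_peak.
  have an : a != 0 by rewrite gt_eqF.
  have : pi != 0 :> R by rewrite gt_eqF.
  by move: (pi : R) => p pn; field; rewrite pn an.
have ic2 : mu.-integrable halfline (EFin \o (fun u => 2^-1 * (expR (- (k * u `^ a)) * cos (t * (k * u `^ a))))).
  by have := integrableZl mhalf 2^-1 ic; apply: eq_integrable.
have ix := ifej e x.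
rewrite -mulrBr -RintegralB//.
have iq (q : nat) : mu.-integrable halfline (EFin \o (fun u => expR (- (k1 * u `^ a)) * u ^+ q)).
  have := integrable_powR_expR k1 a q%:R k10 a1 (ler0n _ _).
  apply: eq_integrable => // u /set_mem/pos_itvP u0; rewrite /= mulrC powR_mulrn//.
  exact: ltW.
have i1 : mu.-integrable halfline (EFin \o (fun u => expR (- (k1 * u `^ a)) * u)) by exact: (iq 1).
rewrite normrM ger0_norm ?divr_ge0 ?(ltW pi0)//.
have -> : e * stable_moment a k1 = 2 / pi * \int[mu]_(u in halfline) (e / 2 * (expR (- (k1 * u `^ a)) * u + expR (- (k1 * u `^ a)) * u ^+ 2)).
  rewrite RintegralZl//; last by have := integrableD mhalf i1 (iq 2); apply: eq_integrable.
  rewrite RintegralD// /stable_moment; have : pi != 0 :> R by rewrite gt_eqF.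
  by move: (pi : R) => p pn; field; rewrite pn.
rewrite ler_pM2l ?divr_gt0//.
have iB := integrableB mhalf (ifej e x) ic2.
have iB' : mu.-integrable halfline (EFin \o (fun u => expR (- (k * u `^ a)) * (fejer (e * u) * cos (u * x - t * (k * u `^ a)))
   - 2^-1 * (expR (- (k * u `^ a)) * cos (t * (k * u `^ a))))).
  by move: iB; apply: eq_integrable.
apply: (le_trans (le_normr_Rintegral mhalf iB')).
apply: le_Rintegral => //.
- exact: integrable_norm.
- have := integrableZl mhalf (e / 2) (integrableD mhalf i1 (iq 2)).
  by apply: eq_integrable.
move=> u /pos_itvP u0 /=.
set E := expR (- (k * u `^ a)).
set m := t * (k * u `^ a).
have E0 : 0 < E by rewrite expR_gt0.
have EE : E <= expR (- (k1 * u `^ a)) by rewrite ler_expR lerN2 ler_wpM2r ?powR_ge0.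
have -> : E * (fejer (e * u) * cos (u * x - m)) - 2^-1 * (E * cos m) =
  E * ((fejer (e * u) - 2^-1) * cos (u * x - m) + 2^-1 * (cos (u * x - m) - cos m)) by ring.
have b1 : `|(fejer (e * u) - 2^-1) * cos (u * x - m)| <= 24^-1 * (e * u) ^+ 2.
  rewrite normrM -[leRHS]mulr1; apply: ler_pM => //; last exact: normr_cos_le1.
  have := @fejer_le R (e * u); have := @fejer_ge R (e * u); rewrite mulf_neq0 ?gt_eqF// => /(_ isT).
  by move=> ? ?; rewrite ler_norml; apply/andP; split; lra.
have ux : `|u * x| <= e * u by rewrite normrM (gtr0_norm u0) mulrC ler_wpM2r// ltW.
have b2 : `|cos (u * x - m) - cos m| <= 2^-1 * (e * u) ^+ 2 + e * u.
  have -> : cos (u * x - m) - cos m = - (cos m * (1 - cos (u * x))) + sin (u * x) * sin m.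
    by rewrite cosB; ring.
  apply: (le_trans (ler_normD _ _)); apply: lerD.
    rewrite normrN normrM -[leRHS]mul1r; apply: ler_pM; rewrite ?normr_cos_le1//.
    rewrite ger0_norm ?subr_ge0 ?cos_le1//; apply: le_trans (cos_ge _) _.
    rewrite ler_pM2l ?invr_gt0// -[(u * x) ^+ 2]real_normK ?num_real//.
    by rewrite lerXn2r ?nnegrE ?normr_ge0// mulr_ge0 ?ltW.
  rewrite normrM -[leRHS]mulr1; apply: ler_pM; rewrite ?normr_sin_le1//.
  exact: le_trans (normr_sin_le _) ux.
rewrite normrM (gtr0_norm E0).
have eu : (e * u) ^+ 2 <= e * u ^+ 2.
  by rewrite exprMn ler_wpM2r ?sqr_ge0// expr2 ler_piMr// ltW.
apply: (@le_trans _ _ (E * (e / 2 * (u + u ^+ 2)))).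
  rewrite ler_pM2l//; apply: (le_trans (ler_normD _ _)).
  rewrite (normrM 2^-1) (ger0_norm (_ : 0 <= 2^-1)) ?invr_ge0//.
  have u20 := sqr_ge0 u.
  have eu20 : 0 <= e * u ^+ 2 by rewrite mulr_ge0// ltW.
  lra.
have -> : e / 2 * (expR (- (k1 * u `^ a)) * u + expR (- (k1 * u `^ a)) * u ^+ 2) =
  expR (- (k1 * u `^ a)) * (e / 2 * (u + u ^+ 2)) by ring.
apply: ler_wpM2r => //.
by rewrite mulr_ge0 ?divr_ge0 ?(ltW e0)// addr_ge0 ?sqr_ge0// ltW.
Qed.

End stable_kernel.

(** * Riemann sums of decreasing functions *)

Section riemann_sums.
Context {R : realType}.
Notation mu := (@lebesgue_measure R).
Let halfline : set (measurableTypeR R) := `]0, +oo[%classic.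
Variable g : R -> R.
Hypothesis g_decr : forall x y : R, 0 < x -> x <= y -> g y <= g x.
Hypothesis g_ge0 : forall x, 0 <= g x.
Hypothesis int_g : mu.-integrable `]0, +oo[ (EFin \o g).

Let int_gS (x y : R) : 0 <= x -> mu.-integrable `]x, y] (EFin \o g).
Proof.
move=> x0; apply: integrableS int_g => //.
by move=> z; rewrite /= !in_itv/= andbT => /andP[xz _]; exact: le_lt_trans xz.
Qed.

Let I (x y : R) := \int[mu]_(z in `]x, y]) g z.

Let I_split (x y z : R) : 0 <= x -> x <= y -> y <= z -> I x z = I x y + I y z.
Proof.
move=> x0 xy yz; apply/eqP; rewrite addrC -subr_eq; apply/eqP.
by apply: Rintegral_itvB; rewrite ?bnd_simp//; exact: int_gS.
Qed.

Let I_cst (x y c : R) : x <= y -> \int[mu]_(z in `]x, y]) c = c * (y - x).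
Proof.
move=> xy; rewrite Rintegral_cst//= lebesgue_measure_itv/= lte_fin.
by case: ltP => // yx; rewrite (_ : y = x) ?subrr//; apply/eqP; rewrite eq_le yx xy.
Qed.

Let int_cst (x y c : R) : mu.-integrable `]x, y] (EFin \o cst c).
Proof.
apply: (@measurable_bounded_integrable _ _ _ mu (cst c)) => //.
  by rewrite /= lebesgue_measure_itv/=; case: ifP => _; rewrite ?ltry// -EFinB ltry.
exists `|c|; split; first exact: num_real.
by move=> M cM z _ /=; exact: ltW.
Qed.

Let I_le (x y c : R) : 0 <= x -> x <= y -> (forall z, x < z -> z <= y -> g z <= c) ->
  I x y <= c * (y - x).
Proof.
move=> x0 xy gc; rewrite -I_cst//.
apply: le_Rintegral => //; [exact: int_gS|exact: int_cst|].
by move=> z; rewrite /= in_itv/= => /andP[]; exact: gc.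
Qed.

Let I_ge (x y c : R) : 0 <= x -> x <= y -> (forall z, x < z -> z <= y -> c <= g z) ->
  c * (y - x) <= I x y.
Proof.
move=> x0 xy gc; rewrite -I_cst//.
apply: le_Rintegral => //; [exact: int_cst|exact: int_gS|].
by move=> z; rewrite /= in_itv/= => /andP[]; exact: gc.
Qed.

Let I_ge0 (x y : R) : 0 <= I x y.
Proof. by apply: Rintegral_ge0 => z _; exact: g_ge0. Qed.

Let I0_le (x : R) : 0 <= x -> I 0 x + \int[mu]_(z in `]x, +oo[) g z = \int[mu]_(z in `]0, +oo[) g z.
Proof.
move=> x0; apply/eqP; rewrite addrC eq_sym -subr_eq; apply/eqP.
by apply: Rintegral_itvB; rewrite ?bnd_simp.
Qed.

Let sum_le (e : R) (m n : nat) : 0 < e -> (m <= n)%N ->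
  \sum_(m <= j < n) e * g (j.+1%:R * e) <= I (m%:R * e) (n%:R * e).
Proof.
move=> e0; elim: n => [|n IH].
  by rewrite leqn0 => /eqP ->; rewrite big_nil; exact: I_ge0.
rewrite leq_eqVlt => /predU1P[->|]; first by rewrite big_geq//; exact: I_ge0.
rewrite ltnS => mn; rewrite big_nat_recr//=.
have ne : n%:R * e <= n.+1%:R * e by rewrite ler_pM2r// ler_nat.
rewrite (I_split (m%:R * e) (n%:R * e)) ?mulr_ge0 ?(ltW e0)//; last by rewrite ler_pM2r// ler_nat.
apply: lerD; first exact: IH.
have -> : e * g (n.+1%:R * e) = g (n.+1%:R * e) * (n.+1%:R * e - n%:R * e).
  by rewrite -natr1; ring.
apply: I_ge => //; first by rewrite mulr_ge0// ltW.
by move=> z nz zn; apply: g_decr => //; apply: le_lt_trans nz; rewrite mulr_ge0// ltW.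
Qed.

Let sum_ge (e : R) (m n : nat) : 0 < e -> (0 < m)%N -> (m <= n)%N ->
  I (m%:R * e) (n%:R * e) <= \sum_(m <= j < n) e * g (j%:R * e).
Proof.
move=> e0 m0; elim: n => [|n IH]; first by rewrite leqn0 => /eqP m00; rewrite m00 in m0.
have I0 x : 0 <= x -> I x x = 0.
  move=> x0; apply/eqP; rewrite eq_le I_ge0 andbT.
  by rewrite (le_trans (@I_le x x 0 x0 (lexx _) _)) ?mul0r// => z xz zx; have := lt_le_trans xz zx; rewrite ltxx.
rewrite leq_eqVlt => /predU1P[->|]; first by rewrite big_geq// I0// mulr_ge0// ltW.
rewrite ltnS => mn; rewrite big_nat_recr//=.
have ne : n%:R * e <= n.+1%:R * e by rewrite ler_pM2r// ler_nat.
rewrite (I_split (m%:R * e) (n%:R * e)) ?mulr_ge0 ?(ltW e0)//; last by rewrite ler_pM2r// ler_nat.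
apply: lerD; first exact: IH.
have -> : e * g (n%:R * e) = g (n%:R * e) * (n.+1%:R * e - n%:R * e).
  by rewrite -natr1; ring.
apply: I_le => //; first by rewrite mulr_ge0// ltW.
move=> z nz zn; apply: g_decr; last exact: ltW.
by rewrite mulr_gt0// ltr0n (leq_trans m0).
Qed.

Lemma riemann_upper (e : R) (n : nat) : 0 < e ->
  \sum_(0 <= j < n) e * g (j.+1%:R * e) <= \int[mu]_(z in `]0, +oo[) g z.
Proof.
move=> e0; apply: (le_trans (sum_le _ _ _ e0 (leq0n _))); rewrite mul0r.
rewrite -(I0_le (n%:R * e)) ?mulr_ge0 ?(ltW e0)// lerDl.
by apply: Rintegral_ge0 => z _; exact: g_ge0.
Qed.

Let I_approx (M : R) : M < \int[mu]_(z in `]0, +oo[) g z ->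
  exists a b : R, [/\ 0 < a, a < b & M < I a b].
Proof.
move=> MG.
have := @ge0_nondecreasing_set_cvg_integral _ (measurableTypeR R) R _ (EFin \o g) mu (@ndecr_cut R).
rewrite bigcup_cut => H.
have mg : measurable_fun (`]0, +oo[ : set R) (EFin \o g) by have /integrableP[] := int_g.
have {}H : (fun n => \int[mu]_(z in `[n.+1%:R^-1, n.+2%:R]) g z)%R @ \oo --> \int[mu]_(z in `]0, +oo[) g z.
  apply: fine_cvg; rewrite -EFin_Rintegral_halfline// in H *; apply: H.
  - by move=> n; exact: measurable_itv.
  - by move=> n; apply: measurable_funS mg => //; exact: cut_sub.
  - by move=> n x _; rewrite lee_fin.
have [n _ /(_ n (leqnn n)) Mn] := cvgr_gt _ H _ MG.
exists n.+1%:R^-1, n.+2%:R; split.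
- by rewrite invr_gt0.
- by rewrite (@le_lt_trans _ _ 1) ?invf_le1 ?ler1n// ltr1n.
rewrite /I Rintegral_itv_obnd_cbnd//.
by apply: int_gS; rewrite invr_ge0.
Qed.

(** A singularity at the origin carries little mass, uniformly in the step. *)
Lemma riemann_small (eta : R) : 0 < eta -> exists2 u0 : R, 0 < u0 &
  forall (e : R) (n : nat), 0 < e -> n%:R * e <= u0 ->
  \sum_(0 <= j < n) e * g (j.+1%:R * e) <= eta.
Proof.
move=> eta0; have [|a [b [a0 ab Mab]]] := I_approx (\int[mu]_(z in `]0, +oo[) g z - eta).
  by rewrite gtrBl.
exists a => // e n e0 na; apply: (le_trans (sum_le _ _ _ e0 (leq0n _))); rewrite mul0r.
have ne0 : 0 <= n%:R * e by rewrite mulr_ge0// ltW.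
have b0 : 0 <= b by rewrite (le_trans (ltW a0))// ltW.
have := I0_le b b0; rewrite (I_split 0 a b)// ?(ltW ab) ?(ltW a0)//.
rewrite (I_split 0 (n%:R * e) a)// => E.
have J0 : 0 <= \int[mu]_(z in `]b, +oo[) g z by apply: Rintegral_ge0 => z _; exact: g_ge0.
move: Mab E J0 (I_ge0 (n%:R * e) a).
move: (\int[mu]_(z in `]0, +oo[) g z) (\int[mu]_(z in `]b, +oo[) g z) => G J.
by move: (I 0 (n%:R * e)) (I (n%:R * e) a) (I a b) => x1 x2 x3; lra.
Qed.

(** Nodes in a window bounded away from the origin and from infinity already capture
    almost the whole integral; on such a window the kernel asymptotics are uniform. *)
Lemma riemann_lower (M : R) : M < \int[mu]_(z in `]0, +oo[) g z ->
  exists u1 u2 : R, [/\ 0 < u1, u1 < u2 & forall e : R, 0 < e -> e <= u1 ->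
   exists j1 j2 : nat, [/\ (j1 <= j2)%N, u1 <= j1%:R * e, j2%:R * e <= u2 &
     M <= \sum_(j1 <= j < j2) e * g (j%:R * e)]].
Proof.
move=> /I_approx[a [b [a0 ab Mab]]].
have b0 : 0 < b := lt_trans a0 ab.
exists (a / 2), (b + a / 2); split; [lra|lra|].
move=> e e0 ea.
have /andP[t1 t2] := truncn_itv (ltW (divr_gt0 a0 e0)).
have /andP[s1 s2] := truncn_itv (ltW (divr_gt0 b0 e0)).
rewrite ler_pdivlMr// in t1; rewrite ler_pdivlMr// in s1.
rewrite ltr_pdivrMr// -natr1 mulrDl mul1r in t2.
rewrite ltr_pdivrMr// -natr1 mulrDl mul1r in s2.
move: t1 t2 s1 s2; set j1 := Num.truncn _; set j2 := Num.truncn _ => t1 t2 s1 s2.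
have j12 : (j1 <= j2.+1)%N.
  by rewrite -(ler_nat R) -(ler_pM2r e0) -[j2.+1%:R]natr1 mulrDl mul1r; lra.
exists j1, j2.+1; split => //; [lra|by rewrite -[j2.+1%:R]natr1 mulrDl mul1r; lra|].
have j10 : (0 < j1)%N.
  by rewrite -(ltr_nat R) -(ltr_pM2r e0) mul0r; lra.
apply: le_trans (sum_ge _ _ _ e0 j10 j12).
rewrite (I_split (j1%:R * e) a) ?mulr_ge0 ?(ltW e0)//; last first.
  by rewrite -[j2.+1%:R]natr1 mulrDl mul1r; lra.
rewrite (I_split a b) ?(ltW a0) ?(ltW ab)//; last first.
  by rewrite -[j2.+1%:R]natr1 mulrDl mul1r; lra.
move: Mab (I_ge0 (j1%:R * e) a) (I_ge0 b (j2.+1%:R * e)).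
by move: (I _ a) (I a b) (I b _) => x1 x2 x3; lra.
Qed.

End riemann_sums.

(** * Independence and conditioning on the past *)

Section independent_pair.
Context {d : measure_display} {T : measurableType d} {R : realType} (P : probability T R).
Context {d1 d2 : measure_display} {T1 : measurableType d1} {T2 : measurableType d2}.
Variables (F1 : T -> T1) (F2 : T -> T2).
Hypotheses (mF1 : measurable_fun setT F1) (mF2 : measurable_fun setT F2).
Hypothesis indep : forall A B, measurable A -> measurable B ->
  P (F1 @^-1` A `&` F2 @^-1` B) = (P (F1 @^-1` A) * P (F2 @^-1` B))%E.

(** The joint law is the product of the laws, so Tonelli applies.  The values lie in
    arbitrary measurable spaces, which allows sigma-algebras of pasts and of paths. *)
Lemma integral_independent_pair (f : T1 * T2 -> \bar R) :
  measurable_fun setT f -> (forall z, 0 <= f z)%E ->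
  (\int[P]_w f (F1 w, F2 w) = \int[P]_w \int[P]_v f (F1 w, F2 v))%E.
Proof.
move=> mf f0.
pose p1 : {mfun T >-> T1} := HB.pack F1 (isMeasurableFun.Build _ _ _ _ F1 mF1).
pose p2 : {mfun T >-> T2} := HB.pack F2 (isMeasurableFun.Build _ _ _ _ F2 mF2).
have mpair : measurable_fun setT (fun w => (F1 w, F2 w)) by exact: measurable_fun_pair.
pose pp : {mfun T >-> (T1 * T2)%type} := HB.pack (fun w => (F1 w, F2 w))
  (isMeasurableFun.Build _ _ _ _ (fun w => (F1 w, F2 w)) mpair).
have E := @product_measure_unique _ _ T1 T2 R (distribution P p1) (distribution P p2) (distribution P pp).
have {}E : forall X, measurable X -> (distribution P p1 \x distribution P p2)%E X = distribution P pp X.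
  by apply: E => A B mA mB; rewrite /distribution /pushforward/= -indep.
transitivity (\int[distribution P pp]_z f z)%E; first by rewrite ge0_integral_distribution.
transitivity (\int[distribution P p1 \x distribution P p2]_z f z)%E.
  by apply: eq_measure_integral => A mA _; exact: (esym (E A mA)).
rewrite fubini_tonelli1// ge0_integral_distribution//; last 2 first.
- exact: (@measurable_fun_fubini_tonelli_F _ _ _ _ _ (distribution P p2) f mf f0).
- by move=> x; exact: integral_ge0.
apply: eq_integral => w _; rewrite /fubini_F /= ge0_integral_distribution//.
exact: (measurableT_comp mf (measurable_pair1 (F1 w))).
Qed.

End independent_pair.

Section independence.
Context {d : measure_display} {T : measurableType d} {R : realType}.
Variable P : probability T R.
Local Open Scope ereal_scope.

Definition cylinders (n : nat) (D : 'I_n -> T -> R) : set (set T) :=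
  [set E | exists B : 'I_n -> set R, (forall i, measurable (B i)) /\
    E = \bigcap_(i in [set: 'I_n]) (D i @^-1` B i)].

Variables (n : nat) (D : 'I_n.+1 -> T -> R).
Hypothesis mD : forall i, measurable_fun setT (D i).
Hypothesis indD : mutually_independent P D.

Let past (i : 'I_n) := D (widen_ord (leqnSn n) i).
Let last := D ord_max.

(** The sample space with the sigma-algebra generated by the first [n] variables: a
    function measurable for it is a function of the past. *)
Definition past_type := g_sigma_algebraType (cylinders n past).

Lemma cylinders_measurable : cylinders n past `<=` measurable.
Proof.
move=> E [B [mB ->]]; apply: fin_bigcap_measurable => // i _.
by rewrite -[X in measurable X]setTI; exact: mD.
Qed.

Lemma setI_closed_cylinders : setI_closed (cylinders n past).
Proof.
move=> _ _ [B [mB ->]] [C [mC ->]]; exists (fun i => B i `&` C i); split.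
  by move=> i; exact: measurableI.
by rewrite bigcapI.
Qed.

Lemma cylinders_setT : cylinders n past setT.
Proof.
exists (fun=> setT); split => //.
by apply/seteqP; split.
Qed.

(** The cylinders form a generating pi-system, on which the product rule is the
    hypothesis with the last set free. *)
Lemma indep_past_last (A : set T) (B : set R) : <<s cylinders n past >> A -> measurable B ->
  P (A `&` last @^-1` B) = P A * P (last @^-1` B).
Proof.
move=> sA mB.
have mlB : measurable (last @^-1` B) by rewrite -[X in measurable X]setTI; exact: mD.
have finB : P (last @^-1` B) \is a fin_num by exact: fin_num_measure.
have nnB : (0 <= fine (P (last @^-1` B)))%R by exact: fine_ge0.
pose m1 := mrestr P mlB.
pose m2 := mscale (NngNum nnB) P.
suff U : m1 A = m2 A.
  by move: U; rewrite /m1 /m2 /mrestr /mscale /= fineK// muleC.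
apply: (@g_sigma_algebra_measure_unique _ _ _ (cylinders n past) cylinders_measurable
  (fun=> setT) (fun=> cylinders_setT) _ m1 m2 setI_closed_cylinders _ _ A sA).
- by rewrite bigcup_const.
- have key (B1 : 'I_n -> set R) (C : set R) : (forall i, measurable (B1 i)) -> measurable C ->
    P ((\bigcap_(i in [set: 'I_n]) (past i @^-1` B1 i)) `&` last @^-1` C) =
    (\prod_(i < n) P (past i @^-1` B1 i)) * P (last @^-1` C).
    move=> mB1 mC.
    pose B' (i : 'I_n.+1) := oapp B1 C (insub (val i)).
    have B'w i : B' (widen_ord (leqnSn n) i) = B1 i by rewrite /B' /= valK.
    have B'm : B' ord_max = C by rewrite /B' /= insubF// ltnn.
    have mB' i : measurable (B' i) by rewrite /B'; case: insubP => [k _ _|_] /=.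
    rewrite -B'm (_ : _ `&` _ = \bigcap_(i in [set: 'I_n.+1]) (D i @^-1` B' i)); last first.
      apply/seteqP; split => w /=.
        move=> [H1 H2] i _ /=.
        have [ni|] := ltnP i n.
          have -> : i = widen_ord (leqnSn n) (Ordinal ni) by exact: val_inj.
          by rewrite B'w; exact: H1.
        rewrite leq_eqVlt ltnNge -ltnS ltn_ord orbF => /eqP ni.
        have -> : i = ord_max by exact: val_inj.
        exact: H2.
      move=> H; split; last exact: H.
      by move=> i _ /=; rewrite -B'w; exact: H.
    rewrite (indD _ mB') big_ord_recr/=.
    by congr (_ * _); apply: eq_bigr => i _; rewrite B'w.
  move=> E [B1 [mB1 ->]].
  set F := \bigcap_(i in _) _.
  transitivity (P (F `&` last @^-1` B)); first by [].
  transitivity ((fine (P (last @^-1` B)))%:E * P F); last by [].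
  rewrite fineK// key// [RHS]muleC; congr (_ * _).
  by have := key B1 setT mB1 measurableT; rewrite preimage_setT setIT [X in _ * X](_ : _ = 1) ?mule1//; exact: probability_setT.
- move=> k; apply: (@le_lt_trans _ _ 1%E); last exact: ltry.
  by apply: probability_le1; exact: measurableI.
Qed.

Definition to_past (w : T) : past_type := w.

Lemma measurable_to_past : measurable_fun setT to_past.
Proof.
apply: (@measurability _ _ _ past_type setT to_past (cylinders n past)) => //.
by move=> _ [E cE <-]; rewrite setTI; exact: cylinders_measurable.
Qed.

Lemma measurable_past (i : 'I_n) : measurable_fun setT (past i : past_type -> R).
Proof.
move=> _ B mB; rewrite setTI; apply: sub_sigma_algebra.
exists (fun j => if j == i then B else setT); split; first by move=> j; case: ifP.
apply/seteqP; split => [w wB j _ /=|w /(_ i Logic.I)/=]; last by rewrite eqxx.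
by case: eqP => // ->.
Qed.

Lemma integral_past_last (f : past_type * R -> \bar R) :
  measurable_fun setT f -> (forall z, 0 <= f z) ->
  \int[P]_w f (to_past w, last w) = \int[P]_w \int[P]_v f (to_past w, last v).
Proof. exact: (integral_independent_pair P to_past last measurable_to_past (mD ord_max) indep_past_last f). Qed.

End independence.

Section independence_real.
Context {d : measure_display} {T : measurableType d} {R : realType}.
Variable P : probability T R.
Variables (n : nat) (D : 'I_n.+1 -> T -> R).
Hypothesis mD : forall i, measurable_fun setT (D i).
Hypothesis indD : mutually_independent P D.
Notation past := (past_type n D).

(** The last variable is integrated out with the past frozen. *)
Lemma Rintegral_past_last (f V : past -> R) (h : R -> R) (M N : R) :
  measurable_fun setT f -> measurable_fun setT V -> measurable_fun setT h ->
  (forall w, 0 <= f w <= M) -> (forall x, 0 <= h x <= N) ->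
  \int[P]_w (f w * h (V w + D ord_max w)) =
  \int[P]_w (f w * \int[P]_v h (V w + D ord_max v)).
Proof.
move=> mf mV mh f0M h0N.
pose F (z : past * R) : \bar R := (f z.1 * h (V z.1 + z.2))%:E.
have mF : measurable_fun setT F.
  apply/measurable_EFinP; apply: measurable_funM.
    exact: (measurableT_comp mf measurable_fst).
  apply: (measurableT_comp mh); apply: measurable_funD.
    exact: (measurableT_comp mV measurable_fst).
  exact: measurable_snd.
have F0 z : (0 <= F z)%E.
  by have /andP[? _] := f0M z.1; have /andP[? _] := h0N (V z.1 + z.2); rewrite lee_fin mulr_ge0.
have := integral_past_last P n D mD indD F mF F0.
rewrite /Rintegral => ->; congr fine; apply: eq_integral => w _.
have mhw : measurable_fun setT (fun v => h (V w + D ord_max v)).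
  by apply: (measurableT_comp mh); apply: measurable_funD => //; exact: mD.
rewrite EFinM -(EFin_Rintegral_prob P (fun v => h (V w + D ord_max v)) N)//; last first.
  by move=> v; have /andP[? ?] := h0N (V w + D ord_max v); rewrite ger0_norm.
have /andP[f0 _] := f0M w.
rewrite -ge0_integralZl_EFin//.
- by move=> v _; have /andP[? ?] := h0N (V w + D ord_max v); rewrite lee_fin.
- exact/measurable_EFinP.
Qed.

End independence_real.

(** * Discrete renewal inequalities *)

Section renewal.
Context {R : realType}.
Implicit Types (A b : nat -> R).

Lemma sum_triangle (F : nat -> nat -> R) (n : nat) :
  \sum_(0 <= k < n) \sum_(0 <= i < k) F i (k - i)%N =
  \sum_(0 <= i < n) \sum_(0 <= j < n - i.+1) F i j.+1.
Proof.
elim: n => [|n IH]; first by rewrite !big_nil.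
rewrite big_nat_recr//= IH [RHS]big_nat_recr//= subnn big_nil addr0 -big_split/=.
rewrite big_nat [RHS]big_nat; apply: eq_bigr => i /andP[_ ni].
by rewrite subSS (_ : (n - i)%N = (n - i.+1).+1) ?big_nat_recr//=; lia.
Qed.

(** After multiplication by [r ^+ k.+1] and summation the convolution is at most [q]
    times the sum itself, and is absorbed since [q < 1].  So the growth is at most that
    of the powers of [r^-1] for every [r] at which the transform of the kernel is less
    than one. *)
Lemma renewal_upper A b (hi : nat -> R) (n : nat) (r q B : R) : 0 < r <= 1 ->
  (forall k, 0 <= A k) -> (forall k, 0 <= hi k) ->
  (forall k, (k < n)%N -> A k <= b k + \sum_(0 <= i < k) A i * hi (k - i)%N) ->
  \sum_(0 <= k < n) b k * r ^+ k.+1 <= B ->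
  \sum_(0 <= j < n) hi j.+1 * r ^+ j.+1 <= q -> q < 1 ->
  (\sum_(0 <= k < n) A k) * r ^+ n <= B / (1 - q).
Proof.
move=> /andP[r0 r1] A0 hi0 rec bB hq q1.
set S := \sum_(0 <= k < n) A k * r ^+ k.+1.
have q0 : 0 < 1 - q by rewrite subr_gt0.
have SS : S <= B + S * q.
  apply: (@le_trans _ _ (\sum_(0 <= k < n) (b k * r ^+ k.+1 + \sum_(0 <= i < k) A i * r ^+ i.+1 * (hi (k - i)%N * r ^+ (k - i))))).
    rewrite /S !big_mkord; apply: ler_sum => k _.
    apply: (le_trans (ler_wpM2r (exprn_ge0 _ (ltW r0)) (rec k (ltn_ord k)))).
    rewrite mulrDl lerD2l mulr_suml !big_mkord; apply: ler_sum => i _.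
    have -> : r ^+ k.+1 = r ^+ i.+1 * r ^+ (k - i).
      by rewrite -exprD addSn subnKC// ltnW.
    by rewrite le_eqVlt; apply/orP; left; apply/eqP; ring.
  rewrite big_split/=; apply: lerD => //.
  rewrite (sum_triangle (fun i j => A i * r ^+ i.+1 * (hi j * r ^+ j))) /S mulr_suml.
  rewrite big_nat [leRHS]big_nat; apply: ler_sum => i /andP[_ ni].
  rewrite -mulr_sumr; apply: ler_wpM2l; first by rewrite mulr_ge0// exprn_ge0// ltW.
  apply: le_trans hq.
  have nin : (n - i.+1 <= n)%N by rewrite leq_subr.
  rewrite [leRHS](big_cat_nat (leq0n _) nin)//= lerDl; apply: sumr_ge0 => j _.
  by rewrite mulr_ge0// exprn_ge0// ltW.
rewrite ler_pdivlMr//.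
apply: (@le_trans _ _ (S * (1 - q))); last by rewrite mulrBr mulr1 lerBlDr.
rewrite ler_pM2r// mulr_suml /S big_nat [leRHS]big_nat; apply: ler_sum => k /andP[_ kn].
by apply: ler_wpM2l => //; apply: ler_wiXn2l; rewrite ?(ltW r0).
Qed.

(** If the transform of the kernel at [r] is at least one, then [A k * r ^+ k] stays
    above its values on a window of length [J], by strong induction.  The bound [beta]
    holds from [K] on only, and the last [K] terms alone are summed, whence the
    exponent [2 * K + J]. *)
Lemma renewal_lower A (lo : nat -> R) (n J K : nat) (r beta : R) : 0 < r <= 1 ->
  0 <= beta -> (forall j, 0 <= lo j) ->
  (forall k, (k < n)%N -> \sum_(0 <= i < k) A i * lo (k - i)%N <= A k) ->
  (forall k, (K <= k < n)%N -> beta <= A k) -> (forall k, 0 <= A k) ->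
  1 <= \sum_(0 <= j < J) lo j.+1 * r ^+ j.+1 ->
  (2 * K <= n)%N ->
  K%:R * beta * r ^+ (2 * K + J) <= (\sum_(0 <= k < n) A k) * r ^+ n.
Proof.
move=> /andP[r0 r1] b0 lo0 rec bA A0 loJ Kn.
have claim k : (K <= k)%N -> (k < n)%N -> beta * r ^+ (K + J) <= A k * r ^+ k.
  elim/ltn_ind: k => k IH Kk kn.
  have [kKJ|KJk] := ltnP k (K + J)%N.
    apply: ler_pM => //; [by rewrite exprn_ge0// ltW|by apply: bA; rewrite Kk|].
    by apply: ler_wiXn2l; rewrite ?(ltW r0)// ltnW.
  apply: le_trans (ler_wpM2r (exprn_ge0 _ (ltW r0)) (rec k kn)).
  rewrite mulr_suml.
  apply: (@le_trans _ _ (\sum_(k - J <= i < k) A i * lo (k - i)%N * r ^+ k)); last first.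
    have kJ : (k - J <= k)%N by rewrite leq_subr.
    rewrite [leRHS](big_cat_nat (leq0n _) kJ)//= lerDr big_nat; apply: sumr_ge0 => i _.
    by rewrite !mulr_ge0// exprn_ge0// ltW.
  have JK : (J <= k)%N by apply: leq_trans KJk; rewrite leq_addl.
  apply: (@le_trans _ _ (\sum_(0 <= j < J) (beta * r ^+ (K + J)) * (lo j.+1 * r ^+ j.+1))).
    rewrite -mulr_sumr -[leLHS]mulr1; apply: ler_wpM2l => //.
    by rewrite mulr_ge0// exprn_ge0// ltW.
  rewrite -{1}(add0n (k - J)%N) big_addn subKn// [leLHS]big_nat_rev/= add0n.
  rewrite big_nat [leRHS]big_nat; apply: ler_sum => j /andP[_ jJ].
  have -> : (k - (j + (k - J)) = (J - j.+1).+1)%N by lia.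
  have -> : r ^+ k = r ^+ (j + (k - J)) * r ^+ (J - j.+1).+1.
    by rewrite -exprD; congr (_ ^+ _); lia.
  have -> : A (j + (k - J))%N * lo (J - j.+1).+1 * (r ^+ (j + (k - J)) * r ^+ (J - j.+1).+1) =
    (A (j + (k - J))%N * r ^+ (j + (k - J))) * (lo (J - j.+1).+1 * r ^+ (J - j.+1).+1) by ring.
  apply: ler_wpM2r; first by rewrite mulr_ge0// exprn_ge0// ltW.
  by apply: IH; lia.
rewrite mulr_suml.
apply: (@le_trans _ _ (\sum_(n - K <= k < n) A k * r ^+ n)); last first.
  have nK : (n - K <= n)%N by rewrite leq_subr.
  rewrite [leRHS](big_cat_nat (leq0n _) nK)//= lerDr; apply: sumr_ge0 => i _.
  by rewrite !mulr_ge0// exprn_ge0// ltW.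
apply: (@le_trans _ _ (\sum_(n - K <= k < n) beta * r ^+ (2 * K + J))).
  rewrite big_const_nat iter_addr_0 subKn; last by lia.
  by rewrite -mulrA mulr_natl.
rewrite big_nat [leRHS]big_nat; apply: ler_sum => k /andP[Kk kn].
have -> : r ^+ (2 * K + J) = r ^+ (K + J) * r ^+ K by rewrite -exprD; congr (_ ^+ _); lia.
have -> : r ^+ n = r ^+ k * r ^+ (n - k) by rewrite -exprD subnKC// ltnW.
rewrite !mulrA; apply: ler_pM.
- by rewrite mulr_ge0// exprn_ge0// ltW.
- by rewrite exprn_ge0// ltW.
- by apply: claim; lia.
- by apply: ler_wiXn2l; rewrite ?(ltW r0)//; lia.
Qed.

End renewal.

(** * Exponential functionals of a Levy process *)

Lemma Rintegral_same_law {d} {T : measurableType d} {R : realType} (P : probability T R)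
  (Y Y' : T -> R) (f : R -> R) : measurable_fun setT Y -> measurable_fun setT Y' ->
  measurable_fun setT f -> (forall y, 0 <= f y) -> same_law P Y Y' ->
  \int[P]_w f (Y w) = \int[P]_w f (Y' w).
Proof.
move=> mY mY' mf f0 YY'; rewrite /Rintegral; congr fine.
have mF : measurable_fun setT (EFin \o f) by exact/measurable_EFinP.
have F0 y : (0 <= (EFin \o f) y)%E by rewrite lee_fin.
rewrite -(@ge0_integral_pushforward _ _ _ _ _ _ mY P setT (EFin \o f) measurableT mF (fun y _ => F0 y)).
rewrite -(@ge0_integral_pushforward _ _ _ _ _ _ mY' P setT (EFin \o f) measurableT mF (fun y _ => F0 y)).
by apply: eq_measure_integral => A mA _; exact: YY'.
Qed.

Lemma measurable_Rintegral_shift {d} {T : measurableType d} {R : realType} (P : probability T R)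
  (Y : T -> R) (h : R -> R) : measurable_fun setT Y -> measurable_fun setT h ->
  (forall y, 0 <= h y) -> measurable_fun setT (fun x : R => \int[P]_w h (x + Y w)).
Proof.
move=> mY mh h0.
pose F (z : R * T) : \bar R := (h (z.1 + Y z.2))%:E.
have mF : measurable_fun setT F.
  apply/measurable_EFinP; apply: (measurableT_comp mh); apply: measurable_funD => //.
  exact: (measurableT_comp mY measurable_snd).
apply: (measurableT_comp (fine_measurable measurableT)).
by apply: (@measurable_fun_fubini_tonelli_F _ _ _ _ _ P F mF) => z; rewrite lee_fin.
Qed.

Section hitting_weights.
Context {d : measure_display} {T : measurableType d} {R : realType}.
Variable P : probability T R.
Variable X : R -> {RV P >-> R}.
Hypothesis X_levy : is_levy X.
Variables (s : nat -> R) (h : R -> R) (e N : R).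
Hypotheses (s_ge0 : 0 <= s 0%N) (s_nd : forall i, s i <= s i.+1).
Hypothesis mh : measurable_fun setT h.
Hypothesis h_bnd : forall x, 0 <= h x <= N.
Hypothesis h_supp : forall x, e < `|x| -> h x = 0.

Let U (m : nat) (w : T) : R := X (s m) w - X (s 0%N) w.

(** With [h = expR f - 1] this is the exponential of the sum of the values of [f]
    along the times; expanding it factor by factor reveals a renewal structure. *)
Definition hit_product (m : nat) (w : T) : R :=
  \prod_(0 <= i < m) (1 + h (U i.+1 w)).

Definition hit_weight (k : nat) : R :=
  \int[P]_w (hit_product k w * h (U k.+1 w)).

Let mU m : measurable_fun setT (U m).
Proof. exact: measurable_funB. Qed.

Let N0 : 0 <= N. Proof. by have /andP[] := h_bnd 0; exact: le_trans. Qed.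

Let prod_bnd m w : 1 <= hit_product m w <= (1 + N) ^+ m.
Proof.
rewrite /hit_product; elim: m => [|m IH]; first by rewrite big_nil expr0 lexx.
have /andP[i1 i2] := IH; have /andP[h0 hN] := h_bnd (U m.+1 w).
rewrite big_nat_recr//= exprSr; apply/andP; split.
  by rewrite -[leLHS]mulr1; apply: ler_pM => //; rewrite lerDl.
apply: ler_pM => //; [exact: le_trans i1|by rewrite addr_ge0|by rewrite lerD2l].
Qed.

Let mprod m : measurable_fun setT (hit_product m).
Proof.
elim: m => [|m IH].
  rewrite (_ : hit_product 0 = cst 1); first exact: measurable_cst.
  by apply/funext => w; rewrite /hit_product big_nil.
rewrite (_ : hit_product m.+1 = (fun w => hit_product m w * (1 + h (U m.+1 w)))).
  apply: measurable_funM => //; apply: measurable_funD => //.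
  exact: (measurableT_comp mh (mU m.+1)).
by apply/funext => w; rewrite /hit_product big_nat_recr.
Qed.

Let mhU m : measurable_fun setT (fun w => h (U m w)).
Proof. exact: (measurableT_comp mh (mU m)). Qed.

Let bw k (f : T -> R) (M : R) : measurable_fun setT f -> (forall w, 0 <= f w <= M) ->
  P.-integrable setT (EFin \o (fun w => hit_product k w * f w)).
Proof.
move=> mf f0M; apply: (@integrable_bounded_prob _ _ _ P _ ((1 + N) ^+ k * M)).
  exact: measurable_funM.
move=> w; have /andP[p1 pM] := prod_bnd k w; have /andP[f0 fM] := f0M w.
by rewrite ger0_norm; [apply: ler_pM => //|apply: mulr_ge0 => //]; exact: le_trans p1.
Qed.

Let iprod k : P.-integrable setT (EFin \o hit_product k).
Proof.
apply: (@integrable_bounded_prob _ _ _ P _ ((1 + N) ^+ k)) => // w.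
by have /andP[p1 pM] := prod_bnd k w; rewrite ger0_norm// (le_trans _ p1).
Qed.

Let ihw k : P.-integrable setT (EFin \o (fun w => hit_product k w * h (U k.+1 w))).
Proof. by apply: (bw k _ N). Qed.

Lemma hit_weight_ge0 k : 0 <= hit_weight k.
Proof.
apply: Rintegral_ge0 => w _; have /andP[p1 _] := prod_bnd k w.
by have /andP[h0 _] := h_bnd (U k.+1 w); rewrite mulr_ge0// (le_trans _ p1).
Qed.

Lemma expectation_hit_product n :
  \int[P]_w hit_product n w = 1 + \sum_(0 <= k < n) hit_weight k.
Proof.
elim: n => [|n IH].
  rewrite big_nil addr0 (_ : hit_product 0 = cst 1); last first.
    by apply/funext => w; rewrite /hit_product big_nil.
  rewrite Rintegral_cst// mul1r [X in fine X](_ : _ = 1%E)//; exact: probability_setT.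
rewrite big_nat_recr//= addrA -IH /hit_weight -(@RintegralD _ _ _ P)//.
by apply: eq_Rintegral => w _; rewrite /hit_product big_nat_recr//=; ring.
Qed.

(** [hit_product m] is 1 plus the sum of the [hit_product i * h (U i.+1)] for [i < m]
    by telescoping; the identity is integrated against one more factor. *)
Lemma hit_weight_split k : hit_weight k = \int[P]_w h (U k.+1 w) +
  \sum_(0 <= i < k) \int[P]_w (hit_product i w * h (U i.+1 w) * h (U k.+1 w)).
Proof.
suff E m : \int[P]_w (hit_product m w * h (U k.+1 w)) = \int[P]_w h (U k.+1 w) +
    \sum_(0 <= i < m) \int[P]_w (hit_product i w * h (U i.+1 w) * h (U k.+1 w)) by exact: E.
elim: m => [|m IH].
  rewrite big_nil addr0; apply: eq_Rintegral => w _.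
  by rewrite /hit_product big_nil mul1r.
rewrite big_nat_recr//= addrA -IH -(@RintegralD _ _ _ P)//.
- apply: eq_Rintegral => w _; rewrite [hit_product m.+1 w]big_nat_recr//= -/(hit_product m w).
  by ring.
- by apply: (bw m _ N).
- under eq_fun do rewrite -mulrA.
  apply: (bw m _ (N * N)); first exact: measurable_funM.
  move=> w; have /andP[p1 pM] := h_bnd (U m.+1 w); have /andP[h0 hN] := h_bnd (U k.+1 w).
  by rewrite mulr_ge0//= ler_pM.
Qed.

(** The Markov property at the time [s i.+1].  Only consecutive increments are
    assumed independent, so the sequence [t] jumps from [s i.+1] to [s k.+1]. *)
Lemma hit_weight_markov i k : (i < k)%N ->
  \int[P]_w (hit_product i w * h (U i.+1 w) * h (U k.+1 w)) =
  \int[P]_w (hit_product i w * h (U i.+1 w) *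
    \int[P]_v h (U i.+1 w + (X (s k.+1) v - X (s i.+1) v))).
Proof.
move=> ik.
pose t (m : nat) := if (m <= i.+1)%N then s m else s k.+1.
have s_homo (a b : nat) : (a <= b)%N -> s a <= s b.
  by move=> /subnK <-; elim: (b - a)%N => [|c IH]; rewrite ?add0n// addSn (le_trans IH).
have t_nd m : t m <= t m.+1.
  rewrite /t; have [m1|m1] := leqP m.+1 i.+1; first by rewrite ltnW//.
  by have [m2|m2] := leqP m i.+1; [apply: s_homo; lia|exact: lexx].
have t0 : 0 <= t 0%N by rewrite /t.
have ind := levy_independent_increments X_levy (n := i.+2) (t := t) t0 t_nd.
set D := (fun _ : 'I_i.+2 => _) in ind.
have mD j : measurable_fun setT (D j) by exact: measurable_funB.
have mpast m : (m <= i.+1)%N -> measurable_fun setT (U m : past_type i.+1 D -> R).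
  elim: m => [_|m IH mi].
    rewrite (_ : U 0 = cst 0); first exact: measurable_cst.
    by apply/funext => w; rewrite /U subrr.
  rewrite (_ : U m.+1 = (fun w => U m w + D (widen_ord (leqnSn _) (Ordinal mi)) w)).
    apply: measurable_funD; first by apply: IH; exact: ltnW.
    exact: measurable_past.
  apply/funext => w; rewrite /U /D /= /t mi (ltnW mi); ring.
have mprodpast m : (m <= i.+1)%N -> measurable_fun setT (hit_product m : past_type i.+1 D -> R).
  elim: m => [_|m IH mi].
    rewrite (_ : hit_product 0 = cst 1); first exact: measurable_cst.
    by apply/funext => w; rewrite /hit_product big_nil.
  rewrite (_ : hit_product m.+1 = (fun w => hit_product m w * (1 + h (U m.+1 w)))).
    apply: measurable_funM => //; first by apply: IH; exact: ltnW.
    apply: measurable_funD; first exact: measurable_cst.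
    exact: (measurableT_comp mh (mpast _ mi)).
  by apply/funext => w; rewrite /hit_product big_nat_recr.
have DE v : D ord_max v = X (s k.+1) v - X (s i.+1) v.
  by rewrite /D /= /t leqnn ltnn.
have Q := @Rintegral_past_last _ _ _ P i.+1 D mD ind
  (fun w => hit_product i w * h (U i.+1 w)) (U i.+1) h ((1 + N) ^+ i * N) N.
have UE w : U k.+1 w = U i.+1 w + D ord_max w by rewrite DE /U; ring.
transitivity (\int[P]_w (hit_product i w * h (U i.+1 w) * h (U i.+1 w + D ord_max w))).
  by apply: eq_Rintegral => w _; rewrite UE.
rewrite Q; last 5 first.
- apply: measurable_funM; first by apply: mprodpast; exact: leqnSn.
  exact: (measurableT_comp mh (mpast _ (leqnn _))).
- exact: mpast.
- exact: mh.
- move=> w; have /andP[p1 pM] := prod_bnd i w; have /andP[h0 hN] := h_bnd (U i.+1 w).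
  by have p0 := le_trans ler01 p1; rewrite mulr_ge0//= ler_pM.
- exact: h_bnd.
by apply: eq_Rintegral => w _; congr (_ * _); apply: eq_Rintegral => v _; rewrite DE.
Qed.

(** [h] vanishes away from the origin, so that only starting points near the origin
    contribute; this makes the terms of [hit_weight_split] those of a convolution. *)
Lemma hit_weight_markov_bounds (lo hi : R) i k : (i < k)%N ->
  (forall x, `|x| <= e -> lo <= \int[P]_w h (x + X (s k.+1 - s i.+1) w) <= hi) ->
  hit_weight i * lo <= \int[P]_w (hit_product i w * h (U i.+1 w) * h (U k.+1 w)) <= hit_weight i * hi.
Proof.
move=> ik hb; rewrite hit_weight_markov// /hit_weight.
have s_homo (a b : nat) : (a <= b)%N -> s a <= s b.
  by move=> /subnK <-; elim: (b - a)%N => [|c IH]; rewrite ?add0n// addSn (le_trans IH).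
have lawE x : \int[P]_v h (x + (X (s k.+1) v - X (s i.+1) v)) =
    \int[P]_v h (x + X (s k.+1 - s i.+1) v).
  apply: (@Rintegral_same_law _ _ _ P (fun v => X (s k.+1) v - X (s i.+1) v)
    (X (s k.+1 - s i.+1)) (fun y => h (x + y))).
  - exact: measurable_funB.
  - by [].
  - by apply: (measurableT_comp mh); exact: measurable_funD.
  - by move=> y; have /andP[] := h_bnd (x + y).
  - apply: (levy_stationary_increments X_levy); last by apply: s_homo; lia.
    by apply: (le_trans s_ge0); exact: s_homo.
under [X in _ <= X <= _]eq_Rintegral do rewrite lawE.
pose g x := if `|x| <= e then \int[P]_v h (x + X (s k.+1 - s i.+1) v) else 0.
have gb w : lo * (hit_product i w * h (U i.+1 w)) <=
    hit_product i w * h (U i.+1 w) * (\int[P]_v h (U i.+1 w + X (s k.+1 - s i.+1) v)) <=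
    hi * (hit_product i w * h (U i.+1 w)).
  have [Ue|Ue] := leP `|U i.+1 w| e; last by rewrite h_supp// !(mulr0, mul0r) lexx.
  have /andP[l1 l2] := hb _ Ue.
  have p0 : 0 <= hit_product i w * h (U i.+1 w).
    have /andP[p1 _] := prod_bnd i w; have /andP[h0 _] := h_bnd (U i.+1 w).
    by rewrite mulr_ge0// (le_trans _ p1).
  by rewrite ![_ * (_ * h _)]mulrC !ler_wpM2l.
have iM : P.-integrable setT (EFin \o (fun w => hit_product i w * h (U i.+1 w) *
    (\int[P]_v h (U i.+1 w + X (s k.+1 - s i.+1) v)))).
  have mg : measurable_fun setT (fun x : R => \int[P]_v h (x + X (s k.+1 - s i.+1) v)).
    by apply: measurable_Rintegral_shift => // y; have /andP[] := h_bnd y.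
  apply: (@integrable_bounded_prob _ _ _ P _ ((1 + N) ^+ i * N * N)).
    apply: measurable_funM; first exact: measurable_funM.
    exact: (measurableT_comp mg (mU i.+1)).
  move=> w; have /andP[p1 pM] := prod_bnd i w; have /andP[h0 hN] := h_bnd (U i.+1 w).
  have p0 := le_trans ler01 p1.
  have g0 : 0 <= \int[P]_v h (U i.+1 w + X (s k.+1 - s i.+1) v).
    by apply: Rintegral_ge0 => v _; have /andP[] := h_bnd (U i.+1 w + X (s k.+1 - s i.+1) v).
  rewrite ger0_norm; last by rewrite !mulr_ge0.
  apply: ler_pM; rewrite ?mulr_ge0//; first by rewrite ler_pM.
  rewrite -[leRHS]mulr1 -[X in _ * X](_ : fine (P setT) = 1); last first.
    by rewrite [X in fine X](_ : _ = 1%E)//; exact: probability_setT.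
  rewrite -Rintegral_cst//; apply: le_Rintegral => //.
  - apply: (@integrable_bounded_prob _ _ _ P _ N).
      by apply: (measurableT_comp mh); exact: measurable_funD.
    by move=> v; have /andP[? ?] := h_bnd (U i.+1 w + X (s k.+1 - s i.+1) v); rewrite ger0_norm.
  - exact: finite_measure_integrable_cst.
  - by move=> v _; have /andP[] := h_bnd (U i.+1 w + X (s k.+1 - s i.+1) v).
have ii := ihw i.
rewrite ![_ * lo]mulrC ![_ * hi]mulrC -!RintegralZl//; apply/andP; split.
- apply: le_Rintegral => //; last by move=> w _; have /andP[] := gb w.
  exact: (integrableZl measurableT lo ii).
- apply: le_Rintegral => //; last by move=> w _; have /andP[] := gb w.
  exact: (integrableZl measurableT hi ii).
Qed.

End hitting_weights.

Section pulses.
Context {R : realType}.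
Implicit Types (p e x y : R).

(** A product of factors [1 + pulse p e] is the exponential of [p] times a sum of tents. *)
Definition pulse p e x : R := expR (p * tent e x) - 1.

Lemma expR_sub1_le x : 0 <= x -> x <= 2^-1 -> expR x - 1 <= x * (1 + 2 * x).
Proof.
move=> x0 x2; have := @expR_ge1Dx R (- x); rewrite expRN => h.
have x1 : 0 < 1 - x by lra.
have : expR x <= (1 - x)^-1 by rewrite -[leLHS]invrK lef_pV2// posrE invr_gt0 expR_gt0.
move=> /le_trans -/(_ (1 + x * (1 + 2 * x))); rewrite lerBlDl; apply.
by rewrite -[leLHS]mul1r ler_pdivrMr//; nra.
Qed.

Lemma pulse_ge p e x : p * tent e x <= pulse p e x.
Proof. by rewrite /pulse lerBrDl expR_ge1Dx. Qed.

Lemma tent_supp e x : e < `|x| -> tent e x = 0.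
Proof. by move=> ex; rewrite /tent (max_idPl _) ?mul0r// subr_le0 ltW. Qed.

Lemma pulse_supp p e x : e < `|x| -> pulse p e x = 0.
Proof. by move=> ex; rewrite /pulse tent_supp// mulr0 expR0 subrr. Qed.

Lemma pulse_le p e x : 0 <= p -> 0 < e -> p / e <= 2^-1 ->
  pulse p e x <= p * (1 + 2 * (p / e)) * tent e x.
Proof.
move=> p0 e0 pe; have t0 := tent_ge0 e x; have te := tent_le e x e0.
have pt : p * tent e x <= p / e by apply: ler_wpM2l.
apply: (le_trans (expR_sub1_le (p * tent e x) _ (le_trans pt pe))); first exact: mulr_ge0.
rewrite [leRHS]mulrAC; apply: ler_wpM2l; first exact: mulr_ge0.
by rewrite lerD2l ler_wpM2l.
Qed.

Lemma pulse_bnd p e x : 0 <= p -> 0 < e -> p / e <= 2^-1 -> 0 <= pulse p e x <= 2 * (p / e).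
Proof.
move=> p0 e0 pe; have t0 := tent_ge0 e x; have te := tent_le e x e0.
have pt : p * tent e x <= p / e by apply: ler_wpM2l.
have pt0 : 0 <= p * tent e x by exact: mulr_ge0.
rewrite (le_trans pt0 (pulse_ge p e x))/=; apply: (le_trans (pulse_le _ _ _ p0 e0 pe)).
rewrite mulrAC [leRHS]mulrC; apply: ler_pM => //; last by lra.
by have : 0 <= p / e by [apply: divr_ge0; rewrite ?(ltW e0)]; lra.
Qed.

Lemma measurable_pulse p e : measurable_fun setT (pulse p e).
Proof.
apply: measurable_funB => //; apply: (measurableT_comp (@measurable_expR R)).
by apply: measurable_funM => //; exact: measurable_tent.
Qed.

Context {d : measure_display} {T : measurableType d}.
Variable P : probability T R.

Lemma integrable_tent_shift e (Y : T -> R) x : 0 < e -> measurable_fun setT Y ->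
  P.-integrable setT (EFin \o (fun w => tent e (x + Y w))).
Proof.
move=> e0 mY; apply: (@integrable_bounded_prob _ _ _ P _ (e^-1)).
  by apply: (measurableT_comp (measurable_tent e)); exact: measurable_funD.
by move=> w; rewrite ger0_norm ?tent_ge0 ?tent_le.
Qed.

Lemma expectation_pulse_bounds p e (Y : T -> R) x : 0 <= p -> 0 < e -> p / e <= 2^-1 ->
  measurable_fun setT Y ->
  p * \int[P]_w tent e (x + Y w) <= \int[P]_w pulse p e (x + Y w) <=
  p * (1 + 2 * (p / e)) * \int[P]_w tent e (x + Y w).
Proof.
move=> p0 e0 pe mY; have it := integrable_tent_shift e Y x e0 mY.
have ip : P.-integrable setT (EFin \o (fun w => pulse p e (x + Y w))).
  apply: (@integrable_bounded_prob _ _ _ P _ (2 * (p / e))).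
    by apply: (measurableT_comp (measurable_pulse p e)); exact: measurable_funD.
  by move=> w; have /andP[? ?] := pulse_bnd p e (x + Y w) p0 e0 pe; rewrite ger0_norm.
rewrite -!RintegralZl//; apply/andP; split; apply: le_Rintegral => //.
- exact: (integrableZl measurableT _ it).
- by move=> w _; exact: pulse_ge.
- exact: (integrableZl measurableT _ it).
- by move=> w _; exact: pulse_le.
Qed.

End pulses.

(** * Riemann sums of the Gamma density *)

Section gamma_sums.
Context {R : realType}.
Notation mu := (@lebesgue_measure R).
Variable theta : R.
Hypotheses (theta0 : 0 < theta) (theta1 : theta < 1).

Lemma powR_theta_le (x y : R) : 0 < x -> x <= y -> y `^ (theta - 1) <= x `^ (theta - 1).
Proof.
move=> x0 xy; have -> : theta - 1 = - (1 - theta) by ring.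
rewrite !powRN lef_pV2 ?posrE ?powR_gt0 ?(lt_le_trans x0 xy)//.
by apply: ge0_ler_powR; rewrite ?nnegrE ?subr_ge0 ?(ltW theta1) ?(ltW x0) ?(le_trans (ltW x0) xy).
Qed.

Definition gamma_density (u : R) : R := u `^ (theta - 1) * expR (- u).

Let g_ge0 u : 0 <= gamma_density u.
Proof. by rewrite mulr_ge0 ?powR_ge0 ?expR_ge0. Qed.

Let g_decr (x y : R) : 0 < x -> x <= y -> gamma_density y <= gamma_density x.
Proof.
move=> x0 xy; apply: ler_pM; rewrite ?powR_ge0 ?expR_ge0// ?ler_expR ?lerN2//.
exact: powR_theta_le.
Qed.

(** Geometric weights turn the kernel [s `^ (theta - 1)] into a Gamma density with
    mesh [la * de]; the factor [la `^ (- theta)] is what determines the growth rate. *)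
Lemma gamma_density_scale (la de : R) (j : nat) : 0 < la -> 0 < de ->
  de * (j%:R * de) `^ (theta - 1) * expR (- (la * de)) ^+ j =
  la `^ (- theta) * (la * de * gamma_density (j%:R * (la * de))).
Proof.
move=> la0 de0; rewrite /gamma_density -expRM_natl.
have -> : expR (j%:R * - (la * de)) = expR (- (j%:R * (la * de))) by rewrite mulrN.
have -> : (j%:R * (la * de)) = la * (j%:R * de) by ring.
rewrite [(la * (j%:R * de)) `^ _]powRM ?mulr_ge0 ?(ltW la0) ?(ltW de0)//.
have E : la `^ (- theta) * la * la `^ (theta - 1) = 1.
  rewrite -{2}(@powRr1 _ la) ?(ltW la0)// -!powRD ?(gt_eqF la0) ?implybT//.
  by rewrite (_ : - theta + 1 + (theta - 1) = 0) ?powRr0//; ring.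
rewrite -[LHS]mul1r -[X in X * _ = _]E; ring.
Qed.

Lemma gamma_sum_upper (e : R) n : 0 < e ->
  \sum_(0 <= j < n) e * gamma_density (j.+1%:R * e) <= Gamma theta.
Proof. by apply: riemann_upper => //; exact: integrable_gamma. Qed.

Lemma Gamma_gt0 : 0 < Gamma theta.
Proof.
apply: lt_le_trans (gamma_sum_upper 1 1 ltr01); rewrite big_nat1 !mul1r.
by rewrite /gamma_density mulr_gt0 ?powR_gt0 ?expR_gt0.
Qed.

Lemma gamma_sum_small (eta : R) : 0 < eta -> exists2 u0 : R, 0 < u0 &
  forall (e : R) (n : nat), 0 < e -> n%:R * e <= u0 ->
  \sum_(0 <= j < n) e * gamma_density (j.+1%:R * e) <= eta.
Proof. by apply: riemann_small => //; exact: integrable_gamma. Qed.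

Lemma gamma_sum_cut (eta : R) : 0 < eta -> exists2 u0 : R, 0 < u0 &
  forall (e : R) (n : nat), 0 < e -> \sum_(0 <= j < n)
    (if j.+1%:R * e <= u0 then e * gamma_density (j.+1%:R * e) else 0) <= eta.
Proof.
move=> eta0; have [u0 u00 h] := gamma_sum_small eta eta0.
exists u0 => // e n e0; elim: n => [|n IH]; first by rewrite big_nil ltW.
have [nu0|nu0] := leP (n.+1%:R * e) u0; last first.
  by rewrite big_nat_recr//= [n.+1%:R * e <= u0]leNgt nu0/= addr0.
apply: le_trans (h e n.+1 e0 nu0); rewrite big_nat [leRHS]big_nat; apply: ler_sum => j _.
by case: ifP => // _; rewrite mulr_ge0// ltW.
Qed.

Lemma gamma_sum_lower (M : R) : M < Gamma theta ->
  exists u1 u2 : R, [/\ 0 < u1, u1 < u2 & forall e : R, 0 < e -> e <= u1 ->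
   exists j1 j2 : nat, [/\ (j1 <= j2)%N, u1 <= j1%:R * e, j2%:R * e <= u2 &
     M <= \sum_(j1 <= j < j2) e * gamma_density (j%:R * e)]].
Proof. by apply: riemann_lower => //; exact: integrable_gamma. Qed.

End gamma_sums.

(** * Exponential moments of occupation sums *)

Lemma exists_nat_ge {R : realType} (x : R) :
  exists n0 : nat, forall n, (n0 <= n)%N -> (0 < n)%N /\ x <= n%:R.
Proof.
exists (Num.truncn x).+1 => n nn0; split; first exact: leq_trans nn0.
by apply/ltW/(lt_le_trans (truncnS_gt _)); rewrite ler_nat.
Qed.

Lemma le_divD1M {R : realType} (e x Q : R) : 0 < x -> 0 <= Q -> e <= x / (Q + 1) -> e * Q <= x.
Proof.
move=> x0 Q0 eQ; have Q1 : 0 < Q + 1 by lra.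
apply: (le_trans (ler_wpM2r Q0 eQ)).
by rewrite mulrAC ler_pdivrMr// ler_wpM2l ?(ltW x0)//; lra.
Qed.

Section occupation_moments.
Context {d : measure_display} {T : measurableType d} {R : realType}.
Variable P : probability T R.
Variable X : R -> {RV P >-> R}.
Hypothesis X_levy : is_levy X.
Variables theta c C : R.
Hypotheses (theta0 : 0 < theta) (theta1 : theta < 1) (c0 : 0 < c) (C0 : 0 < C).
Hypothesis kernel_le : forall e s x : R, 0 < e -> 0 < s ->
  \int[P]_w tent e (x + X s w) <= C * s `^ (theta - 1).
Hypothesis kernel_near : forall s0 : R, 0 < s0 -> exists2 M : R, 0 <= M &
  forall e s x : R, 0 < e -> e <= 1 -> `|x| <= e -> s0 <= s ->
  `|\int[P]_w tent e (x + X s w) - c * s `^ (theta - 1)| <= e * M.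
Variables a b : R.
Hypotheses (a0 : 0 <= a) (ab : a < b).

Definition mesh (n : nat) : R := (b - a) / n%:R.

(** Time 0 comes first, so that increments from [grid n 0] are values of the process
    at the [n] nodes between [a] and [b]. *)
Definition grid (n m : nat) : R := if m is _.+1 then a + m%:R * mesh n else 0.

(** The exponential moment at [g] of a Riemann sum of tents, see [riemann_moment_sum]. *)
Definition riemann_moment (g e : R) (n : nat) : R :=
  \int[P]_w hit_product P X (grid n) (pulse (g * mesh n) e) n w.

Let ba0 : 0 < b - a. Proof. by rewrite subr_gt0. Qed.

Lemma mesh_gt0 n : (0 < n)%N -> 0 < mesh n.
Proof. by move=> n0; rewrite divr_gt0// ltr0n. Qed.

Lemma meshM n : (0 < n)%N -> n%:R * mesh n = b - a.
Proof. by move=> n0; rewrite /mesh mulrC mulfVK// gt_eqF// ltr0n. Qed.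

Lemma grid_nd n i : (0 < n)%N -> grid n i <= grid n i.+1.
Proof.
move=> /mesh_gt0 m0; case: i => [|i]; first by rewrite /grid addr_ge0// mulr_ge0// ltW.
by rewrite /grid lerD2l ler_wpM2r ?(ltW m0)// ler_nat.
Qed.

Lemma gridB n i k : (i <= k)%N -> grid n k.+1 - grid n i.+1 = (k - i)%:R * mesh n.
Proof. by move=> ik; rewrite /grid natrB// -![in LHS]natr1; ring. Qed.

Lemma gamma_scaleE (x : R) : 0 < x -> (x `^ theta^-1) `^ (- theta) = x^-1.
Proof.
by move=> x0; rewrite -powRrM mulrN mulVf ?gt_eqF// powRN powRr1// ltW.
Qed.

Let h (g e : R) n := pulse (g * mesh n) e.

Let hprod (g e : R) n := hit_product P X (grid n) (h g e n).

Lemma hit_weight_first (g e : R) n k : 0 < g -> 0 < e -> (0 < n)%N -> g * mesh n / e <= 2^-1 ->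
  g * mesh n * \int[P]_w tent e (0 + X (grid n k.+1) w) <=
  \int[P]_w h g e n (X (grid n k.+1) w - X (grid n 0%N) w) <=
  g * mesh n * (1 + 2 * (g * mesh n / e)) * \int[P]_w tent e (0 + X (grid n k.+1) w).
Proof.
move=> g0 e0 n0 pe; have m0 := mesh_gt0 n n0.
have p0 : 0 <= g * mesh n by rewrite mulr_ge0// ltW.
have := expectation_pulse_bounds P (g * mesh n) e (X (grid n k.+1)) 0 p0 e0 pe.
have -> : \int[P]_w h g e n (X (grid n k.+1) w - X (grid n 0%N) w) =
  \int[P]_w h g e n (0 + X (grid n k.+1) w).
  under [RHS]eq_Rintegral do rewrite add0r.
  apply: (@Rintegral_same_law _ _ _ P (fun v => X (grid n k.+1) v - X (grid n 0%N) v)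
    (X (grid n k.+1)) (h g e n)).
  - exact: measurable_funB.
  - by [].
  - exact: measurable_pulse.
  - by move=> y; have /andP[] := pulse_bnd (g * mesh n) e y p0 e0 pe.
  - have := levy_stationary_increments X_levy (s := 0) (t := grid n k.+1) (lexx _).
    by rewrite subr0; apply; rewrite /grid addr_ge0// mulr_ge0// ltW.
by apply.
Qed.

Lemma hit_weight_bounds (g e : R) n k (lo hi : nat -> R) : 0 < g -> 0 < e -> (0 < n)%N ->
  g * mesh n / e <= 2^-1 ->
  (forall j x, (0 < j)%N -> `|x| <= e ->
     lo j <= g * mesh n * \int[P]_w tent e (x + X (j%:R * mesh n) w)) ->
  (forall j x, (0 < j)%N -> `|x| <= e ->
     g * mesh n * (1 + 2 * (g * mesh n / e)) * \int[P]_w tent e (x + X (j%:R * mesh n) w) <= hi j) ->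
  \int[P]_w h g e n (X (grid n k.+1) w - X (grid n 0%N) w) +
  \sum_(0 <= i < k) hit_weight P X (grid n) (h g e n) i * lo (k - i)%N <=
  hit_weight P X (grid n) (h g e n) k <=
  \int[P]_w h g e n (X (grid n k.+1) w - X (grid n 0%N) w) +
  \sum_(0 <= i < k) hit_weight P X (grid n) (h g e n) i * hi (k - i)%N.
Proof.
move=> g0 e0 n0 pe hlo hhi; have m0 := mesh_gt0 n n0.
have p0 : 0 <= g * mesh n by rewrite mulr_ge0// ltW.
have hb x : 0 <= h g e n x <= 2 * (g * mesh n / e) by exact: pulse_bnd.
have mh : measurable_fun setT (h g e n) by exact: measurable_pulse.
have hs x : e < `|x| -> h g e n x = 0 by exact: pulse_supp.
have g00 : 0 <= grid n 0 by [].
have gnd i : grid n i <= grid n i.+1 by exact: grid_nd.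
have B i : (i < k)%N -> 
  hit_weight P X (grid n) (h g e n) i * lo (k - i)%N <=
  \int[P]_w (hprod g e n i w * h g e n (X (grid n i.+1) w - X (grid n 0) w) *
    h g e n (X (grid n k.+1) w - X (grid n 0) w)) <=
  hit_weight P X (grid n) (h g e n) i * hi (k - i)%N.
  move=> ik; apply: (hit_weight_markov_bounds P X X_levy (grid n) (h g e n) e _ g00 gnd mh hb hs _ _ _ _ ik).
  move=> x xe; rewrite gridB 1?ltnW//.
  have ki : (0 < k - i)%N by rewrite subn_gt0.
  have mX : measurable_fun setT (X ((k - i)%:R * mesh n)) by [].
  have /andP[l u] := expectation_pulse_bounds P (g * mesh n) e (X ((k - i)%:R * mesh n)) x p0 e0 pe mX.
  by rewrite (le_trans (hlo _ _ ki xe) l) (le_trans u (hhi _ _ ki xe)).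
rewrite (hit_weight_split P X (grid n) (h g e n) _ mh hb) !lerD2l.
rewrite !big_nat; apply/andP; split; apply: ler_sum => i /andP[_ ik]; by have /andP[] := B i ik.
Qed.

Lemma riemann_momentE (g e : R) n : 0 < g -> 0 < e -> (0 < n)%N -> g * mesh n / e <= 2^-1 ->
  riemann_moment g e n = 1 + \sum_(0 <= k < n) hit_weight P X (grid n) (h g e n) k.
Proof.
move=> g0 e0 n0 pe; have m0 := mesh_gt0 n n0.
have p0 : 0 <= g * mesh n by rewrite mulr_ge0// ltW.
rewrite /riemann_moment (expectation_hit_product P X (grid n) (h g e n) (2 * (g * mesh n / e)))//.
- exact: measurable_pulse.
- by move=> x; exact: pulse_bnd.
Qed.

Lemma expR_meshX (la : R) n : (0 < n)%N -> expR (- (la * mesh n)) ^+ n = expR (- (la * (b - a))).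
Proof. by move=> n0; rewrite -expRM_natl mulrN mulrCA meshM. Qed.

Variable A : R.
Hypothesis AE : A = c * Gamma theta.

Let A0 : 0 < A. Proof. by rewrite AE mulr_gt0// Gamma_gt0. Qed.

(** [renewal_upper] at [r = expR (- (la * mesh n))].  The transform of the kernel is
    about [g * A * la `^ (- theta)], which the choice of [la] makes [(1 + eta)^-1]; the
    width of the tent, the short times and the passage from tents to pulses each cost
    a fraction of [eta].  The constant [K] is independent of [g], [e] and [n], hence
    harmless for large [g]. *)
Lemma riemann_moment_upper (eta : R) : 0 < eta -> eta <= 1 -> exists2 K : R, 0 < K &
  forall g, 0 < g -> exists2 e0 : R, 0 < e0 & forall e, 0 < e -> e <= e0 ->
  exists n0 : nat, forall n, (n0 <= n)%N ->
  riemann_moment g e n <= 1 + K * expR (((1 + eta) * g * A) `^ theta^-1 * (b - a)).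
Proof.
move=> eta0 eta1.
(* [(1 + eta / 8) * (1 + eta / 2) <= 1 + 11 / 16 * eta]: pulses cost the first factor,
   short times and the width of the tent the second *)
pose q := (1 + 11 / 16 * eta) / (1 + eta).
have q1 : q < 1 by rewrite /q ltr_pdivrMr; lra.
exists (2 * C / c / (1 - q)); first by rewrite divr_gt0 ?subr_gt0// divr_gt0// mulr_gt0.
move=> g g0.
set la := (_ `^ theta^-1).
have la0 : 0 < la by rewrite powR_gt0// !mulr_gt0//; lra.
have laE : la `^ (- theta) = ((1 + eta) * g * A)^-1.
  by rewrite gamma_scaleE// !mulr_gt0//; lra.
have [u0 u00 cut] := gamma_sum_cut theta theta0 theta1 (A * eta / (4 * C)) ltac:(rewrite divr_gt0// mulr_gt0//; lra).
have [M M0 near] := kernel_near (u0 / la) ltac:(rewrite divr_gt0//).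
pose Q := (1 + eta) * g * A * (M * (b - a)).
have Q0 : 0 <= Q by rewrite /Q !mulr_ge0 ?(ltW A0) ?(ltW g0) ?(ltW ba0)//; lra.
pose e0 := Num.min 1 (A * eta / (4 * (Q + 1))).
exists e0.
  by rewrite /e0 lt_min ltr01/= divr_gt0// ?mulr_gt0//; lra.
move=> e e_gt0; rewrite /e0 le_min => /andP[e1 eQ].
have {}eQ : e * Q <= A * eta / 4.
  apply: (@le_trans _ _ (A * eta / (4 * (Q + 1)) * Q)); first exact: ler_wpM2r.
  have Q1 : 0 < 4 * (Q + 1) by lra.
  rewrite mulrAC ler_pdivrMr// -subr_ge0.
  have -> : A * eta / 4 * (4 * (Q + 1)) - A * eta * Q = A * eta by field.
  by rewrite mulr_ge0// ltW.
have [n0 n0P] := exists_nat_ge (g * (b - a) * 16 / (e * eta)).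
exists n0 => n /n0P[n_gt0 n1].
have m0 := mesh_gt0 n n_gt0.
set p := g * mesh n.
have p0 : 0 < p by rewrite mulr_gt0.
have pe : p / e <= eta / 16.
  rewrite ler_pdivrMr// /p /mesh mulrA ler_pdivrMr ?ltr0n//.
  by move: n1; rewrite ler_pdivrMr ?mulr_gt0//; lra.
have pe2 : p / e <= 2^-1 by apply: (le_trans pe); lra.
have pe0 : 0 <= p / e by rewrite divr_ge0 ?ltW.
rewrite (riemann_momentE g e n g0 e_gt0 n_gt0 pe2) lerD2l.
pose r := expR (- (la * mesh n)).
have r01 : 0 < r <= 1 by rewrite expR_gt0 expR_le1 oppr_le0 mulr_ge0 ?ltW.
rewrite -[la * (b - a)]opprK expRN -(expR_meshX la n n_gt0) -/r ler_pdivlMr; last first.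
  by rewrite exprn_gt0//; case/andP: r01.
(* at times below [u0 / la] only the uniform bound [kernel_le] is available *)
pose hi (j : nat) := p * (1 + 2 * (p / e)) * (c * (j%:R * mesh n) `^ (theta - 1) +
  (if j%:R * mesh n <= u0 / la then C * (j%:R * mesh n) `^ (theta - 1) else 0) + e * M).
have fac0 : 0 <= p * (1 + 2 * (p / e)) by rewrite mulr_ge0 ?(ltW p0)//; lra.
have hi_ok j x : (0 < j)%N -> `|x| <= e ->
    p * (1 + 2 * (p / e)) * \int[P]_w tent e (x + X (j%:R * mesh n) w) <= hi j.
  move=> j0 xe; apply: ler_wpM2l => //.
  have jm0 : 0 < j%:R * mesh n by rewrite mulr_gt0// ltr0n.
  have [small|large] := leP (j%:R * mesh n) (u0 / la).
    apply: (le_trans (kernel_le _ _ _ e_gt0 jm0)).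
    by rewrite [c * _ + _]addrC -addrA lerDl addr_ge0 ?mulr_ge0 ?powR_ge0 ?(ltW c0) ?(ltW e_gt0).
  have := near e _ x e_gt0 e1 xe (ltW large).
  by rewrite addr0 ler_distl => /andP[].
have hw0 k : 0 <= hit_weight P X (grid n) (h g e n) k.
  apply: (hit_weight_ge0 P X (grid n) (h g e n) (2 * (p / e))).
  by move=> x; apply: pulse_bnd => //; exact: ltW.
apply: (renewal_upper _ (fun k => \int[P]_w h g e n (X (grid n k.+1) w - X (grid n 0%N) w)) hi n r q (2 * C / c) r01 hw0).
- by move=> j; rewrite /hi mulr_ge0// !addr_ge0 ?mulr_ge0 ?powR_ge0 ?(ltW c0) ?(ltW e_gt0)//; case: ifP => // _; rewrite mulr_ge0 ?powR_ge0 ?(ltW C0).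
- move=> k kn.
  have lo0 j x : (0 < j)%N -> `|x| <= e -> 0 <= p * \int[P]_w tent e (x + X (j%:R * mesh n) w).
    move=> _ _; rewrite mulr_ge0 ?(ltW p0)//; apply: Rintegral_ge0 => w _; exact: tent_ge0.
  by have /andP[_] := hit_weight_bounds g e n k (fun _ => 0) hi g0 e_gt0 n_gt0 pe2 lo0 hi_ok.
- have bk k : \int[P]_w h g e n (X (grid n k.+1) w - X (grid n 0%N) w) <=
      p * 2 * (C * (k.+1%:R * mesh n) `^ (theta - 1)).
    have /andP[_] := hit_weight_first g e n k g0 e_gt0 n_gt0 pe2; rewrite -/p => /le_trans; apply.
    have km : 0 < k.+1%:R * mesh n by rewrite mulr_gt0// ltr0n.
    have gk : k.+1%:R * mesh n <= grid n k.+1 by rewrite /grid lerDr.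
    apply: ler_pM => //.
    - by apply: Rintegral_ge0 => w _; exact: tent_ge0.
    - by rewrite ler_wpM2l ?(ltW p0)//; lra.
    - apply: (le_trans (kernel_le _ _ _ e_gt0 (lt_le_trans km gk))); rewrite ler_wpM2l ?(ltW C0)//.
      exact: (powR_theta_le theta theta1).
  apply: (@le_trans _ _ (\sum_(0 <= k < n) (2 * g * C * la `^ (- theta)) *
      (la * mesh n * gamma_density theta (k.+1%:R * (la * mesh n))))).
    rewrite big_nat [leRHS]big_nat; apply: ler_sum => k _.
    rewrite -mulrA -(gamma_density_scale theta la (mesh n) k.+1 la0 m0) -/r.
    apply: (le_trans (ler_wpM2r _ (bk k))); first by rewrite exprn_ge0// expR_ge0.
    by rewrite le_eqVlt /p; apply/orP; left; apply/eqP; ring.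
  rewrite -mulr_sumr laE.
  have le0 : 0 < la * mesh n by rewrite mulr_gt0.
  apply: (le_trans (ler_wpM2l _ (gamma_sum_upper theta theta0 theta1 _ n le0))).
    by rewrite !mulr_ge0 ?invr_ge0 ?mulr_ge0 ?(ltW g0) ?(ltW C0) ?(ltW A0)//; lra.
  have G0 := Gamma_gt0 theta theta0 theta1.
  have -> : 2 * g * C * ((1 + eta) * g * A)^-1 * Gamma theta = 2 * C / c / (1 + eta).
    rewrite AE; field; rewrite !gt_eqF//; lra.
  rewrite ler_pdivrMr ?ler_peMr//; [|lra|lra].
  by rewrite divr_ge0 ?mulr_ge0 ?ltW.
- pose S1 := \sum_(0 <= j < n) (la * mesh n * gamma_density theta (j.+1%:R * (la * mesh n))).
  pose S2 := \sum_(0 <= j < n) (if j.+1%:R * (la * mesh n) <= u0 then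
    la * mesh n * gamma_density theta (j.+1%:R * (la * mesh n)) else 0).
  have le0 : 0 < la * mesh n by rewrite mulr_gt0.
  have S1G : S1 <= Gamma theta by exact: gamma_sum_upper.
  have S2G : S2 <= A * eta / (4 * C) by exact: cut.
  apply: (@le_trans _ _ ((1 + 2 * (p / e)) * g * (c * la `^ (- theta) * S1 + C * la `^ (- theta) * S2
      + \sum_(0 <= j < n) e * M * mesh n))).
    rewrite /S1 /S2 !mulr_sumr -!big_split/= mulr_sumr big_nat [leRHS]big_nat.
    apply: ler_sum => j _; rewrite /hi /p.
    have -> : (j.+1%:R * (la * mesh n) <= u0) = (j.+1%:R * mesh n <= u0 / la).
      by rewrite ler_pdivlMr// mulrCA mulrC.
    have := gamma_density_scale theta la (mesh n) j.+1 la0 m0; rewrite -/r => gs.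
    have r1 : r ^+ j.+1 <= 1 by case/andP: r01 => r0 r1; rewrite exprn_ile1// ltW.
    set L1 := (X in X <= _); set L2 := (X in _ <= X).
    pose ps := (j.+1%:R * mesh n) `^ (theta - 1).
    pose tst := if j.+1%:R * mesh n <= u0 / la then C * ps else 0.
    have -> : L1 = (1 + 2 * (g * mesh n / e)) * g * (c * (mesh n * ps * r ^+ j.+1) +
       mesh n * tst * r ^+ j.+1 + e * M * mesh n * r ^+ j.+1) by rewrite /L1 /tst /ps; ring.
    have -> : L2 = (1 + 2 * (g * mesh n / e)) * g * (c * (mesh n * ps * r ^+ j.+1) +
       mesh n * tst * r ^+ j.+1 + e * M * mesh n).
      rewrite /L2 /tst gs; case: ifP => _; last by ring.
      have -> : mesh n * (C * ps) * r ^+ j.+1 = C * (mesh n * ps * r ^+ j.+1) by ring.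
      by rewrite gs; ring.
    apply: ler_wpM2l; first by rewrite mulr_ge0 ?(ltW g0)// -/p; lra.
    by rewrite lerD2l ler_piMr// !mulr_ge0// ltW.
  have -> : \sum_(0 <= j < n) e * M * mesh n = e * M * (b - a).
    by rewrite sumr_const_nat subn0 -mulr_natl mulrCA meshM.
  have -> : (1 + 2 * (p / e)) * g * (c * la `^ (- theta) * S1 + C * la `^ (- theta) * S2 +
      e * M * (b - a)) = (1 + 2 * (p / e)) * (c * S1 + C * S2 + e * Q) / ((1 + eta) * A).
    rewrite laE /Q; field; rewrite !gt_eqF//; lra.
  rewrite ler_pdivrMr ?mulr_gt0//; last by lra.
  have -> : q * ((1 + eta) * A) = (1 + 11 / 16 * eta) * A.
    rewrite /q; field; rewrite gt_eqF//; lra.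
  have cS1 : c * S1 <= A by rewrite AE ler_wpM2l// ltW.
  have CS2 : C * S2 <= A * eta / 4.
    have -> : A * eta / 4 = C * (A * eta / (4 * C)) by field; rewrite gt_eqF.
    by rewrite ler_wpM2l// ltW.
  have S10 : 0 <= S1.
    apply: sumr_ge0 => j _; rewrite mulr_ge0 ?(ltW le0)//.
    by rewrite mulr_ge0 ?powR_ge0 ?expR_ge0.
  have S20 : 0 <= S2.
    apply: sumr_ge0 => j _; case: ifP => // _; rewrite mulr_ge0 ?(ltW le0)//.
    by rewrite mulr_ge0 ?powR_ge0 ?expR_ge0.
  apply: (@le_trans _ _ ((1 + eta / 8) * (A * (1 + eta / 2)))).
    apply: ler_pM; [lra| |lra|lra].
    by apply: addr_ge0; [apply: addr_ge0|]; apply: mulr_ge0 => //; exact: ltW.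
  rewrite mulrCA mulrC ler_wpM2r ?(ltW A0)//; nra.
- exact: q1.
Qed.

(** [renewal_lower], with the kernel cut down to the window of [gamma_sum_lower], where
    its asymptotics are uniform.  The discarded terms are a fraction [eta] of all, which
    costs [1 - 4 * eta] in the exponent; the factor [g] comes from summing [K] weights
    of size [g * mesh n]. *)
Lemma riemann_moment_lower (eta : R) : 0 < eta -> eta <= 4^-1 -> exists2 K : R, 0 < K &
  forall g, 0 < g -> exists2 e0 : R, 0 < e0 & forall e, 0 < e -> e <= e0 ->
  exists n0 : nat, forall n, (n0 <= n)%N ->
  K * g * expR (((1 - eta) * g * A) `^ theta^-1 * (b - a) * (1 - 4 * eta)) <= riemann_moment g e n.
Proof.
move=> eta0 eta1.
have G0 := Gamma_gt0 theta theta0 theta1.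
have MG : Gamma theta * (1 - eta / 2) < Gamma theta by rewrite gtr_pMr//; lra.
have [u1 [u2 [u10 u12 low]]] := gamma_sum_lower theta theta0 theta1 _ MG.
have u20 : 0 < u2 by exact: lt_trans u12.
have b0 : 0 < b by exact: le_lt_trans ab.
have cb0 : 0 < c * b `^ (theta - 1) / 2 by rewrite divr_gt0// mulr_gt0// powR_gt0.
exists (eta * (b - a) * (c * b `^ (theta - 1) / 2) * expR (- u2)).
  by rewrite mulr_gt0 ?expR_gt0// mulr_gt0// mulr_gt0.
move=> g g0.
set la := (_ `^ theta^-1).
have la0 : 0 < la by rewrite powR_gt0// !mulr_gt0//; lra.
have laE : la `^ (- theta) = ((1 - eta) * g * A)^-1.
  by rewrite gamma_scaleE// !mulr_gt0//; lra.
have [M1 M10 near1] := kernel_near (u1 / la) ltac:(rewrite divr_gt0//).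
have [M2 M20 near2] := kernel_near (eta * (b - a)) ltac:(rewrite mulr_gt0//).
pose Q := (1 - eta) * g * A * (M1 * (u2 / la)).
have Q0 : 0 <= Q.
  rewrite /Q mulr_ge0//; last by rewrite mulr_ge0// divr_ge0 ?ltW.
  by rewrite !mulr_ge0 ?(ltW A0) ?(ltW g0)//; lra.
pose e0 := Num.min 1 (Num.min (A * eta / 2 / (Q + 1)) (c * b `^ (theta - 1) / 2 / (M2 + 1))).
have Ae0 : 0 < A * eta / 2 by rewrite divr_gt0// mulr_gt0.
exists e0.
  by rewrite /e0 !lt_min ltr01/=; apply/andP; split; rewrite divr_gt0//; lra.
move=> e e_gt0; rewrite /e0 !le_min => /and3P[e1 eQ eM2].
have {}eQ := le_divD1M _ _ _ Ae0 Q0 eQ.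
have {}eM2 := le_divD1M _ _ _ cb0 M20 eM2.
have [n0 n0P] := exists_nat_ge (4 + eta^-1 + 2 * g * (b - a) / e + la * (b - a) / u1).
exists n0 => n /n0P[n_gt0 nbig].
have eta_inv : 0 < eta^-1 by rewrite invr_gt0.
have t1 : 0 < 2 * g * (b - a) / e by rewrite divr_gt0 ?mulr_gt0.
have t2 : 0 < la * (b - a) / u1 by rewrite divr_gt0 ?mulr_gt0.
have n4 : 4 <= n%:R :> R by lra.
have neta : 1 <= eta * n%:R.
  have : eta^-1 <= n%:R by lra.
  by rewrite -[eta^-1]mul1r ler_pdivrMr// mulrC.
have ng : 2 * g * (b - a) <= e * n%:R.
  have : 2 * g * (b - a) / e <= n%:R by lra.
  by rewrite ler_pdivrMr// [n%:R * _]mulrC.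
have nla : la * (b - a) <= u1 * n%:R.
  have : la * (b - a) / u1 <= n%:R by lra.
  by rewrite ler_pdivrMr// [n%:R * _]mulrC.
have m0 := mesh_gt0 n n_gt0.
set p := g * mesh n.
have p0 : 0 < p by rewrite mulr_gt0.
have pe2 : p / e <= 2^-1.
  rewrite ler_pdivrMr// /p /mesh mulrA ler_pdivrMr ?ltr0n//; lra.
have pe0 : 0 <= p / e by rewrite divr_ge0 ?ltW.
have le0 : 0 < la * mesh n by rewrite mulr_gt0.
have leu1 : la * mesh n <= u1 by rewrite /mesh mulrA ler_pdivrMr ?ltr0n.
have [j1 [j2 [j12 u1j j2u sumM]]] := low _ le0 leu1.
rewrite (riemann_momentE g e n g0 e_gt0 n_gt0 pe2).
pose r := expR (- (la * mesh n)).
have r01 : 0 < r <= 1 by rewrite expR_gt0 expR_le1 oppr_le0 mulr_ge0 ?ltW.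
pose lo (j : nat) := if (j1 <= j < j2)%N then
  p * Num.max 0 (c * (j%:R * mesh n) `^ (theta - 1) - e * M1) else 0.
have lo0 j : 0 <= lo j.
  by rewrite /lo; case: ifP => // _; rewrite mulr_ge0 ?(ltW p0)// le_max lexx.
have tent_E0 x s : 0 <= \int[P]_w tent e (x + X s w).
  by apply: Rintegral_ge0 => w _; exact: tent_ge0.
have lo_ok j x : (0 < j)%N -> `|x| <= e -> lo j <= p * \int[P]_w tent e (x + X (j%:R * mesh n) w).
  move=> j0 xe; rewrite /lo; case: ifP => [/andP[jj _]|_]; last by rewrite mulr_ge0 ?(ltW p0).
  apply: ler_wpM2l; first exact: ltW.
  rewrite ge_max tent_E0/=.
  have := near1 e (j%:R * mesh n) x e_gt0 e1 xe; rewrite ler_distl.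
  suff sj : u1 / la <= j%:R * mesh n by move=> /(_ sj)/andP[].
  rewrite ler_pdivrMr// mulrC mulrCA; apply: (le_trans u1j).
  by rewrite ler_wpM2r ?(ltW le0)// ler_nat.
pose hi (j : nat) := p * (1 + 2 * (p / e)) * (C * (j%:R * mesh n) `^ (theta - 1)).
have hi_ok j x : (0 < j)%N -> `|x| <= e ->
    p * (1 + 2 * (p / e)) * \int[P]_w tent e (x + X (j%:R * mesh n) w) <= hi j.
  move=> j0 xe; apply: ler_wpM2l; first by rewrite mulr_ge0 ?(ltW p0)//; lra.
  by apply: kernel_le => //; rewrite mulr_gt0// ltr0n.
have hw0 k : 0 <= hit_weight P X (grid n) (h g e n) k.
  apply: (hit_weight_ge0 P X (grid n) (h g e n) (2 * (p / e))).
  by move=> x; apply: pulse_bnd => //; exact: ltW.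
pose K := (Num.truncn (eta * n%:R)).+1.
have [K1 K2] : eta * n%:R <= K%:R /\ K%:R <= eta * n%:R + 1.
  have en0 : 0 <= eta * n%:R by lra.
  have /andP[k1 k2] := truncn_itv en0; rewrite /K; split; first exact: ltW.
  by rewrite -natr1 lerD2r.
have KN : (2 * K <= n)%N.
  rewrite -(ler_nat R) natrM; apply: (le_trans (ler_wpM2l _ K2)) => //.
  have : eta * n%:R <= 4^-1 * n%:R by apply: ler_wpM2r.
  lra.
have first k := hit_weight_first g e n k g0 e_gt0 n_gt0 pe2.
have both k := hit_weight_bounds g e n k lo hi g0 e_gt0 n_gt0 pe2 lo_ok hi_ok.
have hitb k : (K <= k < n)%N -> p * (c * b `^ (theta - 1) / 2) <= hit_weight P X (grid n) (h g e n) k.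
  move=> /andP[Kk kn]; have /andP[l _] := both k; apply: le_trans l.
  have /andP[f _] := first k.
  rewrite -[leLHS]addr0; apply: lerD; last by apply: sumr_ge0 => i _; rewrite mulr_ge0.
  apply: le_trans f; rewrite -/p; apply: ler_wpM2l; first exact: ltW.
  have s1 : eta * (b - a) <= grid n k.+1.
    rewrite -(meshM n n_gt0) mulrA /grid -[leLHS]add0r; apply: lerD => //.
    apply: ler_wpM2r; first exact: ltW.
    by apply: (le_trans K1); rewrite ler_nat ltnW// ltnS.
  have s2 : grid n k.+1 <= b.
    rewrite /grid -lerBrDl -(meshM n n_gt0); apply: ler_wpM2r; first exact: ltW.
    by rewrite ler_nat.
  have s0 : 0 < grid n k.+1 by apply: lt_le_trans s1; rewrite mulr_gt0.
  have e00 : `|0 : R| <= e by rewrite normr0 ltW.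
  have := near2 e _ 0 e_gt0 e1 e00 s1; rewrite ler_distl => /andP[+ _].
  apply: le_trans; have := ler_wpM2l (ltW c0) (powR_theta_le theta theta1 _ _ s0 s2).
  by move: eM2; lra.
have rec k : (k < n)%N -> \sum_(0 <= i < k) hit_weight P X (grid n) (h g e n) i * lo (k - i)%N <=
    hit_weight P X (grid n) (h g e n) k.
  move=> kn; have /andP[l _] := both k; apply: le_trans l; rewrite lerDr.
  have /andP[f _] := first k; apply: le_trans f; exact: mulr_ge0 (ltW p0) (tent_E0 _ _).
have sum1 : 1 <= \sum_(0 <= j < j2) lo j.+1 * r ^+ j.+1.
  have j11 : (0 < j1)%N.
    by rewrite lt0n; apply/eqP => j10; move: u1j; rewrite j10 mul0r leNgt u10.
  have -> : \sum_(0 <= j < j2) lo j.+1 * r ^+ j.+1 = \sum_(1 <= j < j2.+1) lo j * r ^+ j.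
    by rewrite big_add1.
  have lor j : 0 <= lo j * r ^+ j by rewrite mulr_ge0// exprn_ge0// expR_ge0.
  apply: (@le_trans _ _ (\sum_(j1 <= j < j2) lo j * r ^+ j)); last first.
    have j12S : (j1 <= j2.+1)%N by exact: leqW.
    rewrite [leRHS](big_cat_nat j11 j12S)//= big_nat_recr//= addrCA lerDl.
    by rewrite addr_ge0// sumr_ge0.
  apply: (@le_trans _ _ (\sum_(j1 <= j < j2) (g * c * la `^ (- theta) *
      (la * mesh n * gamma_density theta (j%:R * (la * mesh n))) - g * e * M1 * mesh n))); last first.
    rewrite big_nat [leRHS]big_nat; apply: ler_sum => j jj.
    rewrite /lo jj -mulrA -(gamma_density_scale theta la (mesh n) j la0 m0) -/r /p.
    have r0 : 0 <= r ^+ j by rewrite exprn_ge0// expR_ge0.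
    have r1 : r ^+ j <= 1 by case/andP: r01 => r0' r1; rewrite exprn_ile1// ltW.
    set y := _ `^ (theta - 1).
    apply: (@le_trans _ _ (g * mesh n * (c * y - e * M1) * r ^+ j)); last first.
      apply: ler_wpM2r => //; apply: ler_wpM2l; first exact: ltW.
      by rewrite le_max lexx orbT.
    rewrite -subr_ge0.
    have -> : g * mesh n * (c * y - e * M1) * r ^+ j - (g * c * (mesh n * y * r ^+ j) - g * e * M1 * mesh n)
      = g * e * M1 * mesh n * (1 - r ^+ j) by ring.
    by rewrite mulr_ge0 ?subr_ge0// !mulr_ge0// ltW.
  rewrite sumrB -mulr_sumr sumr_const_nat -mulr_natl.
  have e_le : (j2 - j1)%:R * (g * e * M1 * mesh n) <= g * e * M1 * (u2 / la).
    rewrite mulrCA; apply: ler_wpM2l; first by rewrite !mulr_ge0// ltW.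
    rewrite ler_pdivlMr//; apply: le_trans j2u; rewrite -mulrA [mesh n * _]mulrC.
    by apply: ler_wpM2r; rewrite ?(ltW le0)// ler_nat leq_subr.
  have gl0 : 0 <= g * c * la `^ (- theta) by rewrite !mulr_ge0 ?powR_ge0 ?(ltW g0) ?(ltW c0).
  have s_le := ler_wpM2l gl0 sumM.
  apply: (@le_trans _ _ (g * c * la `^ (- theta) * (Gamma theta * (1 - eta / 2)) - g * e * M1 * (u2 / la)));
    last by apply: lerB.
  have -> : g * c * la `^ (- theta) * (Gamma theta * (1 - eta / 2)) - g * e * M1 * (u2 / la) =
    (A * (1 - eta / 2) - e * Q) / ((1 - eta) * A).
    rewrite laE /Q AE; field; rewrite !gt_eqF ?mulr_gt0//; lra.
  rewrite ler_pdivlMr ?mulr_gt0//; last by lra.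
  by move: eQ; lra.
have beta0 : 0 <= p * (c * b `^ (theta - 1) / 2) by rewrite mulr_ge0 ?ltW.
have := renewal_lower _ lo n j2 K r _ r01 beta0 lo0 rec hitb hw0 sum1 KN.
move=> sumA.
set z := la * (b - a).
have z0 : 0 <= z by rewrite mulr_ge0 ?ltW.
rewrite expR_meshX// -/z in sumA.
have KE : eta * (b - a) * g <= K%:R * p.
  have -> : eta * (b - a) * g = eta * n%:R * p by rewrite /p -(meshM n n_gt0); ring.
  by apply: ler_wpM2r => //; exact: ltW.
have rE : expR (- (4 * eta * z) - u2) <= r ^+ (2 * K + j2).
  rewrite /r -expRM_natl ler_expR mulrN -opprD lerN2 natrD mulrDl; apply: lerD => //.
  have -> : 4 * eta * z = (4 * eta * n%:R) * (la * mesh n).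
    by rewrite /z -(meshM n n_gt0); ring.
  by apply: ler_wpM2r; rewrite ?(ltW le0)// natrM; lra.
have ez := expR_gt0 z.
apply: (@le_trans _ _ (\sum_(0 <= k < n) hit_weight P X (grid n) (h g e n) k)); last by rewrite lerDr.
have -> : \sum_(0 <= k < n) hit_weight P X (grid n) (h g e n) k =
  \sum_(0 <= k < n) hit_weight P X (grid n) (h g e n) k * expR (- z) * expR z.
  by rewrite -!mulr_suml -mulrA -expRD addNr expR0 mulr1.
rewrite -mulr_suml -mulr_suml.
apply: le_trans (ler_wpM2r (ltW ez) sumA).
have -> : eta * (b - a) * (c * b `^ (theta - 1) / 2) * expR (- u2) * g * expR (z * (1 - 4 * eta)) =
  (eta * (b - a) * g) * (c * b `^ (theta - 1) / 2) * (expR (- (4 * eta * z) - u2) * expR z).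
  have -> : expR (z * (1 - 4 * eta)) = expR (- (4 * eta * z)) * expR z.
    by rewrite -expRD; congr expR; ring.
  by rewrite expRD; ring.
rewrite -[leRHS]mulrA; apply: ler_pM.
- by apply: mulr_ge0; [apply: ltW; rewrite !mulr_gt0|exact: ltW].
- by rewrite mulr_ge0 ?expR_ge0.
- by rewrite [leRHS]mulrA; apply: ler_wpM2r => //; exact: ltW.
- by rewrite ler_wpM2r ?expR_ge0.
Qed.

End occupation_moments.

(** * Riemann sums along right-continuous paths *)

Section right_continuous_paths.
Context {R : realType}.
Notation mu := (@lebesgue_measure R).
Variables (a b : R).
Hypothesis ab : a < b.

Let de (n : nat) : R := (b - a) / n%:R.

Let cell (n i : nat) : set (measurableTypeR R) := `]a + i%:R * de n, a + i.+1%:R * de n]%classic.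

Let dom : set (measurableTypeR R) := `]a, b]%classic.

(** Each cell carries the value at its right end, so that right continuity is enough
    for pointwise convergence. *)
Definition step_path (g : R -> R) (n : nat) (s : R) : R :=
  \sum_(0 <= i < n) g (a + i.+1%:R * de n) * \1_(cell n i) s.

Let de0 n : (0 < n)%N -> 0 < de n.
Proof. by move=> n0; rewrite divr_gt0 ?subr_gt0// ltr0n. Qed.

Let dom_cell n i : (i < n)%N -> cell n i `<=` dom.
Proof.
move=> ni x; rewrite /cell /dom /= !in_itv/= => /andP[xl xu].
have n0 : (0 < n)%N by exact: leq_ltn_trans ni.
have d0 := de0 n n0.
have E : n%:R * de n = b - a by rewrite /de mulrC mulfVK// gt_eqF// ltr0n.
apply/andP; split.
  by apply: le_lt_trans xl; rewrite lerDl mulr_ge0// ltW.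
apply: (le_trans xu); rewrite -lerBrDl -E; apply: ler_wpM2r; first exact: ltW.
by rewrite ler_nat.
Qed.

Lemma step_pathE g n s : (0 < n)%N -> a < s <= b ->
  exists t, [/\ s <= t <= b, t - s < de n & step_path g n s = g t].
Proof.
move=> n0 /andP[as_ sb]; have d0 := de0 n n0.
have nE : n%:R * de n = b - a by rewrite /de mulrC mulfVK// gt_eqF// ltr0n.
have ex : exists m, s - a <= m%:R * de n by exists n; rewrite nE lerD2r.
have := ex_minnP ex; case: ex_minnP => -[|m] hm hmin _.
  by move: hm; rewrite mul0r subr_le0 leNgt as_.
have mn : (m < n)%N by apply: hmin; rewrite nE lerD2r.
have hm' : m%:R * de n < s - a.
  by rewrite ltNge; apply/negP => /hmin; rewrite ltnn.
have mS : m.+1%:R * de n = m%:R * de n + de n by rewrite -natr1 mulrDl mul1r.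
exists (a + m.+1%:R * de n); split.
- apply/andP; split; first by rewrite -lerBlDl.
  by rewrite -lerBrDl -nE; apply: ler_wpM2r; [exact: ltW|rewrite ler_nat].
- by lra.
rewrite /step_path (bigD1_seq m) ?mem_index_iota ?iota_uniq//=.
rewrite indicE mem_set/= ?mulr1; last first.
  by rewrite /cell/= in_itv/= -ltrBrDl hm' -lerBlDl.
rewrite big1_seq ?addr0// => i /andP[im _].
rewrite indicE memNset ?mulr0// /cell /= in_itv/= -ltrBrDl -lerBlDl => /andP[i1 i2].
have im1 : (i <= m)%N.
  rewrite leqNgt; apply/negP => mi; move: i1; rewrite ltNge => /negP; apply.
  apply: (le_trans hm); apply: ler_wpM2r; [exact: ltW|by rewrite ler_nat].
by have := hmin _ i2; rewrite ltnS => mi; move: im; rewrite eqn_leq im1 mi.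
Qed.

Lemma measurable_step_path g n : measurable_fun dom (step_path g n).
Proof.
apply: measurable_funTS; apply: measurable_sum => i.
apply: measurable_funM => //; apply: measurable_indic; exact: measurable_itv.
Qed.

Lemma cvg_step_path (g : R -> R) (s : R) : (forall t, a <= t -> g u @[u --> t^'+] --> g t) ->
  a < s <= b -> step_path g n s @[n --> \oo] --> g s.
Proof.
move=> rc sab; have /andP[as_ sb] := sab.
apply/cvgrPdist_lt => e e0.
have /cvgrPdist_lt/(_ e e0) := rc s (ltW as_).
rewrite near_withinE => -[r /= r0 hr].
have [n0 n0P] := exists_nat_ge ((b - a) / r + 1).
exists n0 => // n /= /n0P[n_gt0 nn].
have [t [/andP[st tb] ts ->]] := step_pathE g n s n_gt0 sab.
have [->|ts0] := eqVneq t s; first by rewrite subrr normr0.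
apply: hr; last by rewrite lt_neqAle eq_sym ts0.
rewrite /ball_/= distrC ger0_norm ?subr_ge0//; apply: (lt_le_trans ts).
rewrite /de ler_pdivrMr ?ltr0n// mulrC -ler_pdivrMr//; lra.
Qed.

Lemma measurable_right_continuous (g : R -> R) : (forall t, a <= t -> g u @[u --> t^'+] --> g t) ->
  measurable_fun dom g.
Proof.
move=> rc; apply: (measurable_fun_cvg (measurable_step_path g)) => x.
by rewrite /dom /= in_itv/= => xab; exact: cvg_step_path.
Qed.

Let fdom : (mu dom < +oo)%E.
Proof. by rewrite /dom lebesgue_measure_itv/= lte_fin ab -EFinB ltry. Qed.

Let step_path_integral (g : R -> R) (n k : nat) : (k <= n)%N ->
  let f := fun s : measurableTypeR R => \sum_(0 <= i < k) g (a + i.+1%:R * de n) * \1_(cell n i) s in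
  mu.-integrable dom (EFin \o f) /\
  \int[mu]_(s in dom) f s = de n * \sum_(0 <= i < k) g (a + i.+1%:R * de n).
Proof.
have mdom : measurable dom by exact: measurable_itv.
elim: k => [_|k IH kn] /=.
  split.
    rewrite (_ : EFin \o _ = cst 0%E) ?integrable0//.
    by apply/funext => s; rewrite /= big_nil.
  rewrite big_nil mulr0 /Rintegral; under eq_integral do rewrite big_nil.
  by rewrite integral0.
have [ik Ek] := IH (ltnW kn).
have mcell : measurable (cell n k) by exact: measurable_itv.
have ic : mu.-integrable dom (EFin \o (\1_(cell n k) : measurableTypeR R -> R)).
  apply: measurable_bounded_integrable => //.
  exists 1; split; [by rewrite num_real|move=> x x1 y _; rewrite /= (le_trans _ (ltW x1))//].
  by rewrite indicE; case: (_ \in _); rewrite ?normr1 ?normr0.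
have icg := integrableZl mdom (g (a + k.+1%:R * de n)) ic.
split.
  rewrite (_ : EFin \o _ = (EFin \o (fun s : measurableTypeR R => \sum_(0 <= i < k) g (a + i.+1%:R * de n) * \1_(cell n i) s)) \+
    (fun s => ((g (a + k.+1%:R * de n))%:E * (EFin \o \1_(cell n k)) s)%E)).
    exact: integrableD.
  by apply/funext => s; rewrite /= big_nat_recr.
under eq_Rintegral do rewrite big_nat_recr//=.
rewrite RintegralD// Ek big_nat_recr//= mulrDr; congr (_ + _).
rewrite RintegralZl// mulrC; congr (_ * _).
have d0 : 0 < de n by apply: de0; exact: leq_ltn_trans kn.
have muE : mu (cell n k) = (de n)%:E.
  rewrite /cell lebesgue_measure_itv/= lte_fin ltrD2l ltr_pM2r// ltr_nat ltnSn -EFinB.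
  by congr EFin; rewrite -natr1; ring.
rewrite -[RHS]/(fine (de n)%:E) -muE /Rintegral integral_indic//.
by rewrite (setIidl (dom_cell _ _ kn)).
Qed.

Lemma riemann_right_continuous (g : R -> R) (M : R) :
  (forall t, a <= t -> g u @[u --> t^'+] --> g t) -> (forall t, `|g t| <= M) ->
  de n * (\sum_(0 <= i < n) g (a + i.+1%:R * de n)) @[n --> \oo] --> \int[mu]_(s in dom) g s.
Proof.
move=> rc gM.
have mdom : measurable dom by exact: measurable_itv.
have mg := measurable_right_continuous g rc.
have M0 : 0 <= M by apply: le_trans (gM 0).
have iM : mu.-integrable dom (EFin \o cst M).
  apply: measurable_bounded_integrable => //.
  by exists `|M|; split; [rewrite num_real|move=> x Mx y _; rewrite /= ltW].
have stepM n s : dom s -> `|step_path g n s| <= M.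
  rewrite /dom /= in_itv/= => sab; case: n => [|n]; first by rewrite /step_path big_nil normr0.
  by have [t [_ _ ->]] := step_pathE g n.+1 s isT sab.
have := @dominated_convergence _ _ _ mu dom mdom (fun n s => (step_path g n s)%:E) (EFin \o g) (EFin \o cst M).
move=> []//.
- by move=> n; apply/measurable_EFinP; exact: measurable_step_path.
- exact/measurable_EFinP.
- apply: aeW => s; rewrite /dom /= in_itv/= => sab.
  apply: cvg_EFin; first exact: nearW.
  exact: cvg_step_path.
- by apply: aeW => s n ds; rewrite /= lee_fin; exact: stepM.
move=> ig _ cv.
have e : (\int[mu]_(s in dom) (EFin \o g) s)%E = (\int[mu]_(s in dom) g s)%:E.
  by rewrite /Rintegral fineK//; exact: integrable_fin_num.
rewrite e in cv; apply: cvg_trans (fine_cvg cv); apply: near_eq_cvg.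
exists 1%N => // n /= n0; rewrite -/(Rintegral mu dom (step_path g n)).
by have [_ ->] := step_path_integral g n n (leqnn _).
Qed.

End right_continuous_paths.

(** * Occupation integrals and densities *)

Section tent_mass.
Context {R : realType}.
Notation mu := (@lebesgue_measure R).

Lemma integral_affine (p q x y : R) : x < y ->
  (\int[mu]_(z in `[x, y]) (p + q * z)%:E = (p * (y - x) + q * (y ^+ 2 - x ^+ 2) / 2)%:E)%E.
Proof.
move=> xy; pose F (z : R) := p * z + q / 2 * z ^+ 2.
have dF (z : R) : is_derive z 1 F (p + q * z).
  have -> : F = p *: (@id R) + (q / 2) *: (@id R) ^+ 2 by apply/funext.
  have i1 : is_derive z 1 (@id R) 1 by exact: is_derive_id.
  have i2 : is_derive z 1 ((@id R) ^+ 2) (2%:R * z ^+ 1 *: 1) by exact: is_deriveX.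
  have i3 : is_derive z 1 (p *: @id R) (p *: 1) by exact: is_deriveZ.
  have i4 : is_derive z 1 ((q / 2) *: @id R ^+ 2) ((q / 2) *: (2%:R * z ^+ 1 *: 1)) by exact: is_deriveZ.
  apply: (is_derive1_cast _ _ _ _ (is_deriveD i3 i4)).
  by rewrite /GRing.scale/= expr1 !mulr1; congr (_ + _); field.
have cF : continuous F by move=> z; apply/differentiable_continuous/derivable1_diffP; case: (dF z).
rewrite (continuous_FTC2 xy _ _ _ (F := F)).
- by rewrite -EFinB /F; congr EFin; field.
- apply: continuous_subspaceT => z.
  by apply: cvgD; [exact: cvg_cst|apply: cvgM; [exact: cvg_cst|exact: cvg_id]].
- split; [by move=> z _; case: (dF z)|exact: cvg_at_right_filter (cF x)|exact: cvg_at_left_filter (cF y)].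
- by move=> z _; rewrite derive1E; exact: derive_val.
Qed.

Lemma integral_tent (e : R) : 0 < e -> (\int[mu]_(z in `[(- e)%R, e]) (tent e z)%:E = 1%:E)%E.
Proof.
move=> e0.
have mtent (D : set (measurableTypeR R)) : measurable_fun D (EFin \o tent e).
  by apply/measurable_EFinP; apply: measurable_funTS; exact: measurable_tent.
have -> : `[- e, e]%classic = `[- e, 0]%classic `|` `]0, e]%classic :> set R.
  rewrite -itv_bndbnd_setU// bnd_simp ?oppr_le0; exact: ltW.
rewrite ge0_integral_setU//=; last 2 first.
- by move=> x _; rewrite lee_fin tent_ge0.
- rewrite disj_set2E; apply/eqP/seteqP; split => // x [] /=.
  by rewrite !in_itv/= => /andP[_ x0] /andP[x0' _]; move: x0'; rewrite ltNge x0.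
have tentE z : z \in `[- e, e] -> tent e z = (e - `|z|) / e ^+ 2.
  by rewrite in_itv/= => ze; rewrite /tent (max_idPr _)// subr_ge0 ler_norml.
have -> : (\int[mu]_(z in `[(- e)%R, 0%R]) (tent e z)%:E = (2^-1)%:E)%E.
  transitivity (\int[mu]_(z in `[(- e)%R, 0%R]) (e^-1 + e ^- 2 * z)%:E)%E.
    apply: eq_integral => z /set_mem/=; rewrite in_itv/= => /andP[z1 z2].
    rewrite tentE ?in_itv/= ?z1 ?(le_trans z2 (ltW e0))// ler0_norm//.
    by congr EFin; field; rewrite gt_eqF.
  rewrite integral_affine ?oppr_lt0//; congr EFin; field; rewrite gt_eqF//.
have -> : (\int[mu]_(z in `]0%R, e]) (tent e z)%:E = (2^-1)%:E)%E.
  rewrite integral_itv_obnd_cbnd; last exact: mtent.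
  transitivity (\int[mu]_(z in `[0%R, e]) (e^-1 + - e ^- 2 * z)%:E)%E.
    apply: eq_integral => z /set_mem/=; rewrite in_itv/= => /andP[z1 z2].
    rewrite tentE ?in_itv/= ?z2 ?andbT ?(le_trans _ z1) ?oppr_le0 ?(ltW e0)// ger0_norm//.
    by congr EFin; field; rewrite gt_eqF.
  rewrite integral_affine//; congr EFin; field; rewrite gt_eqF//.
by rewrite -EFinD; congr EFin; field.
Qed.

End tent_mass.

Section measure_comparison.
Import HBNNSimple.
Local Open Scope ereal_scope.
Context {d : measure_display} {T : measurableType d} {R : realType}.

(** The measures are compared on [D] only: a simple function below the restriction of
    [f] to [D] has its nonzero levels inside [D]. *)
Lemma le_measure_integral_on (m1 m2 : {measure set T -> \bar R}) (D : set T) (f : T -> \bar R) :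
  measurable D -> (forall A, measurable A -> A `<=` D -> m1 A <= m2 A) ->
  (forall x, D x -> 0 <= f x) -> \int[m1]_(x in D) f x <= \int[m2]_(x in D) f x.
Proof.
move=> mD m12 f0; rewrite !ge0_integralE//; apply: ge_ereal_sup => _ [h hf <-].
suff m12h : sintegral m1 h <= sintegral m2 h.
  by apply: (le_trans m12h); apply: ereal_sup_ubound; exists h.
rewrite !sintegralE; apply: lee_fsum => // r [t _ <-].
have [->|ht] := eqVneq (h t) 0%R; first by rewrite !mul0e.
have ht0 : (0 < h t)%R by rewrite lt_neqAle eq_sym ht/=.
rewrite lee_pmul2l//; apply: m12; first exact: measurable_sfunP.
move=> x /= hx; have := hf x; rewrite hx /patch; case: ifPn => [/set_mem//|_].
by rewrite lee_fin leNgt ht0.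
Qed.

End measure_comparison.

Section occupation_density.
Context {R : realType}.
Notation mu := (@lebesgue_measure R).
Variables (f l : R -> R) (t : R).
Hypothesis t0 : 0 <= t.
Hypothesis rc : forall s, 0 <= s -> f u @[u --> s^'+] --> f s.
Hypothesis cl : continuous l.
Hypothesis density : forall A : set R, measurable A ->
  mu (`[0, t] `&` [set s | A (f s)]) = (\int[mu]_(x in A) (l x)%:E)%E.

Let dom : set (measurableTypeR R) := `]0, t]%classic.

Let mdom : measurable dom. Proof. exact: measurable_itv. Qed.

Let mf : measurable_fun dom f.
Proof.
have [/eqP t00|tn0] := boolP (t == 0).
  rewrite (_ : dom = set0); first exact: measurable_fun_set0.
  by rewrite /dom t00 set_itvoc0.
by apply: measurable_right_continuous => //; rewrite lt_neqAle eq_sym tn0.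
Qed.

Variable e : R.
Hypothesis e0 : 0 < e.

(* times outside [dom] are sent to a point outside the window, so that the image
   measure charges the window through [dom] only *)
Let Y (s : measurableTypeR R) : measurableTypeR R := ((fun u => f u - (e + 1)) \_ dom) s + (e + 1).

Let mY : measurable_fun setT Y.
Proof.
apply: measurable_funD => //.
by apply/(measurable_restrictT _ mdom); apply: measurable_funB.
Qed.

Let YE s : dom s -> Y s = f s.
Proof. by move=> ds; rewrite /Y /patch mem_set//; ring. Qed.

Let YN s : ~ dom s -> Y s = e + 1.
Proof. by move=> ds; rewrite /Y /patch memNset//; exact: add0r. Qed.

Let window : set (measurableTypeR R) := `[- e, e]%classic.

Let nu := pushforward mu Y.

Let window_nu (A : set (measurableTypeR R)) : measurable A -> A `<=` window ->
  nu A = (\int[mu]_(x in A) (l x)%:E)%E.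
Proof.
move=> mA Aw; rewrite -density// /nu /pushforward.
have mYA : measurable (Y @^-1` A).
  by have := mY measurableT _ mA; rewrite setTI.
have -> : `[0, t] `&` [set s | A (f s)] = Y @^-1` A `|` ([set 0] `&` [set s | A (f s)]).
  apply/seteqP; split => s /=.
    rewrite in_itv/= => -[/andP[s0 st] As].
    have [s00|sn0] := eqVneq s 0; [by right|left].
    by rewrite YE// /dom/= in_itv/= st lt_neqAle eq_sym sn0 s0.
  case=> [Ys|[-> As]]; last by split; rewrite // in_itv/= lexx t0.
  have [ds|nds] := pselect (dom s).
    move: Ys; rewrite YE// => Ys; split => //; move: ds; rewrite /dom/= !in_itv/= => /andP[s0 ->].
    by rewrite ltW.
  by have := Aw _ Ys; rewrite YN// /window/= in_itv/= => /andP[_]; rewrite leNgt ltrDl ltr01.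
have [A0|A0] := pselect (A (f 0)); last first.
  rewrite (_ : [set 0] `&` _ = set0) ?setU0//.
  by apply/seteqP; split => // s [/= ->].
rewrite (_ : [set 0] `&` _ = [set 0]); last by apply/seteqP; split => // s [/= ->].
by rewrite measureU0//; exact: lebesgue_measure_set1.
Qed.

Let occ_nu : (\int[mu]_(s in dom) (tent e (f s))%:E = \int[nu]_(y in window) (tent e y)%:E)%E.
Proof.
have mt : measurable_fun window (EFin \o tent e).
  by apply/measurable_EFinP; apply: measurable_funTS; exact: measurable_tent.
have mw : measurable window by exact: measurable_itv.
have tpos : {in window, forall y, (0 <= (EFin \o tent e) y)%E}.
  by move=> y _; rewrite lee_fin tent_ge0.
have := @ge0_integral_pushforward _ _ _ _ _ _ mY mu window (EFin \o tent e) mw mt tpos.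
rewrite /nu => ->; rewrite [RHS]integral_mkcond [LHS]integral_mkcond.
apply: (@eq_integral _ _ _ mu setT) => s _.
rewrite /patch; have [ds|nds] := pselect (dom s).
  rewrite mem_set//; case: ifPn => [_|nw]; first by rewrite /= YE.
  rewrite /= tent_supp//; move: nw; rewrite notin_setE /preimage/= YE// /window/= in_itv/=.
  by rewrite -ler_norml => /negP; rewrite -ltNge.
rewrite memNset// ifF//; apply/negbTE; rewrite notin_setE /preimage/= YN// /window/= in_itv/=.
by move=> /andP[_]; rewrite leNgt ltrDl ltr01.
Qed.

(** On the window the occupation measure has a density within [eta] of [l 0], and the
    tent has unit mass. *)
Lemma occupation_bounds (eta : R) : 0 < eta -> (forall x, `|x| <= e -> `|l x - l 0| <= eta) ->
  ((l 0 - eta)%:E <= \int[mu]_(s in dom) (tent e (f s))%:E <= (l 0 + eta)%:E)%E.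
Proof.
move=> eta0 le_eta; rewrite occ_nu.
have mw : measurable window by exact: measurable_itv.
have mt (D : set (measurableTypeR R)) : measurable_fun D (EFin \o tent e).
  by apply/measurable_EFinP; apply: measurable_funTS; exact: measurable_tent.
pose Ym : {mfun (measurableTypeR R) >-> (measurableTypeR R)} :=
  HB.pack Y (isMeasurableFun.Build _ _ _ _ Y mY).
have nu_bounds (A : set (measurableTypeR R)) : measurable A -> A `<=` window ->
    ((l 0 - eta)%:E * mu A <= nu A <= (l 0 + eta)%:E * mu A)%E.
  move=> mA Aw; rewrite window_nu//.
  have muA : (mu A < +oo)%E.
    apply: (@le_lt_trans _ _ (mu window)); first by apply: le_measure => //; rewrite inE.
    by rewrite /window lebesgue_measure_itv/=; case: ifP => _; rewrite -?EFinB ltry.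
  have lb x : A x -> l 0 - eta <= l x <= l 0 + eta.
    move=> /Aw; rewrite /window/= in_itv/= -ler_norml => /le_eta; by rewrite ler_distl.
  have il : mu.-integrable A (EFin \o l).
    apply: measurable_bounded_integrable => //.
      by apply: measurable_funTS; exact: continuous_measurable_fun.
    exists (`|l 0| + eta); split; [by rewrite num_real|move=> x x1 y Ay; rewrite /= (le_trans _ (ltW x1))//].
    have /andP[l1 l2] := lb y Ay; rewrite -[l y](subrK (l 0)) addrC (le_trans (ler_normD _ _))// lerD2l.
    by rewrite ler_norml; lra.
  have ic (k : R) : mu.-integrable A (EFin \o cst k).
    apply: measurable_bounded_integrable => //.
    by exists `|k|; split; [rewrite num_real|move=> x kx y _; rewrite /= ltW].
  rewrite -!integral_cst//; apply/andP; split; apply: le_integral => //.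
  - exact: (ic (l 0 - eta)).
  - by move=> x /set_mem/lb/andP[? _]; rewrite lee_fin.
  - exact: (ic (l 0 + eta)).
  - by move=> x /set_mem/lb/andP[_ ?]; rewrite lee_fin.
have tpos y : window y -> (0 <= (tent e y)%:E)%E by rewrite lee_fin tent_ge0.
apply/andP; split.
- have [neg|pos] := ltP (l 0 - eta) 0.
    apply: (@le_trans _ _ (0 : \bar R)%E); first by rewrite lee_fin ltW.
    by rewrite -occ_nu; apply: integral_ge0 => y _; rewrite lee_fin tent_ge0.
  have -> : ((l 0 - eta)%:E = \int[mscale (NngNum pos) mu]_(y in window) (tent e y)%:E)%E.
    by rewrite ge0_integral_mscale// integral_tent// mule1.
  apply: (@le_measure_integral_on _ _ _ (mscale (NngNum pos) mu) (pushforward mu Ym)) => // A mA Aw.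
  by have /andP[] := nu_bounds A mA Aw.
- have pos : 0 <= l 0 + eta.
    have /andP[_] := nu_bounds window mw (@subset_refl _ _).
    have -> : mu window = (2 * e)%:E.
      rewrite /window lebesgue_measure_itv/= lte_fin ifT ?gt0_cp// -EFinB.
      by congr EFin; ring.
    move=> /(le_trans (measure_ge0 mu (Y @^-1` window))); rewrite -EFinM lee_fin.
    by rewrite pmulr_lge0// mulr_gt0.
  have -> : ((l 0 + eta)%:E = \int[mscale (NngNum pos) mu]_(y in window) (tent e y)%:E)%E.
    by rewrite ge0_integral_mscale// integral_tent// mule1.
  apply: (@le_measure_integral_on _ _ _ (pushforward mu Ym) (mscale (NngNum pos) mu)) => // A mA Aw.
  by have /andP[] := nu_bounds A mA Aw.
Qed.

End occupation_density.

(** * Passage to the limit in exponential moments *)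

Section exponential_moments.
Context {d : measure_display} {T : measurableType d} {R : realType}.
Variable P : probability T R.

Lemma bounded_convergence (f_ : nat -> T -> R) (f : T -> R) (M : R) :
  (forall n, measurable_fun setT (f_ n)) -> measurable_fun setT f ->
  (forall n w, `|f_ n w| <= M) -> {ae P, forall w, f_ n w @[n --> \oo] --> f w} ->
  \int[P]_w f_ n w @[n --> \oo] --> \int[P]_w f w.
Proof.
move=> mf_ mf fM aef.
have mE n : measurable_fun setT (EFin \o f_ n) by exact/measurable_EFinP.
have mEf : measurable_fun setT (EFin \o f) by exact/measurable_EFinP.
have M0 : 0 <= M by apply: le_trans (fM 0%N point).
have iM : P.-integrable setT (EFin \o cst M) by exact: finite_measure_integrable_cst.
have cE : {ae P, forall w, setT w -> (EFin \o f_ n) w @[n --> \oo] --> (EFin \o f) w}.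
  by apply: filterS aef => w cw _; apply: cvg_EFin => //; exact: nearW.
have bE : {ae P, forall w, forall n, setT w -> (`|(EFin \o f_ n) w| <= (EFin \o cst M) w)%E}.
  by apply: aeW => w n _; rewrite /= lee_fin.
have [ig _ cv] := dominated_convergence measurableT mE mEf cE iM bE.
have e : (\int[P]_w (EFin \o f) w)%E = (\int[P]_w f w)%:E.
  by rewrite /Rintegral fineK//; exact: integrable_fin_num.
by rewrite e in cv; exact: fine_cvg cv.
Qed.

Variables (S_ : nat -> T -> R) (U : T -> R).
Hypothesis mS : forall m, measurable_fun setT (S_ m).
Hypothesis mU : measurable_fun setT U.
Hypothesis S_bnd : forall m, exists M, forall w, S_ m w <= M.
Hypothesis S_cvg : {ae P, forall w, S_ m w @[m --> \oo] --> U w}.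

Let mexp (f : T -> R) (g : R) : measurable_fun setT f -> measurable_fun setT (fun w => expR (g * f w)).
Proof. by move=> mf; apply: (measurableT_comp (@measurable_expR R)); exact: measurable_funM. Qed.

Let Eexp m (g : R) : 0 < g -> (\int[P]_w (expR (g * S_ m w))%:E = (\int[P]_w expR (g * S_ m w))%:E)%E.
Proof.
move=> g0; have [M SM] := S_bnd m.
apply: (EFin_Rintegral_prob P _ (expR (g * M))); first exact: mexp.
by move=> w; rewrite ger0_norm ?expR_ge0// ler_expR ler_wpM2l// ltW.
Qed.

Lemma exp_moment_fatou (g B : R) : 0 < g ->
  (exists m0, forall m, (m0 <= m)%N -> \int[P]_w expR (g * S_ m w) <= B) ->
  P.-integrable setT (EFin \o (fun w => expR (g * U w))) /\ \int[P]_w expR (g * U w) <= B.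
Proof.
move=> g0 [m0 hB].
have fat : (\int[P]_w (expR (g * U w))%:E <= B%:E)%E.
  have mE m : measurable_fun setT (EFin \o (fun w => expR (g * S_ m w))).
    by apply/measurable_EFinP; exact: mexp.
  have -> : (\int[P]_w (expR (g * U w))%:E = \int[P]_w limn_einf (fun m => (expR (g * S_ m w))%:E))%E.
    apply: ae_eq_integral => //.
    - by apply/measurable_EFinP; exact: mexp.
    - rewrite (_ : (fun w => limn_einf _) = (fun w => - limn_esup (fun m => - (expR (g * S_ m w))%:E))%E).
        apply: measurableT_comp => //; apply: measurable_fun_limn_esup => m.
        by apply: measurableT_comp => //; exact: mE.
      by apply/funext => w; rewrite limn_esupN oppeK.
    - apply: filterS S_cvg => w cw _; apply/esym.
      have ce : (expR (g * S_ m w))%:E @[m --> \oo] --> (expR (g * U w))%:E.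
        apply: cvg_EFin; first exact: nearW.
        apply: continuous_cvg; first exact: continuous_expR.
        by apply: cvgMr.
      by rewrite is_cvg_limn_einfE; [exact/cvg_lim|apply/cvg_ex; eexists; exact: ce].
  have E0 m w : setT w -> (0 <= (EFin \o (fun w => expR (g * S_ m w))) w)%E.
    by rewrite lee_fin expR_ge0.
  have := fatou P measurableT mE E0 => /le_trans; apply.
  rewrite limn_einf_lim; apply: lime_le; first exact: is_cvg_einfs.
  apply: nearW => n; apply: (@le_trans _ _ (\int[P]_w (expR (g * S_ (maxn n m0) w))%:E)%E).
    by apply: ereal_inf_lbound; exists (maxn n m0); rewrite //= leq_maxl.
  by rewrite Eexp// lee_fin hB// leq_maxr.
have i : P.-integrable setT (EFin \o (fun w => expR (g * U w))).
  apply/integrableP; split; first by apply/measurable_EFinP; exact: mexp.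
  under eq_integral => w _ do rewrite /= ger0_norm ?expR_ge0//.
  by apply: (le_lt_trans fat); rewrite ltry.
split=> //; rewrite -lee_fin /Rintegral fineK//; exact: integrable_fin_num.
Qed.

(** Fatou points the other way; the moment at [2 * g] provides uniform integrability,
    since truncating at the level [N] costs at most [B / N]. *)
Lemma exp_moment_lower (g A B : R) : 0 < g ->
  (exists m0, forall m, (m0 <= m)%N -> \int[P]_w expR (2 * g * S_ m w) <= B) ->
  (exists m0, forall m, (m0 <= m)%N -> A <= \int[P]_w expR (g * S_ m w)) ->
  P.-integrable setT (EFin \o (fun w => expR (g * U w))) ->
  A <= \int[P]_w expR (g * U w).
Proof.
move=> g0 [m1 hB] [m2 hA] iU.
have B0 : 0 <= B by apply: le_trans (hB m1 (leqnn _)); apply: Rintegral_ge0 => w _; exact: expR_ge0.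
have step (N : R) : 0 < N -> A <= \int[P]_w expR (g * U w) + B / N.
  move=> N0.
  have mmin (f : T -> R) : measurable_fun setT f -> measurable_fun setT (fun w => Num.min (expR (g * f w)) N).
    by move=> mf; apply: measurable_minr => //; exact: mexp.
  have bmin x : `|Num.min (expR x) N| <= N.
    by rewrite ger0_norm ?le_min ?expR_ge0 ?(ltW N0)// ge_min lexx orbT.
  have cv : \int[P]_w Num.min (expR (g * S_ m w)) N @[m --> \oo] --> \int[P]_w Num.min (expR (g * U w)) N.
    apply: (@bounded_convergence _ _ N) => //.
    - by move=> n; exact: mmin.
    - exact: mmin.
    - apply: filterS S_cvg => w cw.
      apply: (@continuous_cvg _ _ _ (nbhs \oo) _ _ (fun z : R => Num.min (expR (g * z)) N)) => //.
      apply: (@continuous_min R R (fun z => expR (g * z)) (cst N)); last exact: cst_continuous.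
      apply: (@continuous_comp _ _ _ (fun z => g * z) expR); last exact: continuous_expR.
      by apply: (@continuousM _ _ (cst g) id) => //; exact: cst_continuous.
  have minU : \int[P]_w Num.min (expR (g * U w)) N <= \int[P]_w expR (g * U w).
    apply: le_Rintegral => //.
      by apply: (@integrable_bounded_prob _ _ _ P _ N) => //; exact: mmin.
    by move=> w _; rewrite ge_min lexx.
  apply: (@le_trans _ _ (\int[P]_w Num.min (expR (g * U w)) N + B / N)); last by rewrite lerD2r.
  rewrite -lerBlDr; apply: (cvgr_to_ge cv); near=> m.
  rewrite lerBlDr.
  have mm1 : (m1 <= m)%N by near: m; exact: nbhs_infty_ge.
  have mm2 : (m2 <= m)%N by near: m; exact: nbhs_infty_ge.
  apply: (le_trans (hA m mm2)).
  have [M SM] := S_bnd m.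
  have ib (k : R) : 0 < k -> P.-integrable setT (EFin \o (fun w => expR (k * S_ m w))).
    move=> k0; apply: (@integrable_bounded_prob _ _ _ P _ (expR (k * M))); first exact: mexp.
    by move=> w; rewrite ger0_norm ?expR_ge0// ler_expR ler_wpM2l// ltW.
  have imin : P.-integrable setT (EFin \o (fun w => Num.min (expR (g * S_ m w)) N)).
    by apply: (@integrable_bounded_prob _ _ _ P _ N) => //; exact: mmin.
  have i2 := ib (2 * g) ltac:(rewrite mulr_gt0//).
  have i2N := integrableZl measurableT N^-1 i2.
  apply: (@le_trans _ _ (\int[P]_w (Num.min (expR (g * S_ m w)) N + N^-1 * expR (2 * g * S_ m w)))).
    apply: le_Rintegral => //; [exact: ib|exact: (integrableD measurableT imin i2N)|].
    move=> w _; have -> : expR (2 * g * S_ m w) = expR (g * S_ m w) ^+ 2.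
      by rewrite -expRM_natl; congr expR; ring.
    set y := expR (g * S_ m w); have y0 : 0 <= y by exact: expR_ge0.
    have [yN|Ny] := leP y N; first by rewrite lerDl mulr_ge0 ?sqr_ge0// invr_ge0 ltW.
    apply: (@le_trans _ _ (N^-1 * y ^+ 2)); last by rewrite lerDr ltW.
    by rewrite expr2 mulrA ler_peMl// mulrC ler_pdivlMr// mul1r ltW.
  rewrite RintegralD// lerD2l RintegralZl// mulrC ler_pM2r ?invr_gt0//; exact: hB.
rewrite leNgt; apply/negP => lt.
pose D := A - \int[P]_w expR (g * U w).
have D0 : 0 < D by rewrite subr_gt0.
have := step ((B + 1) / D) ltac:(rewrite divr_gt0//; lra).
rewrite -lerBlDl -/D invf_div mulrA ler_pdivlMr; last lra.
by rewrite mulrDr mulr1 mulrC; lra.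
Unshelve. all: by end_near. Qed.

End exponential_moments.

(** * From occupation integrals to the local time *)

Section limits_of_measurable_functions.
Context {d : measure_display} {T : measurableType d} {R : realType}.

(** A limit that is measurable with no assumption of convergence. *)
Definition upper_limit (f_ : nat -> T -> R) (w : T) : R :=
  fine (limn_esup (fun n => (f_ n w)%:E)).

Lemma measurable_upper_limit (f_ : nat -> T -> R) :
  (forall n, measurable_fun setT (f_ n)) -> measurable_fun setT (upper_limit f_).
Proof.
move=> mf; apply: (measurableT_comp (fine_measurable measurableT)).
by apply: measurable_fun_limn_esup => n; exact/measurable_EFinP.
Qed.

Lemma cvg_upper_limit (f_ : nat -> T -> R) (w : T) (l : R) :
  f_ n w @[n --> \oo] --> l -> upper_limit f_ w = l.
Proof.
move=> fl; rewrite /upper_limit.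
have cE : (f_ n w)%:E @[n --> \oo] --> l%:E by apply: cvg_EFin => //; exact: nearW.
by rewrite is_cvg_limn_esupE; [rewrite (cvg_lim _ cE)|apply/cvg_ex; eexists; exact: cE].
Qed.

End limits_of_measurable_functions.

Section occupation_integrals.
Context {d : measure_display} {T : measurableType d} {R : realType}.
Variables (P : probability T R) (X : R -> {RV P >-> R}) (L : R -> R -> {RV P >-> R}).
Notation mu := (@lebesgue_measure R).

(** On these paths the convergences below are deterministic. *)
Definition good_path (w : T) : Prop :=
  [/\ X 0 w = 0, forall t, 0 <= t -> X s w @[s --> t^'+] --> X t w,
    forall t, 0 <= t -> forall A : set R, measurable A ->
      mu (`[0, t] `&` [set s | A (X s w)]) = (\int[mu]_(x in A) (L x t w)%:E)%E &
    {within [set xt : R * R | 0 <= xt.2], continuous (fun xt : R * R => L xt.1 xt.2 w)}].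

Lemma good_path_ae : is_levy X -> is_local_time X L -> {ae P, forall w, good_path w}.
Proof.
move=> XL LT.
near=> w; split.
- by near: w; exact: (levy_start XL).
- have : (forall t, 0 <= t -> X s w @[s --> t^'+] --> X t w) /\
    (forall t, 0 < t -> cvg (X s w @[s --> t^'-])) by near: w; exact: (levy_cadlag XL).
  by case.
- by near: w; exact: (local_time_density LT).
- by near: w; exact: (local_time_continuous LT).
Unshelve. all: by end_near. Qed.

Lemma continuous_local_time (w : T) (t : R) : good_path w -> 0 <= t -> continuous (fun x => L x t w).
Proof.
move=> [_ _ _ cL] t0 x.
have /subspace_continuousP/(_ (x, t) t0) cxt := cL.
apply: (@cvg_comp _ _ _ (fun y : R => (y, t)) (fun xt : R * R => L xt.1 xt.2 w) _
  (within [set xt : R * R | 0 <= xt.2] (nbhs (x, t)))); last exact: cxt.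
move=> B; rewrite /within/= => -[[B1 B2] /= [nB1 nB2] hB].
apply: filterS nB1 => y B1y; apply: (hB (y, t)) => //; split => //=.
exact: nbhs_singleton nB2.
Qed.

Lemma continuous_tent (e : R) : continuous (tent e).
Proof.
move=> z; apply: (@continuousM _ _ (fun z => Num.max 0 (e - `|z|)) (cst (e ^+ 2)^-1)); last exact: cst_continuous.
apply: (@continuous_max R R (cst 0) (fun z => e - `|z|)); first exact: cst_continuous.
by apply: continuousB; [exact: cst_continuous|exact: norm_continuous].
Qed.

Let tent_bnd (e z : R) : 0 < e -> `|tent e z| <= e^-1.
Proof. by move=> e0; rewrite ger0_norm ?tent_ge0// tent_le. Qed.

Definition riemann_sum (a b e : R) (n : nat) (w : T) : R :=
  mesh a b n * \sum_(0 <= i < n) tent e (X (a + i.+1%:R * mesh a b n) w).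

Lemma riemann_sum_cvg (a b e : R) (w : T) : 0 <= a -> a < b -> 0 < e -> good_path w ->
  riemann_sum a b e n w @[n --> \oo] --> \int[mu]_(s in `]a, b]) tent e (X s w).
Proof.
move=> a0 ab e0 [_ rc _ _].
apply: (@riemann_right_continuous R a b ab (fun s => tent e (X s w)) e^-1) => [t at_|t]; last exact: tent_bnd.
apply: (@continuous_cvg _ _ _ _ _ _ (tent e)); first exact: continuous_tent.
by apply: rc; exact: le_trans at_.
Qed.

Lemma riemann_sum_bounds (a b e : R) n w : a < b -> 0 < e -> 0 <= riemann_sum a b e n w <= (b - a) / e.
Proof.
move=> ab e0; rewrite /riemann_sum; case: n => [|n].
  by rewrite big_nil mulr0 lexx divr_ge0 ?subr_ge0 ?(ltW ab) ?(ltW e0).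
have m0 : 0 < mesh a b n.+1 by exact: mesh_gt0.
apply/andP; split; first by rewrite mulr_ge0 ?(ltW m0)// sumr_ge0// => i _; exact: tent_ge0.
apply: (@le_trans _ _ (mesh a b n.+1 * \sum_(0 <= i < n.+1) e^-1)).
  apply: ler_wpM2l; first exact: ltW.
  by rewrite big_nat [leRHS]big_nat; apply: ler_sum => i _; exact: tent_le.
by rewrite sumr_const_nat subn0 -mulr_natl mulrA [mesh _ _ _ * _]mulrC meshM.
Qed.

Let iocc (a b e : R) (w : T) : 0 <= a -> a <= b -> 0 < e -> good_path w ->
  mu.-integrable (`]a, b] : set (measurableTypeR R)) (EFin \o (fun s => tent e (X s w))).
Proof.
move=> a0 ab e0 gw.
have fin_ab : (mu (`]a, b] : set R) < +oo)%E.
  by rewrite lebesgue_measure_itv/=; case: ifP => _; rewrite -?EFinB ltry.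
apply: measurable_bounded_integrable => //.
- move: ab; rewrite le_eqVlt => /predU1P[->|ab].
    by rewrite set_itvoc0; exact: measurable_fun_set0.
  apply: (measurableT_comp (measurable_tent e)).
  case: gw => _ rc _ _; apply: (@measurable_right_continuous R a b ab) => t at_.
  by apply: rc; exact: le_trans at_.
- exists e^-1; split; [by rewrite num_real|move=> x ex y _; rewrite /= (le_trans _ (ltW ex))//].
  exact: tent_bnd.
Qed.

(** [occupation_bounds] at the times [a] and [b], with windows that shrink to the
    origin, where the local time is continuous in space. *)
Lemma occupation_cvg (a b : R) (w : T) (eta : R) : 0 <= a -> a < b -> good_path w -> 0 < eta ->
  exists2 e0, 0 < e0 & forall e, 0 < e -> e <= e0 ->
  `|\int[mu]_(s in `]a, b]) tent e (X s w) - (L 0 b w - L 0 a w)| <= eta.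
Proof.
move=> a0 ab gw eta0; have b0 : 0 <= b := le_trans a0 (ltW ab).
have e20 : 0 < eta / 2 by rewrite divr_gt0.
have near_t t : 0 <= t -> exists2 e0 : R, 0 < e0 & forall e, 0 < e -> e <= e0 ->
    `|\int[mu]_(s in `]0, t]) tent e (X s w) - L 0 t w| <= eta / 2.
  move=> t0; have cl := continuous_local_time w t gw t0.
  have /cvgrPdist_le/(_ _ e20)/nbhs_ballP[e0 /= e00 he] := cl 0.
  exists (e0 / 2); first by rewrite divr_gt0.
  move=> e e_gt0 ee; case: (gw) => _ rc dens _.
  have le_eta x : `|x| <= e -> `|L x t w - L 0 t w| <= eta / 2.
    by move=> xe; rewrite distrC; apply: he; rewrite /ball/= sub0r normrN; lra.
  have := occupation_bounds (fun s => X s w) (fun x => L x t w) t t0 rc cl (dens t t0) e e_gt0 (eta / 2) e20 le_eta.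
  have -> : (\int[mu]_(s in `]0%R, t]) (tent e (X s w))%:E = (\int[mu]_(s in `]0, t]) tent e (X s w))%:E)%E.
    by rewrite /Rintegral fineK//; apply: integrable_fin_num => //; exact: iocc.
  by rewrite !lee_fin ler_distl.
have [ea ea0 ha] := near_t a a0; have [eb eb0 hb] := near_t b b0.
exists (Num.min ea eb); first by rewrite lt_min ea0.
move=> e e0; rewrite le_min => /andP[ee1 ee2].
have := ha e e0 ee1; have := hb e e0 ee2.
have -> : \int[mu]_(s in `]0, b]) tent e (X s w) =
  \int[mu]_(s in `]0, a]) tent e (X s w) + \int[mu]_(s in `]a, b]) tent e (X s w).
  have setE : `]0, b]%classic = `]0, a]%classic `|` `]a, b]%classic :> set R.
    by rewrite -itv_bndbnd_setU// bnd_simp// ltW.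
  have ib : mu.-integrable ((`]0, a] `|` `]a, b]) : set (measurableTypeR R)) (EFin \o (fun s => tent e (X s w))).
    by rewrite -setE; exact: iocc.
  rewrite setE Rintegral_setU//.
  rewrite disj_set2E; apply/eqP/seteqP; split => // x [] /=.
  by rewrite !in_itv/= => /andP[_ xa] /andP[ax _]; move: ax; rewrite ltNge xa.
set I1 := Rintegral _ _ _; set I2 := Rintegral _ _ _.
rewrite !ler_distl; move: I1 I2 => I1 I2; lra.
Qed.

End occupation_integrals.

Section local_time_moments.
Context {d : measure_display} {T : measurableType d} {R : realType}.
Variables (P : probability T R) (X : R -> {RV P >-> R}) (L : R -> R -> {RV P >-> R}).
Hypotheses (X_levy : is_levy X) (L_local_time : is_local_time X L).
Variables a b : R.
Hypotheses (a0 : 0 <= a) (ab : a < b).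
Notation mu := (@lebesgue_measure R).

Let rsum := riemann_sum P X a b.

Let mrsum e n : measurable_fun setT (rsum e n).
Proof.
apply: measurable_funM => //; apply: measurable_sum => i.
exact: (measurableT_comp (measurable_tent e)).
Qed.

Let X0_ae : {ae P, forall w, X 0 w = 0}. Proof. exact: levy_start X_levy. Qed.

(** The process vanishes at time 0 almost surely. *)
Lemma riemann_moment_sum (g e : R) (n : nat) :
  riemann_moment P X a b g e n = \int[P]_w expR (g * rsum e n w).
Proof.
have pE w : hit_product P X (grid a b n) (pulse (g * mesh a b n) e) n w =
    expR (g * (mesh a b n * \sum_(0 <= i < n) tent e (X (grid a b n i.+1) w - X (grid a b n 0) w))).
  rewrite /hit_product; set u := fun i => tent e (X (grid a b n i.+1) w - X (grid a b n 0) w).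
  transitivity (\prod_(0 <= i < n) expR (g * mesh a b n * u i)).
    by apply: eq_bigr => i _; rewrite /pulse addrC subrK.
  by rewrite -(big_morph _ (@expRD R) (@expR0 R)) -mulr_sumr mulrA.
have mshift i : measurable_fun setT (fun w => tent e (X (grid a b n i.+1) w - X (grid a b n 0) w)).
  by apply: (measurableT_comp (measurable_tent e)); exact: measurable_funB.
rewrite /riemann_moment /Rintegral; congr fine; apply: ae_eq_integral => //.
- apply/measurable_EFinP.
  rewrite (_ : hit_product _ _ _ _ _ = fun w => expR (g * (mesh a b n * \sum_(0 <= i < n)
    tent e (X (grid a b n i.+1) w - X (grid a b n 0) w)))); last exact/funext.
  apply: (measurableT_comp (@measurable_expR R)); apply: measurable_funM => //; apply: measurable_funM => //.
  by apply: measurable_sum => i; exact: (mshift i).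
- apply/measurable_EFinP; apply: (measurableT_comp (@measurable_expR R)).
  by apply: measurable_funM => //; exact: mrsum.
- apply: filterS X0_ae => w X0 _; rewrite pE; congr (_%:E); congr expR; congr (_ * (_ * _)).
  by apply: eq_bigr => i _; rewrite /grid X0 subr0.
Qed.

(* a version of the occupation integral, measurable and bounded for every outcome *)
Let occ (e : R) (w : T) : R := Num.max 0 (Num.min ((b - a) / e) (upper_limit (rsum e) w)).

Let mocc e : measurable_fun setT (occ e).
Proof.
apply: measurable_maxr => //; apply: measurable_minr => //.
exact: measurable_upper_limit.
Qed.

Let occ_cvg e w : 0 < e -> good_path P X L w -> rsum e n w @[n --> \oo] --> occ e w.
Proof.
move=> e0 gw; have cv := riemann_sum_cvg P X L a b e w a0 ab e0 gw.
suff -> : occ e w = \int[mu]_(s in `]a, b]) tent e (X s w) by exact: cv.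
rewrite /occ (cvg_upper_limit _ _ _ cv) (min_idPr _) ?(max_idPr _)//.
- apply: Rintegral_ge0 => s _; exact: tent_ge0.
- by apply: (cvgr_to_le cv); apply: nearW => n; have /andP[] := riemann_sum_bounds P X a b e n w ab e0.
Qed.

Let occE e w : 0 < e -> good_path P X L w -> occ e w = \int[mu]_(s in `]a, b]) tent e (X s w).
Proof.
move=> e0 gw; have cv := riemann_sum_cvg P X L a b e w a0 ab e0 gw.
by apply: (cvg_unique _ (occ_cvg e w e0 gw) cv).
Qed.

Let occ_le e w : 0 < e -> occ e w <= (b - a) / e.
Proof.
by move=> e0; rewrite /occ ge_max ge_min lexx andbT divr_ge0 ?subr_ge0 ?(ltW ab) ?(ltW e0).
Qed.

Let good := good_path_ae P X L X_levy L_local_time.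

Lemma local_time_increment_ge0 : {ae P, forall w, 0 <= L 0 b w - L 0 a w}.
Proof.
apply: filterS good => w gw; rewrite leNgt; apply/negP => neg.
have eta0 : 0 < - (L 0 b w - L 0 a w) / 2 by lra.
have [e0 e00 /(_ e0 e00 (lexx _))] := occupation_cvg P X L a b w _ a0 ab gw eta0.
rewrite ler_distl => /andP[_].
have : 0 <= \int[mu]_(s in `]a, b]) tent e0 (X s w) by apply: Rintegral_ge0 => s _; exact: tent_ge0.
set I := Rintegral _ _ _; move: I => I; lra.
Qed.

Let occ_moment_cvg (g e : R) : 0 < g -> 0 < e ->
  riemann_moment P X a b g e n @[n --> \oo] --> \int[P]_w expR (g * occ e w).
Proof.
move=> g0 e0.
have -> : (fun n => riemann_moment P X a b g e n) = (fun n => \int[P]_w expR (g * rsum e n w)).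
  by apply/funext => n; exact: riemann_moment_sum.
apply: (@bounded_convergence _ _ _ P _ _ (expR (g * ((b - a) / e)))).
- by move=> n; apply: (measurableT_comp (@measurable_expR R)); apply: measurable_funM => //; exact: mrsum.
- by apply: (measurableT_comp (@measurable_expR R)); exact: measurable_funM.
- move=> n w; rewrite ger0_norm ?expR_ge0// ler_expR ler_wpM2l ?(ltW g0)//.
  by have /andP[] := riemann_sum_bounds P X a b e n w ab e0.
- apply: filterS good => w gw; apply: continuous_cvg; first exact: continuous_expR.
  by apply: cvgMr; exact: occ_cvg.
Qed.

Let S_ (m : nat) : T -> R := occ (m.+1%:R^-1).

Let U (w : T) : R := L 0 b w - L 0 a w.

Let S_cvg : {ae P, forall w, S_ m w @[m --> \oo] --> U w}.
Proof.
apply: filterS good => w gw; apply/cvgrPdist_le => eta eta0.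
have [e0 e00 he] := occupation_cvg P X L a b w eta a0 ab gw eta0.
have [n0 n0P] := exists_nat_ge e0^-1.
exists n0 => // m /= nm; rewrite distrC /S_ occE//; apply: he => //.
have [_ me] := n0P m.+1 (leqW nm).
by rewrite -[leRHS]invrK lef_pV2 ?posrE ?invr_gt0.
Qed.

Let to_S (Q : R -> Prop) (e0 : R) : 0 < e0 -> (forall e, 0 < e -> e <= e0 -> Q e) ->
  exists m0 : nat, forall m, (m0 <= m)%N -> Q m.+1%:R^-1.
Proof.
move=> e00 h; have [n0 n0P] := exists_nat_ge e0^-1; exists n0 => m nm; apply: h => //.
have [_ me] := n0P m.+1 (leqW nm).
by rewrite -[leRHS]invrK lef_pV2 ?posrE ?invr_gt0.
Qed.

Let S_bnd m : exists M, forall w, S_ m w <= M.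
Proof. by exists ((b - a) / m.+1%:R^-1) => w; exact: occ_le. Qed.

Let mU : measurable_fun setT U. Proof. exact: measurable_funB. Qed.

(** The limit is taken first in [n], at fixed width [e], by bounded convergence, and
    then in [e]. *)
Lemma local_time_moment_le (g B : R) : 0 < g ->
  (exists2 e0, 0 < e0 & forall e, 0 < e -> e <= e0 -> exists n0 : nat, forall n, (n0 <= n)%N ->
    riemann_moment P X a b g e n <= B) ->
  P.-integrable setT (EFin \o (fun w => expR (g * (L 0 b w - L 0 a w)))) /\
  \int[P]_w expR (g * (L 0 b w - L 0 a w)) <= B.
Proof.
move=> g0 [e0 e00 he].
apply: (exp_moment_fatou P S_ U (fun m => mocc _) mU S_bnd S_cvg g B g0).
apply: (to_S (fun e => \int[P]_w expR (g * occ e w) <= B) e0 e00) => e e_gt0 ee0.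
have [n0 hn] := he e e_gt0 ee0.
by apply: (cvgr_to_le (occ_moment_cvg g e g0 e_gt0)); exists n0 => // n /= /hn.
Qed.

Lemma local_time_moment_ge (g A B : R) : 0 < g ->
  (exists2 e0, 0 < e0 & forall e, 0 < e -> e <= e0 -> exists n0 : nat, forall n, (n0 <= n)%N ->
    riemann_moment P X a b (2 * g) e n <= B) ->
  (exists2 e0, 0 < e0 & forall e, 0 < e -> e <= e0 -> exists n0 : nat, forall n, (n0 <= n)%N ->
    A <= riemann_moment P X a b g e n) ->
  P.-integrable setT (EFin \o (fun w => expR (g * (L 0 b w - L 0 a w)))) ->
  A <= \int[P]_w expR (g * (L 0 b w - L 0 a w)).
Proof.
move=> g0 [e1 e10 he1] [e2 e20 he2] iU.
have g20 : 0 < 2 * g by rewrite mulr_gt0.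
apply: (exp_moment_lower P S_ U (fun m => mocc _) mU S_bnd S_cvg g A B g0 _ _ iU).
- apply: (to_S (fun e => \int[P]_w expR (2 * g * occ e w) <= B) e1 e10) => e e_gt0 ee.
  have [n0 hn] := he1 e e_gt0 ee.
  by apply: (cvgr_to_le (occ_moment_cvg (2 * g) e g20 e_gt0)); exists n0 => // n /= /hn.
- apply: (to_S (fun e => A <= \int[P]_w expR (g * occ e w)) e2 e20) => e e_gt0 ee.
  have [n0 hn] := he2 e e_gt0 ee.
  by apply: (cvgr_to_ge (occ_moment_cvg g e g0 e_gt0)); exists n0 => // n /= /hn.
Qed.

End local_time_moments.

(** * Lower tail bounds by exponential tilting *)

Lemma half_of_split {R : realFieldType} (t1 t2 s m q : R) :
  m <= t1 + t2 + q -> t1 <= s -> t2 <= s -> s <= m / 4 -> m / 2 <= q.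
Proof. lra. Qed.

(** Tilting by a proportion [y] gains [y * eta] to first order and loses [y ^+ 2]; the
    remainder [e] pays for the accuracy of the moment asymptotics. *)
Lemma tilted_exponents {R : realFieldType} (eta : R) : 0 < eta -> eta <= 1 ->
  let y := eta / 4 in let e := eta ^+ 2 / 32 in
  (1 + e) * (1 - y + y ^+ 2) + y * (1 - eta) <= 1 - 2 * e /\
  (1 + e) * (1 + y * (1 + 2 * y)) - y * (1 + eta) <= 1 - 2 * e.
Proof.
move=> eta0 eta1 y e; have eta2 : 0 < eta ^+ 2 by exact: exprn_gt0.
split; rewrite -subr_ge0 /y /e.
- have -> : 1 - 2 * (eta ^+ 2 / 32) -
    ((1 + eta ^+ 2 / 32) * (1 - eta / 4 + (eta / 4) ^+ 2) + eta / 4 * (1 - eta)) =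
    eta ^+ 2 * (1 / 8 - (1 - eta / 4 + (eta / 4) ^+ 2) / 32) by field.
  by apply: mulr_ge0; [exact: ltW|nra].
- have -> : 1 - 2 * (eta ^+ 2 / 32) -
    ((1 + eta ^+ 2 / 32) * (1 + eta / 4 * (1 + 2 * (eta / 4))) - eta / 4 * (1 + eta)) =
    eta ^+ 2 * (1 / 16 - (1 + eta / 4 * (1 + 2 * (eta / 4))) / 32) by field.
  by apply: mulr_ge0; [exact: ltW|nra].
Qed.

Section tilting.
Context {d : measure_display} {T : measurableType d} {R : realType}.
Variables (P : probability T R) (U : T -> R).
Hypothesis mU : measurable_fun setT U.
Hypothesis iU : forall g : R, 0 < g -> P.-integrable setT (EFin \o (fun w => expR (g * U w))).

Let M (g : R) : R := \int[P]_w expR (g * U w).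

(** Chernoff bounds for the law tilted by [expR (g * U)], not normalised: the first
    term bounds the mass below [l], the second the mass above [h], and in between the
    tilting density is at most [expR (g * h)]. *)
Lemma tilted_split (g r l h : R) : 0 < g -> 0 < r -> r < 1 -> l <= h ->
  M g <= M ((1 - r) * g) * expR (r * g * l) + M ((1 + r) * g) * expR (- (r * g * h)) +
    expR (g * h) * fine (P [set w | l <= U w]).
Proof.
move=> g0 r0 r1 lh.
have mA : measurable [set w | l <= U w].
  by rewrite -[X in measurable X]setTI; exact: (measurable_fun_le _ (measurable_cst l) mU).
have i1 := iU ((1 - r) * g) ltac:(rewrite mulr_gt0// subr_gt0//).
have i2 := iU ((1 + r) * g) ltac:(rewrite mulr_gt0// addr_gt0//).
have i1' := integrableZl measurableT (expR (r * g * l)) i1.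
have i2' := integrableZl measurableT (expR (- (r * g * h))) i2.
have iA : P.-integrable setT (EFin \o (\1_[set w | l <= U w] : T -> R)).
  apply: (@integrable_bounded_prob _ _ _ P _ 1) => [|w]; first exact: measurable_indic.
  by rewrite indicE; case: (_ \in _); rewrite ?normr1 ?normr0.
have iA' := integrableZl measurableT (expR (g * h)) iA.
have i12 := integrableD measurableT i1' i2'.
have i123 := integrableD measurableT i12 iA'.
have -> : fine (P [set w | l <= U w]) = \int[P]_w (\1_[set w | l <= U w] w).
  by rewrite /Rintegral integral_indic// setIT.
rewrite [M ((1 - r) * g) * _]mulrC [M ((1 + r) * g) * _]mulrC /M.
rewrite -RintegralZl// -RintegralZl// -RintegralZl// -RintegralD// -RintegralD//.
apply: le_Rintegral => //; first exact: iU.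
move=> w _; rewrite -!expRD.
have e1 := expR_ge0 (r * g * l + (1 - r) * g * U w).
have e2 := expR_ge0 (- (r * g * h) + (1 + r) * g * U w).
have e3 := expR_ge0 (g * h).
have rg : 0 < r * g by rewrite mulr_gt0.
rewrite indicE; have [Ul|lU] := ltP (U w) l.
  rewrite memNset/= ?mulr0 ?addr0; last by rewrite leNgt Ul.
  apply: (le_trans _ (_ : expR (r * g * l + (1 - r) * g * U w) <= _)); last by rewrite lerDl.
  rewrite ler_expR -subr_ge0.
  have -> : r * g * l + (1 - r) * g * U w - g * U w = r * g * (l - U w) by ring.
  by rewrite mulr_ge0 ?(ltW rg)// subr_ge0 ltW.
rewrite mem_set/= ?mulr1//.
have [Uh|hU] := leP (U w) h.
  by apply: (@le_trans _ _ (expR (g * h))); [rewrite ler_expR ler_wpM2l// ltW|rewrite lerDr addr_ge0].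
apply: (@le_trans _ _ (expR (- (r * g * h) + (1 + r) * g * U w))).
  rewrite ler_expR -subr_ge0.
  have -> : - (r * g * h) + (1 + r) * g * U w - g * U w = r * g * (U w - h) by ring.
  by rewrite mulr_ge0 ?(ltW rg)// subr_ge0 ltW.
by rewrite addrAC [leRHS]addrC lerDl addr_ge0.
Qed.

Variables (kappa rho : R).
Hypotheses (kappa0 : 0 < kappa) (rho1 : 1 <= rho).
Hypothesis M_upper : forall e : R, 0 < e -> exists g0, forall g, g0 <= g -> 0 < g ->
  M g <= expR ((1 + e) * kappa * g `^ rho).
Hypothesis M_lower : forall e : R, 0 < e -> exists g0, forall g, g0 <= g -> 0 < g ->
  expR ((1 - e) * kappa * g `^ rho) <= M g.

Lemma powR_ge_self (g : R) : 1 <= g -> g <= g `^ rho.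
Proof. by move=> g1; rewrite -{1}(powRr1 (le_trans ler01 g1)); exact: ler_powR. Qed.

Lemma powR_1D_le (y : R) : 0 <= y -> (1 + y / rho) `^ rho <= expR y.
Proof.
move=> y0; have r0 : 0 < rho := lt_le_trans ltr01 rho1.
apply: (@le_trans _ _ (expR (y / rho) `^ rho)).
  by apply: ge0_ler_powR; rewrite ?nnegrE ?expR_ge0 ?(ltW r0) ?addr_ge0 ?divr_ge0 ?(ltW r0)// expR_ge1Dx.
by rewrite -expRM divfK// gt_eqF.
Qed.

Lemma powR_1B_le (y : R) : 0 <= y -> y <= rho -> (1 - y / rho) `^ rho <= expR (- y).
Proof.
move=> y0 yr; have r0 : 0 < rho := lt_le_trans ltr01 rho1.
have yr1 : y / rho <= 1 by rewrite ler_pdivrMr// mul1r.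
apply: (@le_trans _ _ (expR (- (y / rho)) `^ rho)).
  by apply: ge0_ler_powR; rewrite ?nnegrE ?expR_ge0 ?(ltW r0) ?subr_ge0// expR_ge1Dx.
by rewrite -expRM mulNr divfK// gt_eqF.
Qed.

Lemma expRN_le_quad (y : R) : 0 <= y -> expR (- y) <= 1 - y + y ^+ 2.
Proof.
move=> y0; have y1 : 0 < 1 + y by lra.
apply: (@le_trans _ _ (1 + y)^-1).
  by rewrite expRN lef_pV2 ?posrE ?expR_gt0// expR_ge1Dx.
rewrite -[leLHS]mul1r ler_pdivrMr// -subr_ge0.
have -> : (1 - y + y ^+ 2) * (1 + y) - 1 = y ^+ 3 by ring.
exact: exprn_ge0.
Qed.

(** Under the tilt, [U] concentrates at the derivative [kappa * rho * g `^ (rho - 1)] of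
    the logarithmic moment: both Chernoff terms of [tilted_split] are negligible, and
    what is left is about [M g * expR (- (g * h))], whose exponent is minus the Legendre
    transform of [kappa * g `^ rho], namely [- kappa * (rho - 1) * g `^ rho]. *)
Lemma tail_lower (eta : R) : 0 < eta -> eta <= 1 -> exists g0, forall g, g0 <= g ->
  expR (- (kappa * (rho - 1 + (rho + 2) * eta) * g `^ rho)) <=
  fine (P [set w | (1 - eta) * kappa * rho * g `^ (rho - 1) <= U w]).
Proof.
move=> eta0 eta1.
have r0 : 0 < rho := lt_le_trans ltr01 rho1.
pose y := eta / 4; pose r := y / rho; pose e := eta ^+ 2 / 32.
have y0 : 0 < y by rewrite divr_gt0.
have e0 : 0 < e by rewrite divr_gt0// exprn_gt0.
have y1 : y <= 4^-1 by rewrite /y; lra.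
have rr0 : 0 < r by rewrite divr_gt0.
have yr : y < rho by apply: (le_lt_trans y1); apply: lt_le_trans rho1; lra.
have rr1 : r < 1 by rewrite /r ltr_pdivrMr// mul1r.
have r1D : 0 < 1 + r by lra.
have r1BD : 1 - r <= 1 + r by lra.
have y12 : y <= 2^-1 by lra.
have e1D : 0 <= 1 + e by lra.
have eta12 : 1 - eta <= 1 + eta by lra.
have e_eta : eta <= 2 * eta - e by rewrite /e; nra.
have [quad1 quad2] := tilted_exponents eta eta0 eta1.
have [gu hu] := M_upper e e0; have [gl hl] := M_lower e e0.
pose D := kappa * (eta ^+ 2 / 32).
have D0 : 0 < D by rewrite mulr_gt0// divr_gt0// exprn_gt0.
exists (Num.max 1 (Num.max (gu / (1 - r)) (Num.max gl (Num.max (ln 4 / D) (ln 2 / (kappa * eta)))))).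
move=> g; rewrite !ge_max => /and5P[g1 ggu ggl gD g2].
have g_gt0 : 0 < g by exact: lt_le_trans g1.
have rB : 0 < 1 - r by rewrite subr_gt0.
pose G := g `^ rho.
have gG : g <= G by exact: powR_ge_self.
have G0 : 0 < G by exact: lt_le_trans gG.
have Gs : g * g `^ (rho - 1) = G.
  by rewrite -{1}(powRr1 (ltW g_gt0)) -powRD ?(gt_eqF g_gt0) ?implybT// addrC subrK.
set l := (1 - eta) * kappa * rho * g `^ (rho - 1).
pose h := (1 + eta) * kappa * rho * g `^ (rho - 1).
have lh : l <= h.
  rewrite /l /h; do 3! (apply: ler_wpM2r; first by rewrite ?powR_ge0 ?ltW); exact: eta12.
have split := tilted_split g r l h g_gt0 rr0 rr1 lh.
have Ml := hl g ggl g_gt0.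
have gB : gu <= (1 - r) * g by rewrite -ler_pdivrMl// mulrC.
have gB2 : gu <= (1 + r) * g.
  by apply: (le_trans gB); rewrite ler_wpM2r ?(ltW g_gt0).
have M1 := hu ((1 - r) * g) gB ltac:(rewrite mulr_gt0//).
have M2 := hu ((1 + r) * g) gB2 ltac:(rewrite mulr_gt0//).
have p1 : ((1 - r) * g) `^ rho <= (1 - y + y ^+ 2) * G.
  rewrite powRM ?(ltW rB) ?(ltW g_gt0)//; apply: ler_wpM2r; first exact: ltW.
  by apply: le_trans (expRN_le_quad _ (ltW y0)); apply: powR_1B_le; exact: ltW.
have p2 : ((1 + r) * g) `^ rho <= (1 + y * (1 + 2 * y)) * G.
  rewrite powRM ?(ltW g_gt0) ?(ltW r1D)//.
  apply: ler_wpM2r; first exact: ltW.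
  apply: (le_trans (powR_1D_le _ (ltW y0))); rewrite -lerBlDl; apply: expR_sub1_le => //; exact: ltW.
have M0 g' : 0 <= M g' by apply: Rintegral_ge0 => w _; exact: expR_ge0.
have kG0 : 0 < kappa * G by rewrite mulr_gt0.
have small : expR (kappa * G * (1 - 2 * e)) <= expR ((1 - e) * kappa * G) / 4.
  have -> : kappa * G * (1 - 2 * e) = (1 - e) * kappa * G - D * G by rewrite /D -/e; ring.
  rewrite expRD; apply: ler_wpM2l; first exact: expR_ge0.
  have -> : 4^-1 = expR (- ln 4) :> R by rewrite expRN lnK// posrE.
  rewrite ler_expR lerN2; apply: le_trans (ler_wpM2l (ltW D0) gG).
  by move: gD; rewrite ler_pdivrMr// mulrC.
have T1 : M ((1 - r) * g) * expR (r * g * l) <= expR (kappa * G * (1 - 2 * e)).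
  apply: (le_trans (ler_wpM2r (expR_ge0 _) M1)); rewrite -expRD ler_expR.
  have -> : r * g * l = y * (1 - eta) * (kappa * G) by rewrite /r /l -Gs; field; rewrite gt_eqF.
  have ke : 0 <= (1 + e) * kappa by rewrite mulr_ge0 ?(ltW kappa0).
  apply: (@le_trans _ _ ((1 + e) * kappa * ((1 - y + y ^+ 2) * G) + y * (1 - eta) * (kappa * G))).
    by rewrite lerD2r; apply: ler_wpM2l.
  have -> : (1 + e) * kappa * ((1 - y + y ^+ 2) * G) + y * (1 - eta) * (kappa * G) =
    kappa * G * ((1 + e) * (1 - y + y ^+ 2) + y * (1 - eta)) by ring.
  apply: ler_wpM2l; first exact: ltW.
  exact: quad1.
have T2 : M ((1 + r) * g) * expR (- (r * g * h)) <= expR (kappa * G * (1 - 2 * e)).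
  apply: (le_trans (ler_wpM2r (expR_ge0 _) M2)); rewrite -expRD ler_expR.
  have -> : r * g * h = y * (1 + eta) * (kappa * G) by rewrite /r /h -Gs; field; rewrite gt_eqF.
  have ke : 0 <= (1 + e) * kappa by rewrite mulr_ge0 ?(ltW kappa0).
  apply: (@le_trans _ _ ((1 + e) * kappa * ((1 + y * (1 + 2 * y)) * G) - y * (1 + eta) * (kappa * G))).
    by rewrite lerD2r; apply: ler_wpM2l.
  have -> : (1 + e) * kappa * ((1 + y * (1 + 2 * y)) * G) - y * (1 + eta) * (kappa * G) =
    kappa * G * ((1 + e) * (1 + y * (1 + 2 * y)) - y * (1 + eta)) by ring.
  apply: ler_wpM2l; first exact: ltW.
  exact: quad2.
set p := fine _ in split *.
have half : expR ((1 - e) * kappa * G) / 2 <= expR (g * h) * p.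
  have := le_trans Ml split; rewrite -/G.
  move: T1 T2 small; set t1 := _ * expR (r * g * l); set t2 := _ * expR (- (r * g * h)).
  by move=> T1 T2 small Mp; exact: (half_of_split _ _ _ _ _ Mp T1 T2 small).
have -> : p = expR (- (g * h)) * (expR (g * h) * p) by rewrite mulrA -expRD addNr expR0 mul1r.
apply: le_trans (ler_wpM2l (expR_ge0 _) half).
have -> : 2^-1 = expR (- ln 2) :> R by rewrite expRN lnK// posrE.
rewrite -!expRD ler_expR.
have -> : g * h = (1 + eta) * rho * (kappa * G) by rewrite /h -Gs; ring.
rewrite -/G -subr_ge0.
have -> : - ((1 + eta) * rho * (kappa * G)) + ((1 - e) * kappa * G - ln 2) -
   - (kappa * (rho - 1 + (rho + 2) * eta) * G) = kappa * G * (2 * eta - e) - ln 2 by ring.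
rewrite subr_ge0; apply: le_trans (ler_wpM2l (ltW kG0) e_eta).
have ke0 : 0 < kappa * eta by rewrite mulr_gt0.
have : ln 2 <= kappa * eta * g by move: g2; rewrite ler_pdivrMr// mulrC.
move=> /le_trans; apply; rewrite [leRHS]mulrAC; apply: ler_wpM2l => //; exact: ltW.
Qed.

End tilting.

(** * The potential kernel of the stable process *)

Section stable_kernel.
Local Open Scope complex_scope.
Context {d : measure_display} {T : measurableType d} {R : realType}.
Variables (P : probability T R) (X : R -> {RV P >-> R}) (alpha nu chi : R).
Hypotheses (alpha1 : 1 < alpha) (chi0 : 0 < chi) (X_stable : is_stable_levy alpha nu chi X).

Let tau := nu * tan (pi * alpha / 2).

Let alpha0 : 0 < alpha. Proof. exact: lt_trans ltr01 alpha1. Qed.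

Lemma stable_cf_levy (s : R) : 0 < s -> stable_cf P alpha tau (s / chi) (X s).
Proof.
move=> s0 u u0; have [_ /(_ s u (ltW s0))] := X_stable.
have EE f : fine ('E_P[f]) = \int[P]_w f w by rewrite unlock.
rewrite /charfun /cexp gtr0_sg// mulr1 gtr0_norm// -/tau !EE.
have -> : - ((s * u `^ alpha)%:C * ((1 +i* tau) / chi%:C)) =
  (- (s / chi * u `^ alpha)) +i* (- (tau * (s / chi * u `^ alpha))).
  rewrite -fmorphV; apply/eqP; rewrite eq_complex /=; apply/andP; split; apply/eqP; ring.
case; rewrite !mul0r subr0 addr0 cosN sinN => -> ->.
by rewrite mulrN.
Qed.

Let theta := 1 - alpha^-1.

Lemma theta_gt0 : 0 < theta. Proof. by rewrite subr_gt0 invf_lt1. Qed.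

Lemma theta_lt1 : theta < 1. Proof. by rewrite gtrDl oppr_lt0 invr_gt0. Qed.

Let scaleE (s : R) : 0 < s -> (s / chi) `^ (- alpha^-1) = chi `^ alpha^-1 * s `^ (theta - 1).
Proof.
move=> s0; rewrite powRM ?(ltW s0) ?invr_ge0 ?(ltW chi0)// mulrC; congr (_ * _).
  by rewrite -powR_inv1 ?(ltW chi0)// -powRrM mulN1r opprK.
by congr (_ `^ _); rewrite /theta; ring.
Qed.

Definition kernel_bound : R := chi `^ alpha^-1 * (Gamma alpha^-1 / (pi * alpha)).

(** The density at the origin of the process at time 1. *)
Definition kernel_peak : R := chi `^ alpha^-1 * stable_peak alpha tau.

Let pi0 : 0 < pi :> R. Proof. exact: pi_gt0. Qed.

Let Gamma_inv_gt0 : 0 < Gamma alpha^-1 :> R.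
Proof. by apply: Gamma_gt0; rewrite ?invr_gt0// invf_lt1. Qed.

Lemma kernel_bound_gt0 : 0 < kernel_bound.
Proof. by rewrite mulr_gt0 ?powR_gt0// divr_gt0// mulr_gt0. Qed.

Lemma kernel_peak_gt0 : 0 < kernel_peak.
Proof.
rewrite mulr_gt0 ?powR_gt0// divr_gt0 ?mulr_gt0// ?powR_gt0//.
  by rewrite ltr_wpDr ?sqr_ge0.
have ai : 0 < alpha^-1 by rewrite invr_gt0.
have ai1 : alpha^-1 < 1 by rewrite invf_lt1.
have t1 := atan_ltpi2 tau; have t2 := atan_gtNpi2 tau.
apply: cos_gt0_pihalf.
move: t1 t2; set v := atan tau => t1 t2.
have vpi : `|v| < pi / 2 by rewrite ltr_norml t2 t1.
rewrite -ltr_norml normrM gtr0_norm//; apply: le_lt_trans vpi.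
by rewrite ler_piMl// ltW.
Qed.

(** [A1] is the density at the origin times the Laplace factor [Gamma theta] of the
    kernel [s `^ (theta - 1)]. *)
Lemma kernel_peakE : kernel_peak * Gamma theta = A1 alpha nu chi.
Proof.
rewrite /kernel_peak /stable_peak /A1 -/tau -/theta.
have -> : (2 * alpha)^-1 = alpha^-1 / 2 by rewrite invfM mulrC.
rewrite powRN.
have p1 : (1 + tau ^+ 2) `^ (alpha^-1 / 2) != 0 by rewrite gt_eqF// powR_gt0// ltr_wpDr ?sqr_ge0.
have : pi != 0 :> R by rewrite gt_eqF.
have : alpha != 0 by rewrite gt_eqF.
move: p1 (pi : R) => /[swap] p; move: (Gamma theta) (Gamma alpha^-1) (chi `^ _) (cos _) (_ `^ (alpha^-1 / 2)).
by move=> x1 x2 x3 x4 x5 x50 an pn; field; rewrite an pn x50.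
Qed.

Lemma stable_kernel_le (e s x : R) : 0 < e -> 0 < s ->
  \int[P]_w tent e (x + X s w) <= kernel_bound * s `^ (theta - 1).
Proof.
move=> e0 s0; have k0 : 0 < s / chi by rewrite divr_gt0.
have := expectation_tent_stable_le P alpha tau (s / chi) (X s) (ltW alpha1) k0 _ (stable_cf_levy s s0) e x e0.
by rewrite scaleE// /kernel_bound mulrAC; apply.
Qed.

Lemma stable_kernel_near (s0 : R) : 0 < s0 -> exists2 M : R, 0 <= M &
  forall e s x : R, 0 < e -> e <= 1 -> `|x| <= e -> s0 <= s ->
  `|\int[P]_w tent e (x + X s w) - kernel_peak * s `^ (theta - 1)| <= e * M.
Proof.
move=> s00; exists (stable_moment alpha (s0 / chi)).
  rewrite /stable_moment divr_ge0 ?(ltW pi0)// addr_ge0//; apply: Rintegral_ge0 => u /= u0.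
    by rewrite mulr_ge0 ?expR_ge0//; move: u0; rewrite in_itv/= andbT => /ltW.
  by rewrite mulr_ge0 ?expR_ge0// sqr_ge0.
move=> e s x e0 e1 xe ss; have sp : 0 < s by exact: lt_le_trans ss.
have k0 : 0 < s / chi by rewrite divr_gt0.
have k10 : 0 < s0 / chi by rewrite divr_gt0.
have kk : s0 / chi <= s / chi by rewrite ler_pM2r// invr_gt0.
have := expectation_tent_stable_near P alpha tau (s / chi) (X s) (ltW alpha1) k0 _ (stable_cf_levy s sp) e x (s0 / chi) e0 e1 xe k10 kk.
by rewrite scaleE// /kernel_peak mulrAC; apply.
Qed.

End stable_kernel.

(** * Exponential moments of the local time *)

Section local_time_asymptotics.
Context {d : measure_display} {T : measurableType d} {R : realType}.
Variables (P : probability T R) (X : R -> {RV P >-> R}) (L : R -> R -> {RV P >-> R}).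
Variables (alpha nu chi a b : R).
Hypotheses (alpha1 : 1 < alpha) (chi0 : 0 < chi) (X_stable : is_stable_levy alpha nu chi X).
Hypothesis L_local_time : is_local_time X L.
Hypotheses (a0 : 0 <= a) (ab : a < b).

Let theta := 1 - alpha^-1.
Let rho := theta^-1.
Let A := A1 alpha nu chi.
Let M (g : R) := \int[P]_w expR (g * (L 0 b w - L 0 a w)).

Let X_levy : is_levy X. Proof. by case: X_stable. Qed.
Let theta0 : 0 < theta. Proof. exact: theta_gt0. Qed.
Let theta1 : theta < 1. Proof. exact: theta_lt1. Qed.

Lemma A1_gt0 : 0 < A.
Proof. by rewrite /A -(kernel_peakE alpha nu chi alpha1) mulr_gt0 ?kernel_peak_gt0// Gamma_gt0. Qed.

Lemma rho_ge1 : 1 <= rho.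
Proof. by rewrite /rho invf_ge1// ltW. Qed.

Let upper (eta : R) (eta0 : 0 < eta) (eta1 : eta <= 1) :=
  riemann_moment_upper P X X_levy theta (kernel_peak alpha nu chi) (kernel_bound alpha chi)
    theta0 theta1 (kernel_peak_gt0 alpha nu chi alpha1 chi0) (kernel_bound_gt0 alpha chi alpha1 chi0)
    (stable_kernel_le P X alpha nu chi alpha1 chi0 X_stable)
    (stable_kernel_near P X alpha nu chi alpha1 chi0 X_stable)
    a b a0 ab A (esym (kernel_peakE alpha nu chi alpha1)) eta eta0 eta1.

Let lower (eta : R) (eta0 : 0 < eta) (eta1 : eta <= 4^-1) :=
  riemann_moment_lower P X X_levy theta (kernel_peak alpha nu chi) (kernel_bound alpha chi)
    theta0 theta1 (kernel_peak_gt0 alpha nu chi alpha1 chi0)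
    (stable_kernel_le P X alpha nu chi alpha1 chi0 X_stable)
    (stable_kernel_near P X alpha nu chi alpha1 chi0 X_stable)
    a b a0 ab A (esym (kernel_peakE alpha nu chi alpha1)) eta eta0 eta1.

Let local_time_moment (eta : R) : 0 < eta -> eta <= 1 -> exists2 K : R, 0 < K &
  forall g : R, 0 < g -> P.-integrable setT (EFin \o (fun w => expR (g * (L 0 b w - L 0 a w)))) /\
    M g <= 1 + K * expR (((1 + eta) * g * A) `^ rho * (b - a)).
Proof.
move=> eta0 eta1; have [K K0 hK] := upper eta eta0 eta1; exists K => // g g0.
exact: (local_time_moment_le P X L X_levy L_local_time a b a0 ab g _ g0 (hK g g0)).
Qed.

Lemma integrable_local_time_moment (g : R) : 0 < g ->
  P.-integrable setT (EFin \o (fun w => expR (g * (L 0 b w - L 0 a w)))).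
Proof. by move=> g0; have [K _ /(_ g g0)[]] := local_time_moment 1 ltr01 (lexx _). Qed.

Definition moment_rate : R := A `^ rho * (b - a).

Let kappa := moment_rate.

Lemma moment_rate_gt0 : 0 < kappa.
Proof. by rewrite mulr_gt0 ?subr_gt0// powR_gt0// A1_gt0. Qed.

Let kappaE (s g : R) : 0 <= s -> 0 <= g -> (s * g * A) `^ rho * (b - a) = s `^ rho * (kappa * g `^ rho).
Proof.
move=> s0 g0; have A0 := ltW A1_gt0.
rewrite (powRM _ (mulr_ge0 s0 g0) A0) (powRM _ s0 g0) /kappa /moment_rate; ring.
Qed.

(** The slack [1 + y / rho] in the rate becomes about [1 + y] after the power [rho], and
    the constant [K] is absorbed once [g] is large. *)
Lemma local_time_moment_upper (e : R) : 0 < e -> exists g0, forall g, g0 <= g -> 0 < g ->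
  M g <= expR ((1 + e) * kappa * g `^ rho).
Proof.
move=> e0; pose e' := Num.min e 1; have r1 := rho_ge1; have k0 := moment_rate_gt0.
have e'0 : 0 < e' by rewrite lt_min e0 ltr01.
have [e'e e'1] : e' <= e /\ e' <= 1 by rewrite !ge_min !lexx orbT.
pose y := e' / 4; have y0 : 0 < y by rewrite divr_gt0.
have r0 : 0 < rho by exact: lt_le_trans r1.
have eta0 : 0 < y / rho by rewrite divr_gt0.
have eta1 : y / rho <= 1 by rewrite ler_pdivrMr// mul1r; apply: le_trans r1; rewrite /y; lra.
have [K K0 hK] := local_time_moment (y / rho) eta0 eta1.
exists (Num.max 1 (2 * ln (1 + K) / (e' * kappa))) => g; rewrite ge_max => /andP[g1 gK] g0.
have [_ /le_trans] := hK g g0; apply.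
rewrite kappaE ?(ltW g0)//; last by rewrite addr_ge0// ltW.
pose G := kappa * g `^ rho; rewrite -/G.
have gG : kappa * g <= G by apply: ler_wpM2l; [exact: ltW|exact: powR_ge_self].
have G0 : 0 < G by apply: lt_le_trans gG; rewrite mulr_gt0.
have pw : (1 + y / rho) `^ rho <= 1 + e' / 2.
  apply: (le_trans (powR_1D_le rho r1 y (ltW y0))); rewrite -lerBlDl.
  have y2 : y <= 2^-1 by rewrite /y; lra.
  by apply: (le_trans (expR_sub1_le y (ltW y0) y2)); rewrite /y; nra.
have K1 : 0 < 1 + K by lra.
apply: (@le_trans _ _ ((1 + K) * expR ((1 + e' / 2) * G))).
  rewrite mulrDl mul1r; apply: lerD.
    by rewrite -[leLHS]expR0 ler_expR mulr_ge0 ?(ltW G0)//; lra.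
  by rewrite ler_wpM2l ?(ltW K0)// ler_expR ler_wpM2r ?(ltW G0).
rewrite -{1}(lnK (_ : 1 + K \is Num.pos)) ?posrE// -expRD ler_expR.
have lnG : ln (1 + K) <= e' / 2 * G.
  apply: (@le_trans _ _ (e' / 2 * (kappa * g))); last by apply: ler_wpM2l => //; rewrite divr_ge0 ?ltW.
  have ek : 0 < e' * kappa by rewrite mulr_gt0.
  have -> : e' / 2 * (kappa * g) = g * (e' * kappa) / 2 by field.
  by rewrite ler_pdivlMr// mulrC -ler_pdivrMr.
have -> : (1 + e) * kappa * g `^ rho = (1 + e) * G by rewrite /G mulrA.
apply: (@le_trans _ _ ((1 + e') * G)); last by rewrite ler_wpM2r ?(ltW G0)// lerD2l.
have -> : (1 + e') * G = e' / 2 * G + (1 + e' / 2) * G by field.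
by rewrite lerD2r.
Qed.

(** The factor [K * g] is at least one once [g] is large; the two losses in the exponent
    are kept below [e / 4] and [e / 2]. *)
Lemma local_time_moment_lower (e : R) : 0 < e -> exists g0, forall g, g0 <= g -> 0 < g ->
  expR ((1 - e) * kappa * g `^ rho) <= M g.
Proof.
move=> e0; pose e' := Num.min e 1; have r1 := rho_ge1; have k0 := moment_rate_gt0.
have e'0 : 0 < e' by rewrite lt_min e0 ltr01.
have [e'e e'1] : e' <= e /\ e' <= 1 by rewrite !ge_min !lexx orbT.
have r0 : 0 < rho by exact: lt_le_trans r1.
pose eta := e' / 8 / rho.
have eta0 : 0 < eta by rewrite !divr_gt0.
have eta8 : eta <= e' / 8.
  by rewrite /eta ler_pdivrMr// ler_peMr// divr_ge0// ltW.
have eta1 : eta <= 4^-1 by lra.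
have [K K0 hK] := lower eta eta0 eta1.
exists K^-1 => g gK g0.
have g20 : 0 < 2 * g by rewrite mulr_gt0.
have [B B0 hB] := upper 1 ltr01 (lexx _).
apply: le_trans (local_time_moment_ge P X L X_levy L_local_time a b a0 ab g _ _ g0 (hB _ g20) (hK g g0)
  (integrable_local_time_moment g g0)).
have Kg : 1 <= K * g by rewrite -ler_pdivrMl// mulr1.
apply: (@le_trans _ _ (1 * expR (((1 - eta) * g * A) `^ rho * (b - a) * (1 - 4 * eta)))); last first.
  by rewrite ler_wpM2r ?expR_ge0.
rewrite mul1r ler_expR kappaE ?(ltW g0)//; last by lra.
rewrite -[leLHS]mulrA [leRHS]mulrAC; apply: ler_wpM2r.
  by rewrite mulr_ge0 ?powR_ge0 ?ltW.
have base : expR (- (2 * eta)) <= 1 - eta.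
  apply: (@le_trans _ _ (1 + 2 * eta)^-1).
    by rewrite expRN lef_pV2 ?posrE ?expR_gt0 ?expR_ge1Dx//; lra.
  by rewrite -[leLHS]mul1r ler_pdivrMr; nra.
have pw : 1 - e' / 4 <= (1 - eta) `^ rho.
  apply: (@le_trans _ _ (expR (- (2 * eta)) `^ rho)); last first.
    by apply: ge0_ler_powR; rewrite ?nnegrE ?expR_ge0 ?(ltW r0)//; lra.
  rewrite -expRM.
  have -> : - (2 * eta) * rho = - (e' / 4) by rewrite /eta; field; rewrite gt_eqF.
  exact: expR_ge1Dx.
have f1 : 1 - e' / 2 <= 1 - 4 * eta by lra.
apply: (@le_trans _ _ ((1 - e' / 4) * (1 - e' / 2))); first by nra.
by apply: ler_pM => //; lra.
Qed.

End local_time_asymptotics.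

(** * Gaussian tails *)

Lemma measurable_set_gt {d} {T : measurableType d} {R : realType} (f : T -> R) (y : R) :
  measurable_fun setT f -> measurable [set w | y < f w].
Proof.
move=> mf; have := mf measurableT _ (measurable_itv `]y, +oo[); rewrite setTI.
by congr measurable; apply/seteqP; split => w /=; rewrite in_itv/= andbT.
Qed.

Section normal_law.
Context {R : realType}.
Notation mu := (@lebesgue_measure R).
Implicit Types (m s c l x : R).

Lemma integral_normal_prob m s (f : R -> \bar R) : s != 0 -> measurable_fun setT f ->
  (forall x, (0 <= f x)%E) ->
  (\int[normal_prob m s]_x f x = \int[mu]_x (f x * (normal_pdf m s x)%:E))%E.
Proof.
move=> s0 mf f0; have dom := normal_prob_dominates m s.
rewrite -(Radon_Nikodym_SigmaFinite.change_of_variables dom f0 measurableT mf).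
have mpdf : measurable_fun setT (EFin \o normal_pdf m s).
  by apply/measurable_EFinP; exact: measurable_normal_pdf.
have iRN := Radon_Nikodym_SigmaFinite.f_integrable dom.
apply: ae_eq_integral => //.
- apply: emeasurable_funM => //; exact: (measurable_int mu).
- exact: emeasurable_funM.
- apply: ae_eqe_mul2l; apply: integral_ae_eq => //= E _ mE.
  by rewrite -Radon_Nikodym_SigmaFinite.f_integral.
Qed.

Lemma normal_pdf_gauss s c x : 0 < s -> 0 < 1 + c ->
  expR (- (c * x ^+ 2 / (2 * s ^+ 2))) * normal_pdf 0 s x =
  (Num.sqrt (1 + c))^-1 * normal_pdf 0 (s / Num.sqrt (1 + c)) x.
Proof.
move=> s0 c0; have q0 : 0 < Num.sqrt (1 + c) by rewrite sqrtr_gt0.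
have s'0 : 0 < s / Num.sqrt (1 + c) by rewrite divr_gt0.
rewrite !normal_pdfE ?gt_eqF// /normal_peak /normal_fun.
have E : (s / Num.sqrt (1 + c)) ^+ 2 = s ^+ 2 / (1 + c) by rewrite expr_div_n sqr_sqrtr// ltW.
rewrite E subr0.
have -> : Num.sqrt (s ^+ 2 / (1 + c) * pi *+ 2) = Num.sqrt (s ^+ 2 * pi *+ 2) / Num.sqrt (1 + c).
  have -> : s ^+ 2 / (1 + c) * pi *+ 2 = (s ^+ 2 * pi *+ 2) * (1 + c)^-1.
    by rewrite [s ^+ 2 / (1 + c) * pi]mulrAC mulrnAl.
  rewrite sqrtrM ?sqrtrV ?(ltW c0)//.
  by rewrite mulrn_wge0// mulr_ge0 ?sqr_ge0 ?pi_ge0.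
rewrite mulrCA -expRD invf_div mulrA [_^-1 * (_ / _)]mulrA mulVf ?gt_eqF// mul1r; congr (_ * expR _).
rewrite -mulr_natl -[s ^+ 2 / (1 + c) *+ 2]mulr_natl.
by field; rewrite !gt_eqF.
Qed.

Lemma normal_pdf_mgf m s l x : 0 < s ->
  expR (l * x) * normal_pdf m s x = expR (l * m + l ^+ 2 * s ^+ 2 / 2) * normal_pdf (m + l * s ^+ 2) s x.
Proof.
move=> s0; rewrite !normal_pdfE ?gt_eqF// /normal_fun mulrCA -expRD [RHS]mulrCA -expRD.
by congr (_ * expR _); field; rewrite gt_eqF.
Qed.

End normal_law.

Section gaussian_variable.
Context {d : measure_display} {T : measurableType d} {R : realType}.
Variables (P : probability T R) (Y : T -> R) (m s : R).
Hypotheses (mY : measurable_fun setT Y) (s0 : 0 < s).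
Hypothesis lawY : forall A : set R, measurable A -> P (Y @^-1` A) = normal_prob m s A.
Notation mu := (@lebesgue_measure R).

Let sn : s != 0. Proof. by rewrite gt_eqF. Qed.

Let law_integral (f : R -> \bar R) : measurable_fun setT f -> (forall x, (0 <= f x)%E) ->
  (\int[P]_w f (Y w) = \int[mu]_x (f x * (normal_pdf m s x)%:E))%E.
Proof.
move=> mf f0; rewrite -integral_normal_prob//.
pose Ym : {mfun T >-> measurableTypeR R} :=
  HB.pack (Y : T -> measurableTypeR R) (isMeasurableFun.Build _ _ _ _ (Y : T -> measurableTypeR R) mY).
transitivity (\int[distribution P Ym]_x f x)%E; first by rewrite ge0_integral_distribution.
by apply: eq_measure_integral => A mA _; exact: lawY.
Qed.

Lemma normal_mgf (l : R) :
  (\int[P]_w (expR (l * Y w))%:E = (expR (l * m + l ^+ 2 * s ^+ 2 / 2))%:E)%E.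
Proof.
rewrite (law_integral (fun x => (expR (l * x))%:E)).
- under eq_integral do rewrite -EFinM normal_pdf_mgf// EFinM.
  rewrite ge0_integralZl_EFin ?expR_ge0//; last 2 first.
  + by move=> x _; rewrite lee_fin normal_pdf_ge0.
  + by apply/measurable_EFinP; exact: measurable_normal_pdf.
  by rewrite integral_normal_pdf mule1.
- apply/measurable_EFinP; apply: (measurableT_comp (@measurable_expR R)); exact: measurable_funM.
- by move=> x; rewrite lee_fin expR_ge0.
Qed.

Lemma normal_gauss_moment (c : R) : m = 0 -> 0 < 1 + c ->
  (\int[P]_w (expR (- (c * Y w ^+ 2 / (2 * s ^+ 2))))%:E = ((Num.sqrt (1 + c))^-1)%:E)%E.
Proof.
move=> m0 c0; have q0 : 0 < Num.sqrt (1 + c) by rewrite sqrtr_gt0.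
rewrite (law_integral (fun x => (expR (- (c * x ^+ 2 / (2 * s ^+ 2))))%:E)).
- transitivity (\int[mu]_x (((Num.sqrt (1 + c))^-1)%:E *
      (normal_pdf 0 (s / Num.sqrt (1 + c)) x)%:E))%E.
    by apply: eq_integral => x _; rewrite -EFinM m0 normal_pdf_gauss.
  rewrite ge0_integralZl_EFin ?invr_ge0 ?(ltW q0)//; last 2 first.
  + by move=> x _; rewrite lee_fin normal_pdf_ge0.
  + by apply/measurable_EFinP; exact: measurable_normal_pdf.
  by rewrite integral_normal_pdf mule1.
- apply/measurable_EFinP; apply: (measurableT_comp (@measurable_expR R)).
  apply: (measurableT_comp (@oppr_measurable R setT)); apply: measurable_funM => //.
  by apply: measurable_funM => //; exact: measurable_funX.
- by move=> x; rewrite lee_fin expR_ge0.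
Qed.

(** [1 + l * Y <= expR (l * Y)] integrates to [0 <= l * m + l ^+ 2 * s ^+ 2 / 2] for all
    [l]; the choice [l = - m / s ^+ 2] leaves no room for a nonzero [m]. *)
Lemma normal_mean : P.-integrable setT (EFin \o Y) -> \int[P]_w Y w = 0 -> m = 0.
Proof.
move=> iY Y0.
have mexp (l : R) : measurable_fun setT (fun w => expR (l * Y w)).
  by apply: (measurableT_comp (@measurable_expR R)); exact: measurable_funM.
have ge1 (l : R) : 0 <= l * m + l ^+ 2 * s ^+ 2 / 2.
  have iexp : P.-integrable setT (EFin \o (fun w => expR (l * Y w))).
    apply/integrableP; split; first by apply/measurable_EFinP; exact: mexp.
    under eq_integral => w _ do rewrite /= ger0_norm ?expR_ge0//.
    by rewrite normal_mgf ltry.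
  have ilY := integrableZl measurableT l iY.
  have i1 : P.-integrable setT (EFin \o cst (1 : R)) by exact: finite_measure_integrable_cst.
  have : \int[P]_w (1 + l * Y w) <= \int[P]_w expR (l * Y w).
    apply: le_Rintegral => //; first exact: (integrableD measurableT i1 ilY).
    by move=> w _; exact: expR_ge1Dx.
  rewrite [X in _ <= X]/Rintegral normal_mgf /= RintegralD//.
  rewrite RintegralZl// Y0 mulr0 addr0 Rintegral_cst// mul1r.
  rewrite [X in fine X](_ : _ = 1%E); last exact: probability_setT.
  by rewrite /= -[X in X <= _]expR0 ler_expR.
have := ge1 (- m / s ^+ 2).
have -> : - m / s ^+ 2 * m + (- m / s ^+ 2) ^+ 2 * s ^+ 2 / 2 = - (m ^+ 2 / (2 * s ^+ 2)) by field.
rewrite oppr_ge0 => h; apply/eqP; rewrite -sqrf_eq0 eq_le sqr_ge0 andbT.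
by move: h; rewrite ler_pdivrMr ?mul0r// mulr_gt0// exprn_gt0.
Qed.

(** The same tangent argument, for the moments of [normal_gauss_moment]. *)
Lemma normal_variance (v : R) : m = 0 -> P.-integrable setT (EFin \o (fun w => Y w ^+ 2)) ->
  \int[P]_w (Y w ^+ 2) = v -> v = s ^+ 2.
Proof.
move=> m0 iY2 Yv; have s20 : 0 < 2 * s ^+ 2 by rewrite mulr_gt0// exprn_gt0.
(* the map c |-> E exp(- c Y^2 / (2 s^2)) lies above its tangent at the origin *)
have tangent (c : R) : 0 < 1 + c -> 1 - c * (v / (2 * s ^+ 2)) <= (Num.sqrt (1 + c))^-1.
  move=> c0.
  have iexp : P.-integrable setT (EFin \o (fun w => expR (- (c * Y w ^+ 2 / (2 * s ^+ 2))))).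
    apply/integrableP; split.
      apply/measurable_EFinP; apply: (measurableT_comp (@measurable_expR R)).
      apply: (measurableT_comp (@oppr_measurable R setT)); apply: measurable_funM => //.
      by apply: measurable_funM => //; exact: measurable_funX.
    under eq_integral => w _ do rewrite /= ger0_norm ?expR_ge0//.
    by rewrite normal_gauss_moment// ltry.
  have icY := integrableZl measurableT (- c / (2 * s ^+ 2)) iY2.
  have i1 : P.-integrable setT (EFin \o cst (1 : R)) by exact: finite_measure_integrable_cst.
  have : \int[P]_w (1 + - c / (2 * s ^+ 2) * Y w ^+ 2) <= \int[P]_w expR (- (c * Y w ^+ 2 / (2 * s ^+ 2))).
    apply: le_Rintegral => //; first exact: (integrableD measurableT i1 icY).
    move=> w _; have -> : - c / (2 * s ^+ 2) * Y w ^+ 2 = - (c * Y w ^+ 2 / (2 * s ^+ 2)) by ring.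
    exact: expR_ge1Dx.
  rewrite [X in _ <= X]/Rintegral normal_gauss_moment// RintegralD//.
  rewrite RintegralZl// Yv Rintegral_cst// mul1r.
  rewrite [X in fine X](_ : _ = 1%E); last exact: probability_setT.
  by rewrite /= mulNr mulNr mulrAC mulrA.
set z := v / (2 * s ^+ 2) in tangent.
have z0 : 0 <= z by rewrite divr_ge0 ?(ltW s20)// -Yv; apply: Rintegral_ge0 => w _; exact: sqr_ge0.
have quad (q : R) : 0 < q -> 0 <= (q - 1) * ((q + 1) * q * z - 1).
  move=> q0; have := tangent (q ^+ 2 - 1); rewrite addrC subrK sqrtr_sqr gtr0_norm// exprn_gt0// => /(_ isT).
  by rewrite -[q^-1]mul1r ler_pdivlMr//; lra.
suff z2 : z = 2^-1.
  have : v = z * (2 * s ^+ 2) by rewrite /z divfK// gt_eqF.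
  by rewrite z2 mulrA mulVf// mul1r.
have [zlt|zgt|//] := ltgtP z 2^-1.
- pose t := 2^-1 - z; have t0 : 0 < t by rewrite subr_gt0.
  have := quad (1 + t); rewrite pmulr_rge0; last by lra.
  rewrite subr_ge0 => /(_ ltac:(lra)); rewrite leNgt => /negP[].
  by rewrite /t in t0 *; nra.
- pose t := (2 * z - 1) / (6 * z).
  have z60 : 0 < 6 * z by lra.
  have t0 : 0 < t by rewrite divr_gt0//; lra.
  have t3 : t <= 3^-1 by rewrite /t ler_pdivrMr//; lra.
  have tz : t * z = (2 * z - 1) / 6 by rewrite /t; field; lra.
  have := quad (1 - t); rewrite nmulr_rge0; last by lra.
  rewrite subr_le0 => /(_ ltac:(lra)); rewrite leNgt => /negP[].
  have -> : (1 - t + 1) * (1 - t) * z = 2 * z - 3 * (t * z) + t * (t * z) by ring.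
  have tz0 : 0 <= t * (t * z) := mulr_ge0 (ltW t0) (mulr_ge0 (ltW t0) z0).
  by rewrite tz in tz0 *; lra.
Qed.

(** The Markov inequality for [expR ((1 - de) * Y ^+ 2 / (2 * s ^+ 2))], whose expectation
    is finite because [de] is positive. *)
Lemma normal_tail_upper (de y : R) : m = 0 -> 0 < de -> de <= 1 -> 0 <= y ->
  fine (P [set w | y < `|Y w|]) <= (Num.sqrt de)^-1 * expR (- ((1 - de) * y ^+ 2 / (2 * s ^+ 2))).
Proof.
move=> m0 de0 de1 y0; have s20 : 0 < 2 * s ^+ 2 by rewrite mulr_gt0// exprn_gt0.
have mA : measurable [set w | y < `|Y w|].
  by apply: measurable_set_gt; exact: (measurableT_comp (@normr_measurable R setT)).
have mom := normal_gauss_moment (- (1 - de)) m0; rewrite opprB addrC subrK in mom.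
have {}mom := mom de0.
have mexp : measurable_fun setT (fun w => expR (- ((de - 1) * Y w ^+ 2 / (2 * s ^+ 2)))).
  apply: (measurableT_comp (@measurable_expR R)).
  apply: (measurableT_comp (@oppr_measurable R setT)); apply: measurable_funM => //.
  by apply: measurable_funM => //; exact: measurable_funX.
set C := expR (- ((1 - de) * y ^+ 2 / (2 * s ^+ 2))).
set A := [set w | y < _] in mA *.
have PC : (P A <= (C * (Num.sqrt de)^-1)%:E)%E.
  have -> : ((C * (Num.sqrt de)^-1)%:E =
      \int[P]_w (C%:E * (expR (- ((de - 1) * Y w ^+ 2 / (2 * s ^+ 2))))%:E))%E.
    rewrite EFinM -mom -ge0_integralZl_EFin ?expR_ge0//; last exact/measurable_EFinP.
  have <- : (\int[P]_w (\1_A w)%:E = P A)%E by rewrite integral_indic// setIT.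
  apply: ge0_le_integral => //.
  - by apply/measurable_EFinP; exact: measurable_indic.
  - by apply: measurable_funeM; exact/measurable_EFinP.
  - move=> w _; rewrite -EFinM lee_fin indicE -expRD.
    have [/set_mem/= yY|_] := boolP (w \in _); last exact: expR_ge0.
    rewrite -[leLHS]expR0 ler_expR.
    have -> : - ((1 - de) * y ^+ 2 / (2 * s ^+ 2)) + - ((de - 1) * Y w ^+ 2 / (2 * s ^+ 2)) =
      (1 - de) / (2 * s ^+ 2) * (Y w ^+ 2 - y ^+ 2) by ring.
    rewrite mulr_ge0 ?divr_ge0 ?subr_ge0 ?(ltW s20)// -[Y w ^+ 2]real_normK ?num_real//.
    by rewrite ler_pXn2r ?nnegrE// ltW.
by rewrite mulrC -lee_fin fineK// fin_num_measure.
Qed.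

(** The density decreases, so the interval from [y] to [y + s] has mass at least [s]
    times the density at its right end. *)
Lemma normal_tail_lower (y : R) : m = 0 -> 0 <= y ->
  (Num.sqrt (pi *+ 2))^-1 * expR (- ((y / s + 1) ^+ 2 / 2)) <= fine (P [set w | y < `|Y w|]).
Proof.
move=> m0 y0.
have mA : measurable [set w | y < `|Y w|].
  by apply: measurable_set_gt; exact: (measurableT_comp (@normr_measurable R setT)).
pose I : set (measurableTypeR R) := `]y, y + s]%classic.
have mI : measurable I by exact: measurable_itv.
have mYI : measurable (Y @^-1` I) by rewrite -[X in measurable X]setTI; exact: mY.
rewrite -lee_fin fineK ?fin_num_measure//.
apply: (@le_trans _ _ (P (Y @^-1` I))); last first.
  apply: le_measure; rewrite ?inE// => w /=; rewrite /I/= in_itv/= => /andP[yY _].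
  by apply: (lt_le_trans yY); exact: ler_norm.
rewrite lawY// /normal_prob.
have -> : (Num.sqrt (pi *+ 2))^-1 * expR (- ((y / s + 1) ^+ 2 / 2)) = s * normal_pdf 0 s (y + s).
  rewrite normal_pdfE// /normal_peak /normal_fun mulrA.
  rewrite -mulrnAr sqrtrM ?sqr_ge0// sqrtr_sqr gtr0_norm// invfM mulrA mulfV// mul1r.
  congr (_ * expR _); rewrite subr0 -mulr_natl; field; exact: sn.
have -> : ((s * normal_pdf 0 s (y + s))%:E = \int[mu]_(x in I) cst (normal_pdf 0 s (y + s))%:E x)%E.
  have muI : mu I = s%:E.
    by rewrite /I lebesgue_measure_itv/= lte_fin ltrDl s0 -EFinB addrAC subrr add0r.
  rewrite integral_cst// EFinM muleC; congr (_ * _)%E; exact: esym muI.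
apply: ge0_le_integral => //.
- by move=> x _; rewrite lee_fin normal_pdf_ge0.
- by apply/measurable_EFinP; apply: measurable_funTS; exact: measurable_normal_pdf.
- move=> x; rewrite /I/= in_itv/= => /andP[x1 x2]; rewrite lee_fin m0 !normal_pdfE// /normal_fun.
  apply: ler_wpM2l; first exact: normal_peak_ge0.
  rewrite ler_expR !subr0 !mulNr lerN2 ler_wpM2r ?invr_ge0 ?mulrn_wge0 ?sqr_ge0//.
  by rewrite ler_pXn2r ?nnegrE// (le_trans y0)// ltW// (lt_le_trans x1).
Qed.

End gaussian_variable.

(** * Increments of fractional Brownian motion *)

Section fbm_increments.
Context {d : measure_display} {T : measurableType d} {R : realType}.
Variables (P : probability T R) (H : R) (W : R -> {RV P >-> R}).
Hypotheses (H0 : 0 < H) (W_fbm : is_fbm H W).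

Let H2 : 2 * H != 0. Proof. by rewrite gt_eqF// mulr_gt0. Qed.

Let covE s t : \int[P]_w (W s w * W t w) =
  2^-1 * (`|s| `^ (2 * H) + `|t| `^ (2 * H) - `|s - t| `^ (2 * H)).
Proof. by rewrite /Rintegral; have := fbm_covariance W_fbm s t; rewrite unlock => ->. Qed.

Let sqE t : (\int[P]_w (W t w ^+ 2)%:E = (`|t| `^ (2 * H))%:E)%E.
Proof.
have := fbm_covariance W_fbm t t; rewrite unlock subrr normr0 powR0// subr0 => E.
transitivity (\int[P]_w (W t w * W t w)%:E)%E; first by apply: eq_integral => w _; rewrite expr2.
by rewrite E; congr (_%:E); field.
Qed.

Let isq t : P.-integrable setT (EFin \o (fun w => W t w ^+ 2)).
Proof.
apply/integrableP; split; first by apply/measurable_EFinP; exact: measurable_funX.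
under eq_integral => w _ do rewrite /= ger0_norm ?sqr_ge0//.
by rewrite sqE ltry.
Qed.

Let iprod s t : P.-integrable setT (EFin \o (fun w => W s w * W t w)).
Proof.
apply: (le_integrable measurableT _ _ (integrableD measurableT (isq s) (isq t))).
  by apply/measurable_EFinP; exact: measurable_funM.
move=> w _; rewrite /= lee_fin normrM [leRHS]ger0_norm ?addr_ge0 ?sqr_ge0//.
rewrite -[W s w ^+ 2]real_normK ?num_real// -[W t w ^+ 2]real_normK ?num_real//.
have := sqr_ge0 (`|W s w| - `|W t w|); have := mulr_ge0 (normr_ge0 (W s w)) (normr_ge0 (W t w)).
nra.
Qed.

Let iW t : P.-integrable setT (EFin \o (W t : T -> R)).
Proof.
have i1 : P.-integrable setT (EFin \o cst (1 : R)) by exact: finite_measure_integrable_cst.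
apply: (le_integrable measurableT _ _ (integrableD measurableT i1 (isq t))).
  exact/measurable_EFinP.
move=> w _; rewrite /= lee_fin [leRHS]ger0_norm ?addr_ge0 ?sqr_ge0//.
by rewrite -[W t w ^+ 2]real_normK ?num_real//; have := sqr_ge0 (`|W t w| - 1); nra.
Qed.

Variables (u v : R).
Hypothesis uv : u != v.

Let sigma := `|u - v| `^ H.

Lemma fbm_scale_gt0 : 0 < sigma. Proof. by rewrite powR_gt0// normr_gt0 subr_eq0. Qed.

Let sigma2 : sigma ^+ 2 = `|u - v| `^ (2 * H).
Proof. by rewrite /sigma -powR_mulrn ?powR_ge0// -powRrM mulrC. Qed.

Let Y w := W u w - W v w.

Let mY : measurable_fun setT Y. Proof. exact: measurable_funB. Qed.

Let iY : P.-integrable setT (EFin \o Y).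
Proof.
rewrite (_ : EFin \o Y = (EFin \o (W u : T -> R)) \- (EFin \o (W v : T -> R)))%E.
  exact: integrableB.
by apply/funext => w; rewrite /= EFinB.
Qed.

Let Y0 : \int[P]_w Y w = 0.
Proof.
have E t : \int[P]_w W t w = 0.
  by rewrite /Rintegral; have := fbm_centered W_fbm t; rewrite unlock => ->.
by rewrite RintegralB// !E subrr.
Qed.

Let iY2 : P.-integrable setT (EFin \o (fun w => Y w ^+ 2)).
Proof.
have i2 := integrableZl measurableT 2 (integrableD measurableT (isq u) (isq v)).
apply: (le_integrable measurableT _ _ i2).
  by apply/measurable_EFinP; exact: measurable_funX.
move=> w _; rewrite /= lee_fin [leLHS]ger0_norm ?sqr_ge0// [leRHS]ger0_norm; last first.
  by apply: mulr_ge0 => //; apply: addr_ge0; exact: sqr_ge0.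
by rewrite /Y; have := sqr_ge0 (W u w + W v w); nra.
Qed.

Let Y2 : \int[P]_w (Y w ^+ 2) = sigma ^+ 2.
Proof.
have iuv := integrableZl measurableT 2 (iprod u v).
have iu_v := integrableB measurableT (iprod u u) iuv.
transitivity (\int[P]_w (W u w * W u w - 2 * (W u w * W v w) + W v w * W v w)).
  by apply: eq_Rintegral => w _; rewrite /Y; ring.
rewrite RintegralD// RintegralB// RintegralZl// !covE sigma2 !subrr normr0 powR0//.
by field.
Qed.

(** The increment has some Gaussian law; the covariance identifies its parameters and
    excludes the degenerate case. *)
Lemma fbm_increment_law (A : set R) : measurable A -> P (Y @^-1` A) = normal_prob 0 sigma A.
Proof.
move=> mA.
have [m [s [s0 law]]] : gaussian P Y.
  have := fbm_gaussian W_fbm (fun i : 'I_2 => if i == ord0 then u else v)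
    (fun i : 'I_2 => if i == ord0 then 1 else -1).
  by congr gaussian; apply/funext => w; rewrite big_ord_recl big_ord1 /= mul1r mulN1r.
have [sz|sn0] := eqVneq s 0.
  have aeY : {ae P, forall w, Y w = m}.
    exists (Y @^-1` (~` [set m])); split.
    - by have := mY measurableT _ (measurableC (measurable_set1 m)); rewrite setTI.
    - rewrite law; last by apply: measurableC; exact: measurable_set1.
      by rewrite sz eqxx /dirac indicE memNset//= => /(_ erefl).
    - by [].
  have const (f : R -> R) : measurable_fun setT f -> \int[P]_w f (Y w) = f m.
    move=> mf; transitivity (\int[P]_w cst (f m) w).
      rewrite /Rintegral; congr fine; apply: ae_eq_integral => //.
      - by apply/measurable_EFinP; exact: (measurableT_comp mf mY).
      - by apply/measurable_EFinP; exact: measurable_cst.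
      - by apply: filterS aeY => w -> _.
    rewrite Rintegral_cst// [X in fine X](_ : _ = 1%E) ?mulr1//; exact: probability_setT.
  have m0 : m = 0 by rewrite -Y0 (const id).
  have := Y2; rewrite (const (fun x => x ^+ 2)); last exact: measurable_funX.
  by rewrite m0 expr0n/= => /esym/eqP; rewrite sqrf_eq0 gt_eqF// fbm_scale_gt0.
have s_gt0 : 0 < s by rewrite lt_neqAle eq_sym sn0.
have lawN (B : set R) : measurable B -> P (Y @^-1` B) = normal_prob m s B.
  by move=> mB; rewrite law// (negbTE sn0).
have m0 := normal_mean P Y m s mY s_gt0 lawN iY Y0.
have vE := normal_variance P Y m s mY s_gt0 lawN _ m0 iY2 Y2.
have -> : sigma = s.
  by apply/eqP; rewrite -(eqrXn2 (n := 2))// ?(ltW fbm_scale_gt0) ?(ltW s_gt0)// vE.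
by have := lawN A mA; rewrite m0.
Qed.

Lemma fbm_tail_upper (de y : R) : 0 < de -> de <= 1 -> 0 <= y ->
  fine (P [set w | y < `|W u w - W v w|]) <=
  (Num.sqrt de)^-1 * expR (- ((1 - de) * y ^+ 2 / (2 * `|u - v| `^ (2 * H)))).
Proof.
move=> de0 de1 y0; rewrite -sigma2.
exact: (normal_tail_upper P Y 0 sigma mY fbm_scale_gt0 fbm_increment_law de y erefl de0 de1 y0).
Qed.

Lemma fbm_tail_lower (y : R) : 0 <= y ->
  (Num.sqrt (pi *+ 2))^-1 * expR (- ((y / `|u - v| `^ H + 1) ^+ 2 / 2)) <=
  fine (P [set w | y < `|W u w - W v w|]).
Proof.
exact: (normal_tail_lower P Y 0 sigma mY fbm_scale_gt0 fbm_increment_law y erefl).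
Qed.

End fbm_increments.

(** * Conditioning on the local time *)

Section path_sigma_algebra.
Context {d : measure_display} {T : measurableType d} {R : realType}.

(** The sample space with the sigma-algebra generated by the process on [D]. *)
Definition path_type (D : set R) (Y : R -> T -> R) :=
  g_sigma_algebraType (\bigcup_(t in D) g_sigma_algebra_preimage (Y t)).

Definition to_path (D : set R) (Y : R -> T -> R) (w : T) : path_type D Y := w.

Lemma measurable_path (D : set R) (Y : R -> T -> R) (t : R) : D t ->
  measurable_fun setT (Y t : path_type D Y -> R).
Proof.
move=> Dt _ B mB; rewrite setTI; apply: sub_sigma_algebra; exists t => //.
by exists B => //; rewrite setTI.
Qed.

Lemma measurable_to_path (D : set R) (Y : R -> T -> R) : (forall t, measurable_fun setT (Y t)) ->
  measurable_fun setT (to_path D Y).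
Proof.
move=> mY; apply: (@measurability _ _ _ (path_type D Y) setT (to_path D Y)
  (\bigcup_(t in D) g_sigma_algebra_preimage (Y t))) => //.
move=> _ [E [t Dt [B mB <-]] <-]; rewrite !setTI.
by have := mY t measurableT B mB; rewrite setTI.
Qed.

End path_sigma_algebra.

Section time_change.
Context {d1 d2 : measure_display} {T1 : measurableType d1} {T2 : measurableType d2} {R : realType}.
Variables (S : T1 -> R) (W : R -> T2 -> R).
Hypotheses (mS : measurable_fun setT S) (mW : forall t, measurable_fun setT (W t)).
Hypothesis cW : forall v, continuous (W ^~ v).

Let level (n : nat) (s : R) : nat := Num.truncn (Num.max 0 (n.+1%:R * (s + n.+1%:R))).

Let point (n k : nat) : R := k%:R / n.+1%:R - n.+1%:R.

Let point_cvg (s : R) : point n (level n s) @[n --> \oo] --> s.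
Proof.
apply/cvgrPdist_le => e e0.
have [n0 n0P] := exists_nat_ge (`|s| + e^-1).
exists n0 => // n /= nn; have [_ hn] := n0P n.+1 (leqW nn).
have ei : 0 < e^-1 by rewrite invr_gt0.
have n_gt0 : 0 < n.+1%:R :> R by [].
have sn0 : 0 <= s + n.+1%:R by have := ler_norm (- s); rewrite normrN; lra.
have p0 : 0 <= n.+1%:R * (s + n.+1%:R) by rewrite mulr_ge0.
rewrite /level /point (max_idPr p0); have /andP[k1 k2] := truncn_itv p0.
set k := Num.truncn _ in k1 k2 *.
have inv : n.+1%:R^-1 <= e.
  by rewrite -[leRHS]invrK lef_pV2 ?posrE//; have := normr_ge0 s; lra.
have E : s - (k%:R / n.+1%:R - n.+1%:R) = (n.+1%:R * (s + n.+1%:R) - k%:R) / n.+1%:R.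
  by field; rewrite gt_eqF.
rewrite E ger0_norm ?divr_ge0 ?subr_ge0//; apply: le_trans inv.
rewrite -[leRHS]mul1r ler_pM2r ?invr_gt0// lerBlDl natr1.
exact: ltW.
Qed.

(** Continuity of the paths allows the random time to be rounded to a countable grid. *)
Lemma measurable_time_change :
  measurable_fun setT (fun z : T1 * T2 => W (S z.1) z.2).
Proof.
apply: (measurable_fun_cvg (h := fun n z => W (point n (level n (S z.1))) z.2)); last first.
  by move=> z _; apply: (@continuous_cvg _ _ _ _ _ _ (W ^~ z.2)); [exact: cW|exact: point_cvg].
move=> n _ B mB; rewrite setTI.
have -> : (fun z : T1 * T2 => W (point n (level n (S z.1))) z.2) @^-1` B =
  \bigcup_k ([set z : T1 * T2 | level n (S z.1) = k] `&` (fun z => W (point n k) z.2) @^-1` B).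
  apply/seteqP; split => z /=; first by move=> Bz; exists (level n (S z.1)).
  by move=> [k _ [/= -> //]].
apply: bigcupT_measurable => k; apply: measurableI; last first.
  have mWk : measurable_fun setT (fun z : T1 * T2 => W (point n k) z.2).
    exact: (measurableT_comp (mW _) measurable_snd).
  by have := mWk measurableT B mB; rewrite setTI.
have mL : measurable_fun setT (fun z : T1 * T2 => Num.max 0 (n.+1%:R * (S z.1 + n.+1%:R))).
  apply: measurable_maxr => //; apply: measurable_funM => //; apply: measurable_funD => //.
  exact: (measurableT_comp mS measurable_fst).
have := mL measurableT _ (measurable_itv `[k%:R, k.+1%:R[); rewrite setTI.
congr measurable; apply/seteqP; split => z /=; rewrite in_itv/= /level.
  have m0 : 0 <= Num.max 0 (n.+1%:R * (S z.1 + n.+1%:R)) by rewrite le_max lexx.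
  by move=> h; apply/eqP; rewrite truncn_eq.
have m0 : 0 <= Num.max 0 (n.+1%:R * (S z.1 + n.+1%:R)) by rewrite le_max lexx.
by move=> /eqP; rewrite truncn_eq.
Qed.

End time_change.

Section local_time_version.
Context {d : measure_display} {T : measurableType d} {R : realType}.
Variables (P : probability T R) (X : R -> {RV P >-> R}) (L : R -> R -> {RV P >-> R}).
Hypotheses (X_levy : is_levy X) (L_local_time : is_local_time X L).
Notation mu := (@lebesgue_measure R).

Let Xpath := path_type [set t | 0 <= t] (fun t => X t : T -> R).

(** Independence concerns the sigma-algebra generated by [X], with respect to which [L]
    is measurable up to null sets only.  This version is built from [X] and is exactly
    measurable. *)
Definition local_time_version (t : R) (w : T) : R :=
  upper_limit (fun m => upper_limit (riemann_sum P X 0 t m.+1%:R^-1)) w.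

Lemma measurable_local_time_version (t : R) : 0 <= t ->
  measurable_fun setT (local_time_version t : Xpath -> R).
Proof.
move=> t0; apply: measurable_upper_limit => m; apply: measurable_upper_limit => n.
apply: measurable_funM; first exact: measurable_cst.
apply: measurable_sum => i; apply: (measurableT_comp (measurable_tent _)).
apply: measurable_path; rewrite /= add0r mulr_ge0// /mesh subr0.
by rewrite divr_ge0.
Qed.

Lemma local_time_versionE (t : R) : 0 <= t -> {ae P, forall w, local_time_version t w = L 0 t w}.
Proof.
move=> t0; apply: filterS (good_path_ae P X L X_levy L_local_time) => w gw.
have L00 : L 0 0 w = 0.
  have h (eta : R) : 0 < eta -> `|L 0 0 w| <= eta.
    move=> eta0; have cl := continuous_local_time P X L w 0 gw (lexx _).
    have /cvgrPdist_le/(_ _ eta0)/nbhs_ballP[e0 /= e00 he] := cl 0.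
    have e20 : 0 < e0 / 2 by rewrite divr_gt0.
    case: (gw) => _ rc dens _.
    have le_eta x : `|x| <= e0 / 2 -> `|L x 0 w - L 0 0 w| <= eta.
      by move=> xe; rewrite distrC; apply: he; rewrite /ball/= sub0r normrN; lra.
    have := occupation_bounds (fun s => X s w) (fun x => L x 0 w) 0 (lexx _) rc cl
      (dens 0 (lexx _)) (e0 / 2) e20 eta eta0 le_eta.
    rewrite set_itvoc0 integral_set0 !lee_fin ler_norml; lra.
  apply/eqP; rewrite -normr_eq0 eq_le normr_ge0 andbT; apply/ler_addgt0Pr => e e0.
  by rewrite add0r; exact: h.
move: t0; rewrite le_eqVlt => /predU1P[<-|t0].
  rewrite L00 /local_time_version.
  have cst0 (f_ : nat -> T -> R) : (forall n, f_ n w = 0) -> upper_limit f_ w = 0.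
    move=> f0; apply: cvg_upper_limit; rewrite (_ : (fun n => f_ n w) = cst 0); first exact: cvg_cst.
    exact/funext.
  apply: (cst0) => m; apply: (cst0) => n.
  by rewrite /riemann_sum /mesh subrr !mul0r.
apply: cvg_upper_limit; apply/cvgrPdist_le => eta eta0.
have [e0 e00 he] := occupation_cvg P X L 0 t w eta (lexx _) t0 gw eta0.
have [n0 n0P] := exists_nat_ge e0^-1.
exists n0 => // m /= nm.
have m0 : 0 < m.+1%:R^-1 :> R by rewrite invr_gt0.
have cv := riemann_sum_cvg P X L 0 t _ w (lexx _) t0 m0 gw.
rewrite (cvg_upper_limit _ _ _ cv) distrC.
have := he m.+1%:R^-1 m0; rewrite L00 subr0; apply.
have [_ me] := n0P m.+1 (leqW nm).
by rewrite -[leRHS]invrK lef_pV2 ?posrE ?invr_gt0.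
Qed.

End local_time_version.

Section conditioning_on_local_time.
Context {d : measure_display} {T : measurableType d} {R : realType}.
Variables (P : probability T R) (H : R).
Variables (W X : R -> {RV P >-> R}) (L : R -> R -> {RV P >-> R}).
Hypotheses (W_fbm : is_fbm H W) (X_levy : is_levy X) (L_local_time : is_local_time X L).
Hypothesis WX_indep : independent_processes P [set: R] [set t | 0 <= t] W X.

Let V t := local_time_version P X t.

Let Xpath := path_type [set t | 0 <= t] (fun t => X t : T -> R).
Let Wpath := path_type [set: R] (fun t => W t : T -> R).

Let gap (a b : R) (z : Xpath * Wpath) : R := `|W (V b z.1) z.2 - W (V a z.1) z.2|.

Let mgap a b : 0 <= a -> 0 <= b -> measurable_fun setT (gap a b).
Proof.
move=> a0 b0; apply: (measurableT_comp (@normr_measurable R setT)).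
have mt t (t0 : 0 <= t) : measurable_fun setT (fun z : Xpath * Wpath => W (V t z.1) z.2) :=
  measurable_time_change (V t : Xpath -> R) (fun s => W s : Wpath -> R)
    (measurable_local_time_version P X t t0) (fun s => measurable_path setT (fun u => W u : T -> R) s Logic.I)
    (fbm_continuous W_fbm).
by apply: measurable_funB; exact: mt.
Qed.

(** By independence the times may be frozen while the tail of the Gaussian increment
    is computed. *)
Lemma time_changed_tail (a b x : R) : 0 <= a -> 0 <= b ->
  P [set w | x < `|local_time_fbm W L b w - local_time_fbm W L a w|] =
  (\int[P]_w P [set v | (x < `|W (V b w) v - W (V a w) v|)%R])%E.
Proof.
move=> a0 b0.
have mXp : measurable_fun setT (to_path [set t | 0 <= t] (fun t => X t : T -> R)).
  by apply: measurable_to_path => t.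
have mWp : measurable_fun setT (to_path [set: R] (fun t => W t : T -> R)).
  by apply: measurable_to_path => t.
have mZt t : measurable_fun setT (fun w => local_time_fbm W L t w).
  have mpair : measurable_fun setT (fun w : T => (w, w)) by exact: measurable_fun_pair.
  have mt := measurable_time_change (L 0 t) (fun s => W s : T -> R)
    (measurable_funPT (L 0 t)) (fun s => measurable_funPT (W s)) (fbm_continuous W_fbm).
  exact: (measurableT_comp mt mpair).
pose A := [set w | (x < `|local_time_fbm W L b w - local_time_fbm W L a w|)%R].
have mA : measurable A.
  apply: measurable_set_gt; apply: (measurableT_comp (@normr_measurable R setT)).
  exact: measurable_funB.
pose G : set (Xpath * Wpath) := [set z | (x < gap a b z)%R].
have mG : measurable G by apply: measurable_set_gt; exact: mgap.
pose f (z : Xpath * Wpath) : \bar R := (\1_G z)%:E.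
have mf : measurable_fun setT f by apply/measurable_EFinP; exact: measurable_indic.
have f0 z : (0 <= f z)%E by rewrite lee_fin indicE; case: (_ \in _).
have indep (B : set Xpath) (C : set Wpath) : measurable B -> measurable C ->
    P (to_path [set t | 0 <= t] (fun t => X t : T -> R) @^-1` B `&`
       to_path [set: R] (fun t => W t : T -> R) @^-1` C) = (P B * P C)%E.
  by move=> mB mC; rewrite setIC muleC; exact: (WX_indep C B mC mB).
have key := integral_independent_pair P _ _ mXp mWp indep f mf f0.
transitivity (\int[P]_w f (w, w))%E.
  have <- : (\int[P]_w (\1_A w)%:E = P A)%E by rewrite integral_indic// setIT.
  apply: ae_eq_integral => //.
  - by apply/measurable_EFinP; exact: measurable_indic.
  - by apply: (measurableT_comp mf); exact: measurable_fun_pair mXp mWp.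
  - have Va := local_time_versionE P X L X_levy L_local_time a a0.
    have Vb := local_time_versionE P X L X_levy L_local_time b b0.
    near=> w => _; rewrite /f !indicE; congr (_%:E); congr (nat_of_bool _)%:R.
    have -> // : (w \in A) = ((w, w) \in G).
    have va : V a w = L 0 a w by near: w; exact: Va.
    have vb : V b w = L 0 b w by near: w; exact: Vb.
    by apply/idP/idP => /set_mem h; apply/mem_set; move: h; rewrite /A /G /gap /= /local_time_fbm va vb.
transitivity (\int[P]_w \int[P]_v f (w, v))%E; first exact: key.
apply: eq_integral => w _; rewrite /f.
have mGw : measurable (xsection G w : set Wpath) by exact: measurable_xsection.
have mGw' : measurable [set v : T | x < `|W (V b w) v - W (V a w) v|].
  by apply: measurable_set_gt; apply: (measurableT_comp (@normr_measurable R setT)); exact: measurable_funB.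
rewrite -[RHS](_ : (\int[P]_v (\1_([set v : T | x < `|W (V b w) v - W (V a w) v|]%R) v)%:E)%E = _); last first.
  by rewrite integral_indic// setIT.
by apply: eq_integral => v _; rewrite !indicE; congr ((nat_of_bool _)%:R%:E); apply/idP/idP => /set_mem h; apply/mem_set.
Unshelve. all: by end_near. Qed.

Lemma measurable_conditional_tail (a b x : R) : 0 <= a -> 0 <= b ->
  measurable_fun setT (fun w : T => P [set v | x < `|W (V b w) v - W (V a w) v|]).
Proof.
move=> a0 b0.
have mXp : measurable_fun setT (to_path [set t | 0 <= t] (fun t => X t : T -> R)).
  by apply: measurable_to_path => t.
have mV t (t0 : 0 <= t) : measurable_fun setT (V t).
  exact: (measurableT_comp (measurable_local_time_version P X t t0) mXp).
have mt t (t0 : 0 <= t) : measurable_fun setT (fun z : T * T => W (V t z.1) z.2) :=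
  measurable_time_change (V t) (fun s => W s : T -> R) (mV t t0)
    (fun s => measurable_funPT (W s)) (fbm_continuous W_fbm).
pose G : set (T * T) := [set z | (x < `|W (V b z.1) z.2 - W (V a z.1) z.2|)%R].
have mG : measurable G.
  apply: measurable_set_gt; apply: (measurableT_comp (@normr_measurable R setT)).
  by apply: measurable_funB; exact: mt.
have := measurable_fun_xsection P mG; congr measurable_fun; apply/funext => w /=.
by congr (P _); apply/seteqP; split => v; rewrite /xsection/= inE.
Qed.

End conditioning_on_local_time.

(** * The saddle point *)

Section saddle_point.
Context {R : realType}.
Variables (alpha H A t : R).
Hypotheses (alpha1 : 1 < alpha) (H0 : 0 < H) (A0 : 0 < A) (t0 : 0 < t).

Let theta := 1 - alpha^-1.
Let rho := theta^-1.
Let kappa := A `^ rho * t.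

Let alpha0 : 0 < alpha. Proof. exact: lt_trans ltr01 alpha1. Qed.
Let theta0 : 0 < theta. Proof. by rewrite subr_gt0 invf_lt1. Qed.
Let am1 : alpha - 1 != 0. Proof. by rewrite gt_eqF// subr_gt0. Qed.
Let aH0 : 0 < alpha + 2 * H. Proof. by rewrite addr_gt0// mulr_gt0. Qed.

(* logarithms turn the identities between powers into linear relations *)
Let lk := rho * ln A + ln t - ln theta.

Let lv := (ln H + (alpha - 1) * lk) / (alpha + 2 * H).

(** Twice the Gaussian exponent at the saddle, in units of [x `^ rate_exponent]. *)
Definition saddle_energy : R := expR (- (2 * H * lv)).

Definition rate_exponent : R := 2 * alpha / (alpha + 2 * H).

(** The value of the local time increment that is optimal for a displacement [x]. *)
Definition saddle_time (x : R) : R := expR lv * (x `^ rate_exponent) `^ alpha^-1.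

(** Minus the derivative in [u] of [x ^+ 2 / (2 * u `^ (2 * H))] at the saddle; by
    [saddle_tilt_time] also the tilt under which the local time concentrates there. *)
Definition saddle_tilt (x : R) : R := x `^ rate_exponent * H * saddle_energy / saddle_time x.

Let powRE (x a : R) : 0 < x -> x `^ a = expR (a * ln x).
Proof. by move=> x0; rewrite /powR gt_eqF. Qed.

Let expRK' (x : R) : 0 < x -> x = expR (ln x).
Proof. by move=> x0; rewrite lnK// posrE. Qed.

Let timeE x : 0 < x -> saddle_time x = expR (lv + rate_exponent * ln x / alpha).
Proof. by move=> x0; rewrite /saddle_time (powRE x _ x0) -expRM -expRD. Qed.

Lemma saddle_time_gt0 x : 0 < x -> 0 < saddle_time x.
Proof. by move=> x0; rewrite timeE// expR_gt0. Qed.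

Let tiltE x : 0 < x -> saddle_tilt x =
  expR (rate_exponent * ln x + ln H - 2 * H * lv - (lv + rate_exponent * ln x / alpha)).
Proof.
move=> x0; rewrite /saddle_tilt timeE// (powRE x _ x0) {1}(expRK' H H0) /saddle_energy -!expRD -expRN.
by rewrite -expRD.
Qed.

Lemma saddle_tilt_gt0 x : 0 < x -> 0 < saddle_tilt x.
Proof. by move=> x0; rewrite tiltE// expR_gt0. Qed.

Lemma saddle_gaussian x : 0 < x ->
  x ^+ 2 / saddle_time x `^ (2 * H) = x `^ rate_exponent * saddle_energy.
Proof.
move=> x0; rewrite timeE// -expRM (powRE x _ x0) /saddle_energy.
rewrite {1}(expRK' x x0) -expRM_natl -expRN -!expRD; congr expR.
by rewrite /rate_exponent; field; rewrite !gt_eqF.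
Qed.

Let kapparho : kappa * rho = expR lk.
Proof.
by rewrite /kappa (powRE A _ A0) /lk expRD expRD expRN !lnK ?posrE.
Qed.

Lemma saddle_tilt_time x : 0 < x -> kappa * rho * saddle_tilt x `^ (rho - 1) = saddle_time x.
Proof.
move=> x0; rewrite kapparho tiltE// timeE// -expRM -expRD; congr expR.
have rE : rho - 1 = (alpha - 1)^-1.
  by rewrite /rho /theta; field; rewrite am1 gt_eqF.
have -> : lk = ((alpha + 2 * H) * lv - ln H) / (alpha - 1).
  by rewrite /lv; field; rewrite !gt_eqF ?subr_gt0.
rewrite rE; field; rewrite !gt_eqF ?subr_gt0//.
Qed.

Lemma saddle_moment x : 0 < x ->
  kappa * saddle_tilt x `^ rho = x `^ rate_exponent * (H * saddle_energy / rho).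
Proof.
move=> x0; have g0 := saddle_tilt_gt0 x x0; have u0 := saddle_time_gt0 x x0.
have r0 : 0 < rho by rewrite invr_gt0.
have -> : kappa * saddle_tilt x `^ rho = (kappa * rho * saddle_tilt x `^ (rho - 1)) * saddle_tilt x / rho.
  have -> : saddle_tilt x `^ rho = saddle_tilt x `^ (rho - 1) * saddle_tilt x.
    by rewrite -{3}(powRr1 (ltW g0)) -powRD ?(gt_eqF g0) ?implybT// subrK.
  by field; rewrite gt_eqF.
rewrite saddle_tilt_time// /saddle_tilt; field; rewrite !gt_eqF//.
Qed.

Lemma saddle_rateE (nu chi a b : R) : A = A1 alpha nu chi -> t = b - a ->
  B2 H alpha nu chi a b = (alpha + 2 * H) / (2 * alpha) * saddle_energy.
Proof.
move=> AE tE; rewrite /B2 -AE -tE -mulrA; congr (_ * _).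
have p1 : 0 < A `^ alpha by rewrite powR_gt0.
have p2 : 0 < theta `^ (alpha - 1) by rewrite powR_gt0.
have p3 : 0 < H * A `^ alpha / theta `^ (alpha - 1) by rewrite divr_gt0// mulr_gt0.
rewrite (powRE _ _ p3) (powRE t _ t0) -expRD /saddle_energy; congr expR.
rewrite ln_div ?posrE ?mulr_gt0// lnM ?posrE// !ln_powR /lv /lk.
have -> : rho = alpha / (alpha - 1).
  by rewrite /rho /theta; field; rewrite !gt_eqF ?subr_gt0.
by rewrite -/theta; field; rewrite !gt_eqF ?subr_gt0.
Qed.

(** The saddle is a critical point of a convex function of [u]: after scaling,
    [w `^ (- (2 * H))] lies above its tangent at [w = 1]. *)
Lemma saddle_minimum (x u : R) : 0 < x -> 0 < u ->
  x `^ rate_exponent * saddle_energy * (2^-1 + H) <= x ^+ 2 / (2 * u `^ (2 * H)) + saddle_tilt x * u.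
Proof.
move=> x0 u0; have s0 := saddle_time_gt0 x x0.
pose w := u / saddle_time x; have w0 : 0 < w by rewrite divr_gt0.
have uE : u = saddle_time x * w by rewrite /w mulrC divfK// gt_eqF.
have N0 : 0 < x `^ rate_exponent * saddle_energy by rewrite mulr_gt0 ?powR_gt0 ?expR_gt0.
have pw : 0 < saddle_time x `^ (2 * H) by rewrite powR_gt0.
have pw2 : 0 < w `^ (2 * H) by rewrite powR_gt0.
have -> : x ^+ 2 / (2 * u `^ (2 * H)) + saddle_tilt x * u =
  x `^ rate_exponent * saddle_energy * (w `^ (- (2 * H)) / 2 + H * w).
  rewrite {1}uE (powRM _ (ltW s0) (ltW w0)) powRN.
  have -> : x ^+ 2 / (2 * (saddle_time x `^ (2 * H) * w `^ (2 * H))) =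
    (x ^+ 2 / saddle_time x `^ (2 * H)) * (w `^ (2 * H))^-1 / 2 by field; rewrite !gt_eqF.
  rewrite saddle_gaussian// /saddle_tilt uE; field; rewrite !gt_eqF//.
apply: ler_wpM2l; first exact: ltW.
have lw : ln w <= w - 1.
  by rewrite -ler_expR lnK ?posrE//; have := expR_ge1Dx (w - 1); rewrite addrC subrK.
have : 1 - 2 * H * (w - 1) <= w `^ (- (2 * H)).
  rewrite (powRE w _ w0); apply: le_trans (expR_ge1Dx _); rewrite lerD2l mulNr lerN2.
  by apply: ler_wpM2l => //; rewrite mulr_ge0 ?(ltW H0).
lra.
Qed.

End saddle_point.

(** * Tail asymptotics *)

Section elementary_bounds.
Context {R : realType}.

Lemma mulr_le_half (de e C : R) : 0 < C -> de <= e / (2 * C) -> de * C <= e / 2.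
Proof.
move=> C0; rewrite ler_pdivlMr ?mulr_gt0// => h; rewrite ler_pdivlMr//.
by have -> : de * C * 2 = de * (2 * C) by ring.
Qed.

Lemma le_mulr_half (k e n : R) : 0 < e -> 2 * k / e <= n -> k <= n * (e / 2).
Proof.
move=> e0; rewrite ler_pdivrMr// => h; rewrite mulrA ler_pdivlMr//.
by rewrite mulrC.
Qed.

Lemma powR_inv_bound (H eta : R) : 0 < H -> H < 1 -> 0 < eta -> eta <= 4^-1 ->
  ((1 - eta) `^ (2 * H))^-1 <= 1 + 5 * eta.
Proof.
move=> H0 H1 eta0 eta1; have d0 : 0 < 1 - eta by lra.
have d1 : 1 - eta <= 1 by rewrite gerBl ltW.
have p0 : 0 < (1 - eta) ^+ 2 by rewrite exprn_gt0.
apply: (@le_trans _ _ ((1 - eta) ^+ 2)^-1).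
  rewrite lef_pV2 ?posrE ?powR_gt0// -powR_mulrn ?(ltW d0)//.
  by apply: ger_powR; [rewrite d0 d1|lra].
by rewrite invf_ple ?posrE//; [|nra]; rewrite -div1r ler_pdivrMr; nra.
Qed.

Lemma young_coefficient_bound (eta : R) : 0 < eta -> eta <= 4^-1 ->
  (1 + eta) * (1 + 5 * eta) / 2 <= 2^-1 + 4 * eta.
Proof. by move=> eta0 eta1; nra. Qed.

Lemma distN_le (r y e : R) : y <= - (r - e) -> - (r + e) <= y -> `|- r - y| <= e.
Proof. by move=> h1 h2; rewrite ler_norml; lra. Qed.

End elementary_bounds.

Section tail_asymptotics.
Context {d : measure_display} {T : measurableType d} {R : realType}.
Variables (P : probability T R) (H alpha nu chi : R).
Variables (W X : R -> {RV P >-> R}) (L : R -> R -> {RV P >-> R}).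
Hypotheses (H0 : 0 < H) (H1 : H < 1) (alpha1 : 1 < alpha) (chi0 : 0 < chi).
Hypotheses (W_fbm : is_fbm H W) (X_stable : is_stable_levy alpha nu chi X).
Hypothesis WX_indep : independent_processes P [set: R] [set t | 0 <= t] W X.
Hypothesis L_local_time : is_local_time X L.
Variables (a b : R).
Hypotheses (a0 : 0 <= a) (ab : a < b).

Let t := b - a.
Let A := A1 alpha nu chi.
Let rho := (1 - alpha^-1)^-1.
Let kappa := moment_rate alpha nu chi a b.
Let q := saddle_energy alpha H A t.
Let N (x : R) := x `^ rate_exponent alpha H.
Let us := saddle_time alpha H A t.
Let g := saddle_tilt alpha H A t.
Let U (w : T) := L 0 b w - L 0 a w.
Let M (s : R) := \int[P]_w expR (s * U w).

Let t0 : 0 < t. Proof. by rewrite subr_gt0. Qed.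
Let b0 : 0 <= b. Proof. exact: le_trans (ltW ab). Qed.
Let alpha0 : 0 < alpha. Proof. exact: lt_trans ltr01 alpha1. Qed.
Let A0 : 0 < A. Proof. exact: A1_gt0. Qed.
Let X_levy : is_levy X. Proof. by case: X_stable. Qed.
Let kappa0 : 0 < kappa. Proof. exact: moment_rate_gt0. Qed.
Let rho1 : 1 <= rho. Proof. exact: rho_ge1. Qed.
Let q0 : 0 < q. Proof. exact: expR_gt0. Qed.
Let N0 x : 0 < x -> 0 < N x. Proof. exact: powR_gt0. Qed.
Let us0 x : 0 < x -> 0 < us x. Proof. exact: saddle_time_gt0. Qed.
Let g0 x : 0 < x -> 0 < g x. Proof. exact: saddle_tilt_gt0. Qed.

Let energy x : 0 < x -> x ^+ 2 / us x `^ (2 * H) = N x * q.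
Proof. exact: saddle_gaussian. Qed.

Let moment x : 0 < x -> kappa * g x `^ rho = N x * (H * q / rho).
Proof. exact: saddle_moment. Qed.

Let tilt_time x : 0 < x -> kappa * rho * g x `^ (rho - 1) = us x.
Proof. exact: saddle_tilt_time. Qed.

Let minimum x u : 0 < x -> 0 < u -> N x * q * (2^-1 + H) <= x ^+ 2 / (2 * u `^ (2 * H)) + g x * u.
Proof. exact: saddle_minimum. Qed.

Let rhoE : rho^-1 = 1 - alpha^-1. Proof. by rewrite /rho invrK. Qed.

Let rate : R := q * (2^-1 + H) - H * q / rho.

Lemma rateE : B2 H alpha nu chi a b = rate.
Proof.
rewrite (saddle_rateE alpha H A t alpha1 H0 A0 t0 nu chi a b erefl erefl) -/q /rate rhoE.
by field; rewrite gt_eqF.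
Qed.

Lemma rate_gt0 : 0 < rate.
Proof.
rewrite -rateE (saddle_rateE alpha H A t alpha1 H0 A0 t0 nu chi a b erefl erefl).
by rewrite mulr_gt0// divr_gt0 ?mulr_gt0// addr_gt0// mulr_gt0.
Qed.

Let tail (x : R) : R :=
  fine (P [set w | x < `|local_time_fbm W L b w - local_time_fbm W L a w|]).

Let V s := local_time_version P X s.

Let ctail (x : R) (w : T) : \bar R := P [set v | x < `|W (V b w) v - W (V a w) v|].

Let tailE x : (tail x)%:E = (\int[P]_w ctail x w)%E.
Proof.
rewrite -(time_changed_tail P H W X L W_fbm X_levy L_local_time WX_indep a b x a0 b0).
rewrite /tail fineK// fin_num_measure//; apply: measurable_set_gt.
have mpair : measurable_fun setT (fun w : T => (w, w)) by exact: measurable_fun_pair.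
have mt s : measurable_fun setT (fun w => local_time_fbm W L s w).
  exact: (measurableT_comp (measurable_time_change (L 0 s) (fun u => W u : T -> R)
    (measurable_funPT (L 0 s)) (fun u => measurable_funPT (W u)) (fbm_continuous W_fbm)) mpair).
by apply: (measurableT_comp (@normr_measurable R setT)); exact: measurable_funB.
Qed.

Let mctail x : measurable_fun setT (ctail x).
Proof. exact: (measurable_conditional_tail P H W X W_fbm a b x a0 b0). Qed.

Let ctail_fin x w : ctail x w = (fine (ctail x w))%:E.
Proof.
rewrite fineK// fin_num_measure//; apply: measurable_set_gt.
by apply: (measurableT_comp (@normr_measurable R setT)); exact: measurable_funB.
Qed.

Let versions : {ae P, forall w, [/\ V a w = L 0 a w, V b w = L 0 b w & 0 <= U w]}.
Proof.
near=> w; split; near: w.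
- exact: (local_time_versionE P X L X_levy L_local_time a a0).
- exact: (local_time_versionE P X L X_levy L_local_time b b0).
- exact: (local_time_increment_ge0 P X L X_levy L_local_time a b a0 ab).
Unshelve. all: by end_near. Qed.

Let mU : measurable_fun setT U. Proof. exact: measurable_funB. Qed.

Let iM s : 0 < s -> P.-integrable setT (EFin \o (fun w => expR (s * U w))).
Proof.
exact: (integrable_local_time_moment P X L alpha nu chi a b alpha1 chi0 X_stable L_local_time a0 ab).
Qed.

(** [saddle_minimum] exchanges the Gaussian exponent for the exponential moment at the
    saddle tilt. *)
Lemma tail_le_moment (de x : R) : 0 < de -> de <= 1 -> 0 < x ->
  tail x <= (Num.sqrt de)^-1 * expR (- ((1 - de) * (N x * q * (2^-1 + H)))) * M (g x).
Proof.
move=> de0 de1 x0; have gx := g0 x x0.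
set K := _^-1 * _.
have K0 : 0 <= K by rewrite mulr_ge0 ?expR_ge0// invr_ge0.
rewrite -lee_fin tailE.
have -> : ((K * M (g x))%:E = \int[P]_w (K * expR (g x * U w))%:E)%E.
  have iK := integrableZl measurableT K (iM (g x) gx).
  by rewrite -RintegralZl ?iM// /Rintegral fineK//; exact: integrable_fin_num.
apply: ae_ge0_le_integral => //.
- by move=> w _; rewrite lee_fin mulr_ge0 ?expR_ge0.
- apply/measurable_EFinP; apply: measurable_funM => //.
  by apply: (measurableT_comp (@measurable_expR R)); exact: measurable_funM.
- apply: filterS versions => w [va vb U0] _.
  rewrite ctail_fin lee_fin.
  have [Uz|Un] := eqVneq (U w) 0.
    rewrite (_ : ctail x w = 0%E) ?mulr_ge0 ?expR_ge0//.
    rewrite /ctail va vb (_ : L 0 b w = L 0 a w); last by apply/eqP; rewrite -subr_eq0; exact/eqP.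
    rewrite (_ : [set v | _] = set0) ?measure0//; apply/seteqP; split => // v /=.
    by rewrite subrr normr0 ltNge (ltW x0).
  have Upos : 0 < U w by rewrite lt_neqAle eq_sym Un.
  have VU : V b w - V a w = U w by rewrite va vb.
  have uv : V b w != V a w by rewrite -subr_eq0 VU.
  apply: (le_trans (fbm_tail_upper P H W H0 W_fbm (V b w) (V a w) uv de x de0 de1 (ltW x0))).
  rewrite VU gtr0_norm// /K -[leRHS]mulrA -expRD; apply: ler_wpM2l; first by rewrite invr_ge0.
  rewrite ler_expR.
  have d1 : 0 <= 1 - de by rewrite subr_ge0.
  have h := ler_wpM2l d1 (minimum x (U w) x0 Upos).
  have gU : 0 <= g x * U w by rewrite mulr_ge0 ?(ltW gx).
  have h2 : (1 - de) * (g x * U w) <= g x * U w by rewrite ler_piMl// gerBl ltW.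
  rewrite -[(1 - de) * x ^+ 2 / _]mulrA; rewrite [leRHS]mulrDr in h.
  rewrite lerNl opprD opprK lerBlDr; apply: (le_trans h).
  by rewrite lerD2l.
Qed.

(** The conditional tail increases with the local time increment. *)
Lemma tail_ge_probability (l x : R) : 0 < l -> 0 < x ->
  (Num.sqrt (pi *+ 2))^-1 * expR (- ((x / l `^ H + 1) ^+ 2 / 2)) * fine (P [set w | l <= U w]) <= tail x.
Proof.
move=> l0 x0; set Cp := (Num.sqrt _)^-1; set K := Cp * _.
have Cp0 : 0 <= Cp by rewrite invr_ge0 sqrtr_ge0.
have K0 : 0 <= K by rewrite mulr_ge0 ?expR_ge0.
rewrite -lee_fin tailE.
have mE : measurable [set w | l <= U w].
  by rewrite -[X in measurable X]setTI; exact: (measurable_fun_le _ (measurable_cst l) mU).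
set E := [set w | l <= _] in mE *.
have -> : ((K * fine (P E))%:E = \int[P]_w (K%:E * (\1_E w)%:E))%E.
  rewrite ge0_integralZl_EFin//; last by apply/measurable_EFinP; exact: measurable_indic.
  by rewrite integral_indic// setIT EFinM fineK// fin_num_measure.
apply: ae_ge0_le_integral => //.
- by move=> w _; rewrite -EFinM lee_fin mulr_ge0.
- by apply: measurable_funeM; apply/measurable_EFinP; exact: measurable_indic.
- apply: filterS versions => w [va vb U0] _.
  rewrite -EFinM ctail_fin lee_fin indicE.
  have [/set_mem/= lU|_] := boolP (w \in E); last by rewrite mulr0 fine_ge0.
  rewrite mulr1.
  have Upos : 0 < U w by exact: lt_le_trans lU.
  have VU : V b w - V a w = U w by rewrite va vb.
  have uv : V b w != V a w by rewrite -subr_eq0 VU gt_eqF.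
  apply: le_trans (fbm_tail_lower P H W H0 W_fbm (V b w) (V a w) uv x (ltW x0)).
  rewrite VU (gtr0_norm Upos) /K -/Cp; apply: (ler_wpM2l Cp0).
  rewrite ler_expR lerN2 ler_pM2r ?invr_gt0//.
  have p1 : 0 < l `^ H by rewrite powR_gt0.
  have p2 : 0 < U w `^ H by rewrite powR_gt0.
  rewrite ler_pXn2r ?nnegrE ?addr_ge0 ?divr_ge0 ?(ltW x0) ?(ltW p1) ?(ltW p2)// lerD2r.
  rewrite ler_pM2l// lef_pV2 ?posrE//.
  by apply: ge0_ler_powR; rewrite ?nnegrE ?(ltW H0) ?(ltW l0).
Qed.

Lemma rate_scale_large (B : R) : exists2 x0, 0 < x0 & forall x, x0 <= x -> B <= N x.
Proof.
have p0 : 0 < rate_exponent alpha H.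
  by rewrite divr_gt0 ?mulr_gt0// addr_gt0// mulr_gt0.
pose B1 := Num.max 1 B; have B10 : 0 < B1 by rewrite lt_max ltr01.
exists (B1 `^ (rate_exponent alpha H)^-1); first by rewrite powR_gt0.
move=> x xB; apply: (@le_trans _ _ B1); first by rewrite le_max lexx orbT.
have -> : B1 = (B1 `^ (rate_exponent alpha H)^-1) `^ rate_exponent alpha H.
  by rewrite -powRrM mulVf ?gt_eqF// powRr1// ltW.
by apply: ge0_ler_powR; rewrite ?nnegrE ?powR_ge0 ?(ltW p0)// (le_trans _ xB)// powR_ge0.
Qed.

Let tilt_large (B : R) : exists B', forall x, 0 < x -> B' <= N x -> B <= g x.
Proof.
have r0 : 0 < rho by exact: lt_le_trans rho1.
have c0 : 0 < H * q / rho by rewrite divr_gt0 ?mulr_gt0.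
exists (kappa * (Num.max 1 B) `^ rho / (H * q / rho)) => x x0.
rewrite ler_pdivrMr// -moment// ler_pM2l// => h.
have B1 : 0 < Num.max 1 B by rewrite lt_max ltr01.
apply: (@le_trans _ _ (Num.max 1 B)); first by rewrite le_max lexx orbT.
rewrite leNgt; apply/negP => lt; move: h; rewrite leNgt => /negP; apply.
by apply: gt0_ltr_powR; rewrite ?nnegrE ?(ltW B1) ?(ltW (g0 x x0)).
Qed.

Lemma tail_upper_rate (e : R) : 0 < e -> exists2 x0, 0 < x0 & forall x, x0 <= x ->
  tail x <= expR (- (rate - e) * N x).
Proof.
move=> e0; have r0 : 0 < rho by exact: lt_le_trans rho1.
have c0 : 0 < H * q / rho by rewrite divr_gt0 ?mulr_gt0.
pose C := q * (2^-1 + H) + H * q / rho.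
have C0 : 0 < C by rewrite addr_gt0// mulr_gt0// addr_gt0.
pose de := Num.min 1 (e / (2 * C)).
have de0 : 0 < de by rewrite lt_min ltr01 divr_gt0// mulr_gt0.
have de1 : de <= 1 by rewrite ge_min lexx.
have deC : de * C <= e / 2.
  have : de <= e / (2 * C) by rewrite ge_min lexx orbT.
  exact: mulr_le_half.
have [gm hM] := local_time_moment_upper P X L alpha nu chi a b alpha1 chi0 X_stable L_local_time a0 ab de de0.
have [Bg hg] := tilt_large gm.
pose k := - ln (Num.sqrt de).
have [x0 x00 hx] := rate_scale_large (Num.max Bg (2 * k / e)).
exists x0 => // x xx0; have xpos : 0 < x by exact: lt_le_trans xx0.
have := hx x xx0; rewrite ge_max => /andP[nB nk].
apply: (le_trans (tail_le_moment de x de0 de1 xpos)).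
have -> : (Num.sqrt de)^-1 = expR k by rewrite /k expRN lnK// posrE sqrtr_gt0.
have Mg := hM (g x) (hg x xpos nB) (g0 x xpos).
apply: (@le_trans _ _ (expR k * expR (- ((1 - de) * (N x * q * (2^-1 + H)))) *
    expR ((1 + de) * kappa * g x `^ rho))).
  by apply: ler_wpM2l Mg; rewrite mulr_ge0 ?expR_ge0.
rewrite -!expRD ler_expR -[(1 + de) * kappa * _]mulrA moment//.
have -> : k - (1 - de) * (N x * q * (2^-1 + H)) + (1 + de) * (N x * (H * q / rho)) =
  k + N x * (de * C) - rate * N x by rewrite /C /rate; ring.
have Nd : N x * (de * C) <= N x * (e / 2) by apply: ler_wpM2l deC; exact: ltW (N0 x xpos).
have kN : k <= N x * (e / 2) by exact: le_mulr_half.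
have -> : - (rate - e) * N x = (N x * (e / 2) + N x * (e / 2)) - rate * N x by field.
by rewrite lerD2r lerD.
Qed.

(** [tail_ge_probability] at a level slightly below the saddle time, an event whose
    probability is bounded below by [tail_lower]. *)
Lemma tail_lower_rate (e : R) : 0 < e -> exists2 x0, 0 < x0 & forall x, x0 <= x ->
  expR (- (rate + e) * N x) <= tail x.
Proof.
move=> e0; have r0 : 0 < rho by exact: lt_le_trans rho1.
have c0 : 0 < H * q / rho by rewrite divr_gt0 ?mulr_gt0.
pose C := H * q / rho * (rho + 2) + 4 * q.
have C0 : 0 < C.
  by rewrite /C; apply: addr_gt0; apply: mulr_gt0 => //; exact: addr_gt0.
pose eta := Num.min 4^-1 (e / (2 * C)).
have eta0 : 0 < eta by rewrite lt_min invr_gt0 ltr0n/= divr_gt0// mulr_gt0.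
have eta4 : eta <= 4^-1 by rewrite ge_min lexx.
have eta1 : eta <= 1 by apply: (le_trans eta4); lra.
have etaC : eta * C <= e / 2.
  have : eta <= e / (2 * C) by rewrite ge_min lexx orbT.
  exact: mulr_le_half.
have [gm hP] := tail_lower P U mU iM kappa rho kappa0 rho1
  (local_time_moment_upper P X L alpha nu chi a b alpha1 chi0 X_stable L_local_time a0 ab)
  (local_time_moment_lower P X L alpha nu chi a b alpha1 chi0 X_stable L_local_time a0 ab) eta eta0 eta1.
have [Bg hg] := tilt_large gm.
have s2 : 0 < Num.sqrt (pi *+ 2) :> R by rewrite sqrtr_gt0 mulrn_wgt0// pi_gt0.
pose D : R := ln (Num.sqrt (pi *+ 2)).
pose k := D + (1 + eta^-1) / 2.
have [x0 x00 hx] := rate_scale_large (Num.max Bg (2 * k / e)).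
exists x0 => // x xx0; have xpos : 0 < x by exact: lt_le_trans xx0.
have := hx x xx0; rewrite ge_max => /andP[nB nk].
have d0 : 0 < 1 - eta by rewrite subr_gt0 (le_lt_trans eta4)// invf_lt1// ltr1n.
pose l := (1 - eta) * us x; have l0 : 0 < l by rewrite mulr_gt0 ?us0.
apply: le_trans (tail_ge_probability l x l0 xpos).
have hPx := hP (g x) (hg x xpos nB).
have lE : (1 - eta) * kappa * rho * g x `^ (rho - 1) = l by rewrite /l -tilt_time// !mulrA.
rewrite lE in hPx.
have -> : (Num.sqrt (pi *+ 2))^-1 = expR (- ln (Num.sqrt (pi *+ 2))) :> R.
  by rewrite expRN lnK// posrE.
rewrite -/D.
rewrite -expRD.
apply: le_trans (ler_wpM2l (expR_ge0 _) hPx).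
rewrite -expRD ler_expR.
have -> : kappa * (rho - 1 + (rho + 2) * eta) * g x `^ rho =
    (rho - 1 + (rho + 2) * eta) * (N x * (H * q / rho)) by rewrite -moment//; ring.
have NN := ltW (N0 x xpos).
have yq : (x / l `^ H) ^+ 2 <= (1 + 5 * eta) * (N x * q).
  have l2 : (l `^ H) ^+ 2 = l `^ (2 * H) by rewrite -powR_mulrn ?powR_ge0// -powRrM mulrC.
  rewrite expr_div_n l2 /l.
  rewrite (powRM _ (ltW d0) (ltW (us0 x xpos))) invfM mulrCA energy//.
  by rewrite ler_wpM2r ?powR_inv_bound// mulr_ge0// ltW.
(* Young's inequality for the square of a sum with 1 *)
have ysq : (x / l `^ H + 1) ^+ 2 / 2 <= (1 + eta) * ((1 + 5 * eta) * (N x * q)) / 2 + (1 + eta^-1) / 2.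
  rewrite -mulrDl; apply: ler_wpM2r; first by [].
  apply: (@le_trans _ _ ((1 + eta) * (x / l `^ H) ^+ 2 + (1 + eta^-1))).
    rewrite -subr_ge0; set y := x / _.
    have -> : (1 + eta) * y ^+ 2 + (1 + eta^-1) - (y + 1) ^+ 2 = (eta * y - 1) ^+ 2 / eta.
      by field; rewrite gt_eqF.
    by rewrite divr_ge0 ?sqr_ge0 ?(ltW eta0).
  by rewrite lerD2r; apply: ler_wpM2l => //; rewrite addr_ge0// ltW.
have quad : (1 + eta) * ((1 + 5 * eta) * (N x * q)) / 2 <= (2^-1 + 4 * eta) * (N x * q).
  have -> : (1 + eta) * ((1 + 5 * eta) * (N x * q)) / 2 = ((1 + eta) * (1 + 5 * eta) / 2) * (N x * q).
    by field.
  apply: ler_wpM2r; first by rewrite mulr_ge0// ltW.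
  exact: young_coefficient_bound.
have kN : k <= N x * (e / 2) by exact: le_mulr_half.
have NC : N x * (eta * C) <= N x * (e / 2) by exact: ler_wpM2l.
rewrite mulNr lerNl !opprD !opprK.
have -> : (rate + e) * N x = rate * N x + N x * (e / 2) + N x * (e / 2) by field.
apply: (@le_trans _ _ (D + ((2^-1 + 4 * eta) * (N x * q) + (1 + eta^-1) / 2) +
  (rho - 1 + (rho + 2) * eta) * (N x * (H * q / rho)))).
  by rewrite lerD2r lerD2l; apply: (le_trans ysq); rewrite lerD2r.
have -> : D + ((2^-1 + 4 * eta) * (N x * q) + (1 + eta^-1) / 2) +
  (rho - 1 + (rho + 2) * eta) * (N x * (H * q / rho)) = rate * N x + N x * (eta * C) + k.
  by rewrite /k /rate /C; field; rewrite !gt_eqF.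
by rewrite lerD// lerD2l.
Qed.

Lemma tail_log_limit : ln (tail x) / N x @[x --> +oo] --> - B2 H alpha nu chi a b.
Proof.
rewrite rateE; apply/cvgrPdist_le => e e0.
have [x1 x10 h1] := tail_upper_rate e e0; have [x2 x20 h2] := tail_lower_rate e e0.
near=> x.
have x1x : x1 <= x by near: x; exact: nbhs_pinfty_ge (num_real _).
have x2x : x2 <= x by near: x; exact: nbhs_pinfty_ge (num_real _).
have Nx : 0 < N x by apply: N0; exact: lt_le_trans x1x.
have tx : 0 < tail x by apply: lt_le_trans (h2 x x2x); exact: expR_gt0.
have up : ln (tail x) <= - (rate - e) * N x by rewrite -[leRHS]expRK ler_ln ?posrE ?expR_gt0// h1.
have lo : - (rate + e) * N x <= ln (tail x) by rewrite -[leLHS]expRK ler_ln ?posrE ?expR_gt0// h2.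
by apply: distN_le; [rewrite ler_pdivrMr|rewrite ler_pdivlMr].
Unshelve. all: by end_near. Qed.

End tail_asymptotics.

Theorem theorem1p2 (R : realType) (d : measure_display) (T : measurableType d)
  (P : probability T R) (H alpha nu chi : R)
  (W : R -> {RV P >-> R}) (X : R -> {RV P >-> R}) (L : R -> R -> {RV P >-> R})
  (H_gt0 : 0 < H) (H_lt1 : H < 1)
  (alpha_gt1 : 1 < alpha) (alpha_le2 : alpha <= 2)
  (nu_geN1 : -1 <= nu) (nu_le1 : nu <= 1) (chi_gt0 : 0 < chi)
  (W_fbm : is_fbm H W)
  (X_stable : is_stable_levy alpha nu chi X)
  (WX_indep : independent_processes P [set: R] [set t | 0 <= t] W X)
  (L_local_time : is_local_time X L)
  (a b : R) (a_ge0 : 0 <= a) (a_lt_b : a < b) :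
  0 < B2 H alpha nu chi a b /\
  ln (fine (P [set w | x < `|local_time_fbm W L b w - local_time_fbm W L a w|]))
    / x `^ (2 * alpha / (alpha + 2 * H))
    @[x --> +oo] --> - B2 H alpha nu chi a b.
Proof.
split.
  rewrite (rateE H alpha nu chi H_gt0 alpha_gt1 chi_gt0 a b a_lt_b).
  exact: (rate_gt0 H alpha nu chi H_gt0 alpha_gt1 chi_gt0 a b a_lt_b).
exact: (tail_log_limit P H alpha nu chi W X L H_gt0 H_lt1 alpha_gt1 chi_gt0 W_fbm X_stable WX_indep
  L_local_time a b a_ge0 a_lt_b).
Qed.
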